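(* Let $p:\mathcal{X}\to\mathcal{B}$ be a proper holomorphic submersion between compact complex manifolds, and let $\omega_{\mathcal{X}}$ be a relative Kähler form on $\mathcal{X}$, i.e. a real smooth $d$-closed $(1,1)$-form on $\mathcal{X}$ whose restriction to each fiber $X_z=p^{-1}(z)$, $z\in\mathcal{B}$, is positive. (Negative case) If for every $z\in\mathcal{B}$ the Kähler metric $\omega_{\mathcal{X}}|_{X_z}$ has negative holomorphic sectional curvature, and $\mathcal{B}$ admits a Kähler metric of negative holomorphic sectional curvature, then there exist Kähler metrics on $\mathcal{X}$ with negative holomorphic sectional curvature. (Positive case) If for every $z\in\mathcal{B}$ the Kähler metric $\omega_{\mathcal{X}}|_{X_z}$ has positive holomorphic sectional curvature, and $\mathcal{B}$ admits a Kähler metric of positive holomorphic sectional curvature, then there exist Kähler metrics on $\mathcal{X}$ with positive holomorphic sectional curvature.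
   Context: For a Kähler metric $h$ on a complex manifold $X$ with local holomorphic coordinates $\{x^\alpha\}$, the curvature components are $$R_{\gamma\bar\delta\alpha\bar\beta}=-\partial_\alpha\partial_{\bar\beta}h_{\gamma\bar\delta}+h^{\bar\mu\nu}\,\partial_\alpha h_{\gamma\bar\mu}\,\partial_{\bar\beta}h_{\nu\bar\delta},$$ and the holomorphic sectional curvature along a nonzero $(1,0)$-vector $\xi=\xi^\alpha\partial_\alpha$ is $$H(\xi)=\frac{R_{\gamma\bar\delta\alpha\bar\beta}\,\xi^\alpha\bar\xi^\beta\xi^\gamma\bar\xi^\delta}{(h_{\alpha\bar\beta}\xi^\alpha\bar\xi^\beta)^2}.$$ It is negative (resp. positive) if $H(\xi)<0$ (resp. $H(\xi)>0$) for every nonzero $(1,0)$ tangent vector $\xi$. *)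

(* Defs.v *)
From HB Require Import structures.
From mathcomp Require Import all_boot all_order all_algebra.
From mathcomp Require Import all_classical all_reals all_analysis.
From mathcomp Require Import complex.

Set Implicit Arguments.
Unset Strict Implicit.
Unset Printing Implicit Defensive.

Import Order.TTheory GRing.Theory Num.Theory.
Import numFieldNormedType.Exports.

Local Open Scope classical_set_scope.
Local Open Scope ring_scope.
Local Open Scope complex_scope.

(* R[i] with its norm topology, which the library only provides for an abstract
   numClosedFieldType *)
HB.instance Definition _ (R : rcfType) := NormedModule.copy R[i]
  ((R[i] : numClosedFieldType)^o).

Section Calculus.
Context {R : realType} {n : nat}.
Notation C := R[i].
Notation Cn := 'rV[R[i]]_n.
Implicit Types (f : Cn -> C) (U : set Cn) (x v : Cn) (a : 'I_n).

Definition re_line f x v : R -> R := fun t => complex.Re (f (x + t%:C *: v)).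
Definition im_line f x v : R -> R := fun t => complex.Im (f (x + t%:C *: v)).

(* C^n and C are regarded here as R^(2n) and R^2. *)
Definition rderivable f v x : Prop :=
  derivable (re_line f x v) 0 1 /\ derivable (im_line f x v) 0 1.

Definition rderive v f x : C :=
  Complex (derive1 (re_line f x v) 0) (derive1 (im_line f x v) 0).

Definition ex_ a : Cn := delta_mx 0 a.
Definition ey_ a : Cn := 'i%C *: delta_mx 0 a.

(* d/dz^a = (d/dx^a - i d/dy^a) / 2, d/dzbar^a = (d/dx^a + i d/dy^a) / 2 *)
Definition dz a f x : C :=
  2%:R^-1 * (rderive (ex_ a) f x - 'i%C * rderive (ey_ a) f x).
Definition dzb a f x : C :=
  2%:R^-1 * (rderive (ex_ a) f x + 'i%C * rderive (ey_ a) f x).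

(* C^k on U in the real sense, through the 2n real partial derivatives *)
Fixpoint Ck (k : nat) U f : Prop :=
  (forall x, U x -> {for x, continuous f}) /\
  match k with
  | 0%N => True
  | k'.+1 => forall a,
      [/\ forall x, U x -> rderivable f (ex_ a) x /\ rderivable f (ey_ a) x,
          Ck k' U (rderive (ex_ a) f)
        & Ck k' U (rderive (ey_ a) f)]
  end.

Definition smooth_on U f : Prop := forall k, Ck k U f.

(* the definition of Griffiths-Harris: f is C^oo and dbar f = 0 *)
Definition holomorphic_on U f : Prop :=
  smooth_on U f /\ forall x, U x -> forall a, dzb a f x = 0.

End Calculus.

Definition holomorphic_map_on (R : realType) (n m : nat)
    (U : set 'rV[R[i]]_n) (F : 'rV[R[i]]_n -> 'rV[R[i]]_m) : Prop :=
  forall j, holomorphic_on U (fun x => F x 0 j).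

(* row a is the image of d/dx^a: dF (xi) = xi *m jac F x *)
Definition jac (R : realType) (n m : nat)
    (F : 'rV[R[i]]_n -> 'rV[R[i]]_m) (x : 'rV[R[i]]_n) : 'M[R[i]]_(n, m) :=
  \matrix_(a, j) dz a (fun y => F y 0 j) x.

Section Curvature.
Context {R : realType} {n : nat}.
Notation C := R[i].
(* h x a b stands for h_(a bbar) at x *)
Variable h : 'rV[C]_n -> 'M[C]_n.

(* invmx (h x) mu nu is h^(mubar nu), as
   \sum_nu h^(mubar nu) h_(nu deltabar) = (mu == delta) *)
Definition curv (x : 'rV[C]_n) (g d a b : 'I_n) : C :=
  - dz a (dzb b (fun y => h y g d)) x
  + \sum_mu \sum_nu invmx (h x) mu nu
      * dz a (fun y => h y g mu) x * dzb b (fun y => h y nu d) x.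

Definition herm_sq (x xi : 'rV[C]_n) : C :=
  \sum_a \sum_b h x a b * xi 0 a * Num.conj (xi 0 b).

Definition hsc (x xi : 'rV[C]_n) : C :=
  (\sum_g \sum_d \sum_a \sum_b
     curv x g d a b * xi 0 a * Num.conj (xi 0 b) * xi 0 g * Num.conj (xi 0 d))
  / herm_sq x xi ^+ 2.

End Curvature.

Record chart (R : realType) (T : topologicalType) (n : nat) := Chart {
  cdom : set T;
  cimg : set 'rV[R[i]]_n;
  cmap : T -> 'rV[R[i]]_n;
  cinv : 'rV[R[i]]_n -> T;
  cdom_open : open cdom;
  cimg_open : open cimg;
  cmap_img : forall x, cdom x -> cimg (cmap x);
  cinv_dom : forall t, cimg t -> cdom (cinv t);
  cmapK : forall x, cdom x -> cinv (cmap x) = x;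
  cinvK : forall t, cimg t -> cmap (cinv t) = t;
  cmap_cont : forall x, cdom x -> {for x, continuous cmap};
  cinv_cont : forall t, cimg t -> {for t, continuous cinv} }.

(* expression of F in the charts c and d, and the open set where it is valid *)
Definition rep (R : realType) (T T' : topologicalType) (n m : nat)
    (F : T -> T') (c : chart R T n) (d : chart R T' m) :
  'rV[R[i]]_n -> 'rV[R[i]]_m := fun t => cmap d (F (cinv c t)).

Definition rep_dom (R : realType) (T T' : topologicalType) (n m : nat)
    (F : T -> T') (c : chart R T n) (d : chart R T' m) : set 'rV[R[i]]_n :=
  [set t | cimg c t /\ cdom d (F (cinv c t))].

Record complexManifold (R : realType) (n : nat) := ComplexManifold {
  carrier :> topologicalType;
  atlas : set (chart R carrier n);
  chart_at : carrier -> chart R carrier n;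
  manifold_hausdorff : hausdorff_space carrier;
  manifold_second_countable : @second_countable carrier;
  chart_at_atlas : forall x, atlas (chart_at x);
  chart_at_dom : forall x, cdom (chart_at x) x;
  atlas_holomorphic : forall c d, atlas c -> atlas d ->
    holomorphic_map_on (rep_dom idfun c d) (rep idfun c d) }.

Arguments atlas {R n} _ _.
Arguments chart_at {R n} _ _.

Section Maps.
Context {R : realType} {n m : nat}.
Variables (X : complexManifold R n) (B : complexManifold R m) (p : X -> B).

Definition holomorphic : Prop :=
  continuous p /\
  forall c d, atlas X c -> atlas B d ->
    holomorphic_map_on (rep_dom p c d) (rep p c d).

Definition submersion : Prop :=
  forall c d, atlas X c -> atlas B d ->
    forall t, rep_dom p c d t -> row_full (jac (rep p c d) t).

Definition proper_map : Prop :=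
  forall K : set B, compact K -> compact (p @^-1` K).

(* with the topology induced by X *)
Definition fiber (z : B) : topologicalType := set_type (p @^-1` [set z]).

Definition fiber_incl (z : B) : fiber z -> X := fun x => set_val x.

(* The holomorphic coordinates on X_z as a complex submanifold of X: the charts
   of the topological space X_z in which the inclusion is a holomorphic
   immersion *)
Definition fiber_atlas (z : B) : set (chart R (fiber z) (n - m)) :=
  [set c | forall d, atlas X d ->
    holomorphic_map_on (rep_dom (@fiber_incl z) c d) (rep (@fiber_incl z) c d) /\
    forall t, rep_dom (@fiber_incl z) c d t ->
      row_free (jac (rep (@fiber_incl z) c d) t)].

End Maps.

Arguments fiber_incl {R n m X B} p z _.
Arguments fiber_atlas {R n m X B} p z.

(* A (1,1)-form  i h_(a bbar) dx^a /\ dxbar^b  is given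
    by its coefficient matrices in the charts; only the values w c t with c in
    the atlas and t in cimg c are meaningful. *)

Definition coeffs (R : realType) (T : topologicalType) (n : nat) :=
  chart R T n -> 'rV[R[i]]_n -> 'M[R[i]]_n.

(* (F^* h)_(a bbar) = \sum_(i, j) d_a F^i h_(i jbar) conj (d_b F^j) *)
Definition pull_mx (R : realType) (n m : nat)
    (J : 'M[R[i]]_(n, m)) (h : 'M[R[i]]_m) : 'M[R[i]]_n :=
  J *m h *m (map_mx Num.conj J)^T.

Section Forms.
Context {R : realType} {T : topologicalType} {n : nat}.
Variables (A : set (chart R T n)) (w : coeffs R T n).

Definition form_compatible : Prop :=
  forall c d, A c -> A d -> forall t, rep_dom idfun c d t ->
    w c t = pull_mx (jac (rep idfun c d) t) (w d (rep idfun c d t)).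

Definition form_smooth : Prop :=
  forall c, A c -> forall a b, smooth_on (cimg c) (fun t => w c t a b).

(* conjugating  i h_(a bbar) dx^a /\ dxbar^b  replaces h by its adjoint *)
Definition form_real : Prop :=
  forall c, A c -> forall t, cimg c t ->
    forall a b, w c t a b = Num.conj (w c t b a).

(* vanishing of the coefficients of dx^g /\ dx^a /\ dxbar^b in the (2,1) part
   and of dx^a /\ dxbar^g /\ dxbar^b in the (1,2) part of the differential *)
Definition form_closed : Prop :=
  forall c, A c -> forall t, cimg c t -> forall g a b,
    dz g (fun s => w c s a b) t - dz a (fun s => w c s g b) t = 0 /\
    dzb g (fun s => w c s a b) t - dzb b (fun s => w c s a g) t = 0.

Definition form_positive : Prop :=
  forall c, A c -> forall t, cimg c t ->
    forall xi : 'rV[R[i]]_n, xi != 0 -> 0 < herm_sq (w c) t xi.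

Definition closed_real_form : Prop :=
  [/\ form_compatible, form_smooth, form_real & form_closed].

Definition negative_hsc : Prop :=
  forall c, A c -> forall t, cimg c t ->
    forall xi : 'rV[R[i]]_n, xi != 0 -> hsc (w c) t xi < 0.

Definition positive_hsc : Prop :=
  forall c, A c -> forall t, cimg c t ->
    forall xi : 'rV[R[i]]_n, xi != 0 -> 0 < hsc (w c) t xi.

End Forms.

Definition kahler_metric (R : realType) (n : nat) (X : complexManifold R n)
    (w : coeffs R X n) : Prop :=
  closed_real_form (atlas X) w /\ form_positive (atlas X) w.

Section Relative.
Context {R : realType} {n m : nat}.
Variables (X : complexManifold R n) (B : complexManifold R m) (p : X -> B).
Variable w : coeffs R X n.

(* pull-back of w along the inclusion of the fibre; for a compatible w it does
   not depend on the chart of X used around each point *)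
Definition fiber_restr (z : B) : coeffs R (fiber p z) (n - m) :=
  fun c t =>
    let d := chart_at X (fiber_incl p z (cinv c t)) in
    pull_mx (jac (rep (fiber_incl p z) c d) t)
            (w d (rep (fiber_incl p z) c d t)).

Definition relative_kahler : Prop :=
  closed_real_form (atlas X) w /\
  forall z : B, form_positive (fiber_atlas p z) (@fiber_restr z).

End Relative.

Arguments fiber_restr {R n m X B} p w z.

(* Main.v *)
Require Import Defs.
From mathcomp Require Import all_boot all_order all_algebra.
From mathcomp Require Import all_classical all_reals all_analysis.
From mathcomp Require Import complex ring lra.

(* For a Hermitian metric h and a holomorphic curve with 2-jet (xi, eta) at x, let
   levi h x xi eta be the value there of d dbar |velocity|^2;
   completing the square gives levi = - Q(xi) + |eta + Gamma(xi, xi)|^2, Q being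
   the numerator of the holomorphic sectional curvature. Hence
   "positive definite with negative curvature" means levi > 0 on nonzero 2-jets,
   and, for h > 0, "positive curvature" means that every xi <> 0 has an eta with
   levi < 0. Moreover levi is additive in h and compatible with pull-backs, so for
   w_k = omega + k p^* w_B one has levi(w_k) = levi(omega) + k levi(w_B) o p_*.
   The second term is positive off the 2-jets killed by p_*, which are the 2-jets
   of the fibre, where the first term is controlled by hypothesis; by homogeneity
   2-jets range over a compact set, and a large k works near each point, hence
   everywhere. In the positive case eta is chosen so that the base component of
   the 2-jet is a geodesic jet, on which levi(w_B) = - Q_B. *)

Set Implicit Arguments.
Unset Strict Implicit.
Unset Printing Implicit Defensive.
Import Order.TTheory GRing.Theory Num.Theory.
Import numFieldNormedType.Exports.

Local Open Scope classical_set_scope.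
Local Open Scope ring_scope.

(** * Continuity *)

Local Open Scope complex_scope.

(** The hypotheses on the fibres speak of charts in which the inclusion is a holomorphic immersion,
    so nothing follows from them until such a chart is built through a given point; this is what the
    holomorphic implicit function theorem is for, and the inverse of that chart also lifts the jets
    killed by p_* to the fibre. Jets of curves avoid tensor computations: invariance of the Levi
    form under pull-back is invariance of |velocity|^2 under composition, and its reality is reality
    of that function. In the negative case the sign condition holds for all jets and is open once
    jets are normalized; in the positive case it asks for some eta, so eta must vary continuously
    with the point and with xi, and positive definiteness has to be carried separately.
    Differentiability is phrased through continuous slopes, which turns the product, chain and
    inverse rules into algebraic identities. The facts particular to C (symmetry of second
    derivatives, strict differentiability, compact discs, attained minima) enter as hypotheses on an
    abstract field. *)

Lemma near_forall (T : topologicalType) (I : finType) (P : I -> T -> Prop) (x : T) :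
  (forall i, \forall y \near x, P i y) -> \forall y \near x, forall i, P i y.
Proof. by move=> H; apply: filter_forall. Qed.

Definition cont_at (T U : topologicalType) (f : T -> U) (x : T) : Prop :=
  {for x, continuous f}.

Section Continuity.
Context {C : numFieldType} {T : topologicalType}.
Implicit Types (f g : T -> C) (x : T).

Lemma cont_near_eq (U : topologicalType) (f g : T -> U) x :
  (\forall y \near x, f y = g y) ->
  cont_at f x -> cont_at g x.
Proof.
move=> fg cf; have E : f x = g x := nbhs_singleton fg.
have H : g @ x --> f x.
  apply: cvg_trans cf; apply: near_eq_cvg; exact: fg.
by rewrite /cont_at /prop_for /continuous_at -E.
Qed.

Lemma contD f g x : cont_at f x -> cont_at g x ->
  cont_at (fun y => f y + g y) x.
Proof. by move=> cf cg; apply: (continuousD cf cg). Qed.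

Lemma contM f g x : cont_at f x -> cont_at g x ->
  cont_at (fun y => f y * g y) x.
Proof. by move=> cf cg; apply: (continuousM cf cg). Qed.

Lemma contN f x : cont_at f x -> cont_at (fun y => - f y) x.
Proof. by move=> cf; apply: (continuousN cf). Qed.

Lemma contB f g x : cont_at f x -> cont_at g x ->
  cont_at (fun y => f y - g y) x.
Proof. by move=> cf cg; exact: contD cf (contN cg). Qed.

Lemma near_neq0 f x : cont_at f x -> f x != 0 -> \forall y \near x, f y != 0.
Proof. move=> cf f0; exact: (@cvgr_neq0 _ C^o T (nbhs x) _ f (f x) cf f0). Qed.

Lemma contV f x : f x != 0 ->
  cont_at f x -> cont_at (fun y => (f y)^-1) x.
Proof. by move=> f0 cf; apply: (continuousV f0 cf). Qed.

Lemma cont_sum (I : Type) (r : seq I) (P : pred I) (f : I -> T -> C) x :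
  (forall i, cont_at (f i) x) ->
  cont_at (fun y => \sum_(i <- r | P i) f i y) x.
Proof.
move=> cf; elim: r => [|i r IH].
  under eq_fun do rewrite big_nil; exact: cst_continuous.
under eq_fun do rewrite big_cons; case: (P i); first exact: contD (cf i) IH.
exact: IH.
Qed.

Lemma cont_prod (I : Type) (r : seq I) (P : pred I) (f : I -> T -> C) x :
  (forall i, cont_at (f i) x) ->
  cont_at (fun y => \prod_(i <- r | P i) f i y) x.
Proof.
move=> cf; elim: r => [|i r IH].
  under eq_fun do rewrite big_nil; exact: cst_continuous.
under eq_fun do rewrite big_cons; case: (P i); first exact: contM (cf i) IH.
exact: IH.
Qed.

Lemma cont_mx m n (F : T -> 'M[C]_(m, n)) x :
  (forall i j, cont_at (fun y => F y i j) x) -> cont_at F x.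
Proof.
move=> cF A [P Px PA].
apply: (@filterS _ _ _ [set y | forall i j, P i j (F y i j)]) => [y Py|].
  exact: PA.
apply: filter_forall => i; apply: filter_forall => j.
exact: (cF i j _ (Px i j)).
Qed.

Lemma cont_entry m n (F : T -> 'M[C]_(m, n)) x i j :
  cont_at F x -> cont_at (fun y => F y i j) x.
Proof.
move=> cF; apply: (@continuous_comp _ _ _ F (fun M : 'M[C]_(m, n) => M i j)) => //.
exact: coord_continuous.
Qed.

Lemma cont_mulmx m n p (F : T -> 'M[C]_(m, n)) (G : T -> 'M[C]_(n, p)) x :
  cont_at F x -> cont_at G x ->
  cont_at (fun y => F y *m G y) x.
Proof.
move=> cF cG; apply: cont_mx => i j.
under eq_fun do rewrite mxE.
by apply: cont_sum => k; apply: contM; apply: cont_entry.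
Qed.

Lemma cont_addmx m n (F G : T -> 'M[C]_(m, n)) x :
  cont_at F x -> cont_at G x ->
  cont_at (fun y => F y + G y) x.
Proof. by move=> cF cG; apply: (continuousD cF cG). Qed.

Lemma eq_cont (U : topologicalType) (f g : T -> U) x :
  f =1 g -> cont_at g x -> cont_at f x.
Proof. by move=> /funext ->. Qed.

Lemma cont_cst (U : topologicalType) (c : U) x : cont_at (fun _ : T => c) x.
Proof. exact: cst_continuous. Qed.

Lemma cont_scalemx m n (f : T -> C) (F : T -> 'M[C]_(m, n)) x :
  cont_at f x -> cont_at F x -> cont_at (fun y => f y *: F y) x.
Proof.
move=> cf cF; apply: cont_mx => i j.
apply: (@eq_cont _ _ (fun y => f y * F y i j)) => [y|]; first by rewrite mxE.
by apply: contM => //; exact: cont_entry.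
Qed.

Lemma cont_det n (F : T -> 'M[C]_n) x :
  cont_at F x -> cont_at (fun y => \det (F y)) x.
Proof.
move=> cF; apply: cont_sum => s; apply: contM; first exact: cst_continuous.
by apply: cont_prod => i; apply: cont_entry.
Qed.

Lemma cont_invmx n (F : T -> 'M[C]_n) x : F x \in unitmx ->
  cont_at F x -> cont_at (fun y => invmx (F y)) x.
Proof.
move=> Fx cF; have dF := cont_det cF.
have d0 : \det (F x) != 0 by rewrite -unitfE.
apply: (@cont_near_eq _ (fun y => (\det (F y))^-1 *: \adj (F y))).
  near=> y; rewrite /invmx unitmxE unitfE.
  suff -> : \det (F y) != 0 by [].
  by near: y; apply: (cvgr_neq0 (\det (F x))).
apply: cont_mx => i j; under eq_fun do rewrite !mxE.
apply: contM; first exact: contV.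
rewrite /cofactor; apply: contM; first exact: cst_continuous.
apply: cont_det; apply: cont_mx => k l; under eq_fun do rewrite !mxE.
exact: cont_entry.
Unshelve. all: by end_near.
Qed.

End Continuity.

Lemma near_dist (K : numFieldType) (x : K) (e : K) :
  0 < e -> \forall y \near x, `|x - y| < e.
Proof. by move=> e0; exact: (@cvgr_dist_lt _ K^o _ (nbhs x) _ id x cvg_id). Qed.

Lemma conjC_continuous (K : numClosedFieldType) : continuous (Num.conj : K -> K).
Proof.
move=> z; apply/(@cvgrPdist_lt _ K^o _ (nbhs z) (nbhs_filter z)) => e e0.
near=> w; rewrite -rmorphB norm_conjC; near: w.
exact: near_dist.
Unshelve. all: by end_near.
Qed.

Lemma cont_conj (K : numClosedFieldType) (T : topologicalType) (f : T -> K) x :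
  cont_at f x -> cont_at (fun y => Num.conj (f y)) x.
Proof.
move=> cf; apply: (@continuous_comp _ _ _ f Num.conj) => //.
exact: conjC_continuous.
Qed.

Lemma cont_dist (K : numFieldType) (T : topologicalType) (f : T -> K) x e :
  0 < e -> cont_at f x -> \forall y \near x, `|f y - f x| <= e.
Proof.
move=> e0 cf.
apply: (@filterS _ _ (nbhs_filter x) _ _ _ (cf _ (near_dist _ e0))) => y /=.
by rewrite distrC => /ltW.
Qed.

Lemma near0_pos (K : numFieldType) (P : K -> Prop) :
  (\forall t \near (0 : K), P t) -> exists2 t, 0 < t & P t.
Proof.
move=> /(nbhs_ballP (0 : K) P)[e /= e0 H].
have e20 : 0 < e / 2 by rewrite divr_gt0.
exists (e / 2) => //; apply: H; rewrite /ball/= sub0r normrN gtr0_norm//.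
by rewrite ltr_pdivrMr// ltr_pMr// ltr1n.
Qed.

(* R[i] behind a constant, made opaque below: unification of the concrete
   structures of R[i] is prohibitively slow. *)
Definition complexN (R : realType) : numClosedFieldType := R[i].

Section ComplexTopology.
Context {R : realType}.
Notation C := R[i].

Lemma nearC_dist (z e : C) : 0 < e -> \forall w \near z, `|z - w| < e.
Proof. exact: (@near_dist (complexN R) z e). Qed.

Lemma norm_Re_le (z : C) : `|(complex.Re z)%:C| <= `|z|.
Proof.
rewrite !normc_def /= lecR expr0n addr0 ler_sqrt.
  by rewrite lerDl sqr_ge0.
by rewrite addr_ge0 // sqr_ge0.
Qed.

Lemma norm_Im_le (z : C) : `|(complex.Im z)%:C| <= `|z|.
Proof.
rewrite !normc_def /= lecR expr0n addr0 ler_sqrt.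
  by rewrite lerDr sqr_ge0.
by rewrite addr_ge0 // sqr_ge0.
Qed.

Lemma norm_RC (t : R) : `|t%:C| = `|t|%:C.
Proof. by rewrite normc_def /= expr0n addr0 sqrtr_sqr. Qed.

Lemma gt0_RC (e : C) : 0 < e -> exists2 r : R, 0 < r & e = r%:C.
Proof.
case: e => a b; rewrite ltcE /= => /andP[/eqP -> a0].
by exists a.
Qed.

Lemma ReC_continuous : continuous (@complex.Re R).
Proof.
move=> z; apply/(@cvgrPdist_lt _ _ _ (nbhs z) (nbhs_filter z)) => e e0.
have e0' : 0 < e%:C :> C by rewrite ltcR.
near=> w; rewrite -ltcR -norm_RC raddfB /= -raddfB.
have -> : complex.Re z - complex.Re w = complex.Re (z - w) by case: (z) => ? ?; case: (w).
apply: le_lt_trans (norm_Re_le _) _; near: w.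
exact: nearC_dist.
Unshelve. all: by end_near.
Qed.

Lemma ImC_continuous : continuous (@complex.Im R).
Proof.
move=> z; apply/(@cvgrPdist_lt _ _ _ (nbhs z) (nbhs_filter z)) => e e0.
have e0' : 0 < e%:C :> C by rewrite ltcR.
near=> w; rewrite -ltcR -norm_RC.
have -> : complex.Im z - complex.Im w = complex.Im (z - w) by case: (z) => ? ?; case: (w).
apply: le_lt_trans (norm_Im_le _) _; near: w.
exact: nearC_dist.
Unshelve. all: by end_near.
Qed.

Lemma realC_continuous : continuous (fun t : R => t%:C : C).
Proof.
move=> t; apply/(@cvgrPdist_lt _ _ _ (nbhs t) (nbhs_filter t)) => e /gt0_RC[r r0 ->].
near=> s; rewrite -raddfB norm_RC ltcR; near: s.
exact: (@near_dist R).
Unshelve. all: by end_near.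
Qed.

End ComplexTopology.

Local Close Scope complex_scope.

(** * Wirtinger calculus *)

Section WirtingerDerivatives.
Context {K : numClosedFieldType} {n : nat}.
Implicit Types (f g : 'rV[K]_n -> K) (x y : 'rV[K]_n) (A B : 'I_n -> K).

(* Caratheodory's form of: f is real-differentiable at x with differential
   \sum_j (A j dz_j + B j dzbar_j) *)
Definition wd f x A B : Prop :=
  exists phi psi : 'I_n -> 'rV[K]_n -> K,
    [/\ forall j, cont_at (phi j) x /\ cont_at (psi j) x,
        forall j, phi j x = A j /\ psi j x = B j
      & \forall y \near x, f y = f x + \sum_j
          (phi j y * (y 0 j - x 0 j) + psi j y * Num.conj (y 0 j - x 0 j))].

Lemma cont_coord j x : cont_at (fun y : 'rV[K]_n => y 0 j) x.
Proof. exact: coord_continuous. Qed.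

Lemma cont_coordB j x : cont_at (fun y : 'rV[K]_n => y 0 j - x 0 j) x.
Proof. by apply: contB; [exact: cont_coord|exact: cont_cst]. Qed.

Lemma wd_cont f x A B : wd f x A B -> cont_at f x.
Proof.
move=> [phi [psi [cp _ E]]].
have E' : \forall y \near x, f x + \sum_j
   (phi j y * (y 0 j - x 0 j) + psi j y * Num.conj (y 0 j - x 0 j)) = f y.
  by apply: filterS E => y ->.
apply: cont_near_eq E' _; apply: contD; first exact: cont_cst.
apply: cont_sum => j; have [cphi cpsi] := cp j.
by apply: contD; apply: contM => //; [|apply: cont_conj]; exact: cont_coordB.
Qed.

Lemma wd_near f g x A B :
  (\forall y \near x, f y = g y) -> wd f x A B -> wd g x A B.
Proof.
move=> fg [phi [psi [cp ep E]]]; exists phi, psi; split => //.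
have e := nbhs_singleton fg.
by apply: filterS2 fg E => y <- ->; rewrite e.
Qed.

Lemma eq_wd f x A B A' B' : A =1 A' -> B =1 B' -> wd f x A B -> wd f x A' B'.
Proof. by move=> /funext -> /funext ->. Qed.

Lemma wd_cst c x : wd (fun=> c) x (fun=> 0) (fun=> 0).
Proof.
exists (fun _ _ => 0), (fun _ _ => 0); split => //.
  by move=> j; split; exact: cont_cst.
apply: filterE => y; rewrite big1 ?addr0// => j _.
by rewrite !mul0r addr0.
Qed.

Lemma wd_coord i x :
  wd (fun y => y 0 i) x (fun j => (j == i)%:R) (fun=> 0).
Proof.
exists (fun j _ => (j == i)%:R), (fun _ _ => 0); split => //.
  by move=> j; split; exact: cont_cst.
apply: filterE => y; rewrite (bigD1 i)//= big1 => [|j /negPf ->].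
  by rewrite eqxx mul0r !addr0 mul1r addrC subrK.
by rewrite !mul0r addr0.
Qed.

Lemma wdD f g x A B A' B' : wd f x A B -> wd g x A' B' ->
  wd (fun y => f y + g y) x (fun j => A j + A' j) (fun j => B j + B' j).
Proof.
move=> [p [q [cp ep Ef]]] [p' [q' [cp' ep' Eg]]].
exists (fun j y => p j y + p' j y), (fun j y => q j y + q' j y); split.
- by move=> j; have [??] := cp j; have [??] := cp' j; split; exact: contD.
- by move=> j; have [-> ->] := ep j; have [-> ->] := ep' j.
apply: filterS2 Ef Eg => y -> ->; rewrite addrACA; congr (_ + _).
rewrite -big_split/=; apply: eq_bigr => j _; rewrite !mulrDl; exact: addrACA.
Qed.

Lemma wdM f g x A B A' B' : wd f x A B -> wd g x A' B' ->
  wd (fun y => f y * g y) x (fun j => A j * g x + f x * A' j)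
                            (fun j => B j * g x + f x * B' j).
Proof.
move=> Wf Wg; have cg := wd_cont Wg; move: Wf Wg.
move=> [p [q [cp ep Ef]]] [p' [q' [cp' ep' Eg]]].
exists (fun j y => p j y * g y + f x * p' j y),
       (fun j y => q j y * g y + f x * q' j y); split.
- move=> j; have [??] := cp j; have [??] := cp' j.
  by split; apply: contD; apply: contM => //; exact: cont_cst.
- by move=> j; have [-> ->] := ep j; have [-> ->] := ep' j.
apply: filterS2 Ef Eg => y Ef Eg.
(* Asymmetric splitting of the increment: only the slopes of [f] get a varying factor, [g y], whose
   continuity at [x] is all that is required. *)
rewrite (_ : f y * g y = (f y - f x) * g y + f x * (g y - g x) + f x * g x);
  last by ring.
rewrite {1}Ef {2}Eg ![_ + _ - _]addrC !addKr addrC mulr_suml mulr_sumr.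
rewrite -big_split/=; congr (_ + _); apply: eq_bigr => j _; ring.
Qed.

Lemma wdZ c f x A B : wd f x A B ->
  wd (fun y => c * f y) x (fun j => c * A j) (fun j => c * B j).
Proof.
by move=> /(wdM (wd_cst c x)); apply: eq_wd => j; rewrite mul0r add0r.
Qed.

Lemma wdN f x A B : wd f x A B ->
  wd (fun y => - f y) x (fun j => - A j) (fun j => - B j).
Proof.
move=> /(wdZ (-1)); rewrite (_ : (fun y => -1 * f y) = (fun y => - f y)).
  by apply: eq_wd => j; rewrite mulN1r.
by apply/funext => y; rewrite mulN1r.
Qed.

Lemma wd_sum (I : Type) (r : seq I) (f : I -> 'rV[K]_n -> K) x
    (A B : I -> 'I_n -> K) :
  (forall i, wd (f i) x (A i) (B i)) ->
  wd (fun y => \sum_(i <- r) f i y) x (fun j => \sum_(i <- r) A i j)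
     (fun j => \sum_(i <- r) B i j).
Proof.
move=> W; elim: r => [|i r IH].
  under eq_fun do rewrite big_nil.
  by apply: eq_wd (wd_cst 0 x) => j; rewrite big_nil.
under eq_fun do rewrite big_cons.
by apply: eq_wd (wdD (W i) IH) => j; rewrite big_cons.
Qed.

Lemma wd_conj f x A B : wd f x A B ->
  wd (fun y => Num.conj (f y)) x (fun j => Num.conj (B j))
     (fun j => Num.conj (A j)).
Proof.
move=> [p [q [cp ep E]]].
exists (fun j y => Num.conj (q j y)), (fun j y => Num.conj (p j y)); split.
- by move=> j; have [??] := cp j; split; exact: cont_conj.
- by move=> j; have [-> ->] := ep j.
apply: filterS E => y ->; rewrite rmorphD; congr (_ + _).
rewrite rmorph_sum; apply: eq_bigr => j _.
by rewrite rmorphD !rmorphM/= conjCK addrC.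
Qed.

Lemma wdV f x A B : f x != 0 -> wd f x A B ->
  wd (fun y => (f y)^-1) x (fun j => - A j / f x ^+ 2)
     (fun j => - B j / f x ^+ 2).
Proof.
move=> f0 W; have cf := wd_cont W; have [p [q [cp ep E]]] := W.
exists (fun j y => - p j y * ((f y)^-1 * (f x)^-1)),
       (fun j y => - q j y * ((f y)^-1 * (f x)^-1)); split.
- have cV : cont_at (fun y => (f y)^-1 * (f x)^-1) x.
    by apply: contM; [exact: contV|exact: cont_cst].
  by move=> j; have [??] := cp j; split; apply: contM => //; exact: contN.
- by move=> j; have [-> ->] := ep j; rewrite expr2 invfM.
have fn0 := near_neq0 cf f0.
apply: filterS2 fn0 E => y fy0 E.
have e : (f y)^-1 = (f x)^-1 - (f y - f x) * ((f y)^-1 * (f x)^-1).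
  by field; rewrite fy0 f0.
rewrite {1}e {1}E [_ + _ - _]addrC addKr -mulNr; congr (_ + _).
rewrite -sumrN mulr_suml; apply: eq_bigr => j _; ring.
Qed.

(* Evaluate along the line x + t c e_j, c = 1 or 'i, t > 0 tending to 0 *)
Lemma wd_uniq f x A B A' B' : wd f x A B -> wd f x A' B' ->
  A = A' /\ B = B'.
Proof.
move=> W W'.
have {W W'} := wdD W (wdN W').
move=> /(wd_near (g := fun=> 0)) => /(_ _)[].
  by apply: filterE => y; rewrite subrr.
move=> p [q [cp ep E]].
(* The difference of the two expansions is an expansion of 0. Read along [c] times the j-th basis
   vector it gives this real-linear relation; [c = 1] and [c = 'i] then separate the two
   unknowns. *)
have key j c : c != 0 -> c * (A j - A' j) + Num.conj c * (B j - B' j) = 0.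
  move=> c0; apply/eqP; apply: contraT => nz.
  have cont : cont_at (fun y => c * p j y + Num.conj c * q j y) x.
    have [??] := cp j.
    by apply: contD; apply: contM => //; exact: cont_cst.
  have nz' : \forall y \near x, c * p j y + Num.conj c * q j y != 0.
    by apply: near_neq0 cont _; have [-> ->] := ep j.
  have cl : cont_at (fun t : K => x + t *: (c *: delta_mx 0 j)) 0.
    apply: cont_addmx; first exact: cont_cst.
    by apply: cont_scalemx; [exact: (fun=> id)|exact: cont_cst].
  have x0 : x = x + 0 *: (c *: delta_mx 0 j) by rewrite scale0r addr0.
  rewrite /cont_at /prop_for /continuous_at -x0 in cl.
  have [t t0 H] := near0_pos (@filterI _ _ (nbhs_filter (0 : K)) _ _ (cl _ E) (cl _ nz')).
  case: H => /esym/eqP.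
  rewrite add0r (bigD1 j)//= big1 => [|i ij]; last first.
    by rewrite !mxE (negPf ij) !mulr0 !addr0 subrr conjC0 !mulr0 addr0.
  set y := x + _; rewrite (_ : y 0 j - x 0 j = t * c); last first.
    by rewrite !mxE !eqxx mulr1 addrC addKr.
  rewrite addr0 rmorphM/= (geC0_conj (ltW t0)) ![_ * (t * _)]mulrCA -mulrDr.
  by rewrite mulf_eq0 (gt_eqF t0)/= ![_ * p _ _]mulrC ![_ * q _ _]mulrC => ->.
have {}key j : A j - A' j = 0 /\ B j - B' j = 0.
  have := key j 1 (oner_neq0 _); have := key j 'i (neq0Ci _).
  rewrite conjCi conjC1 !mul1r mulNr -mulrBr => /eqP.
  rewrite mulf_eq0 (negPf (neq0Ci _))/= subr_eq0 => /eqP ->.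
  by move=> /eqP; rewrite -mulr2n mulrn_eq0/= => /eqP ->.
by split; apply/funext => j; apply/eqP; rewrite -subr_eq0;
   have [h1 h2] := key j; rewrite ?h1 ?h2.
Qed.

(* The coefficients of dz_a and dzbar_a in the differential; 0 where f is not
   differentiable. *)
Definition pz (a : 'I_n) f x : K :=
  xget (fun=> 0) [set A | exists B, wd f x A B] a.
Definition pzb (a : 'I_n) f x : K :=
  xget (fun=> 0) [set B | exists A, wd f x A B] a.

Lemma wd_pz f x A B a : wd f x A B -> pz a f x = A a.
Proof.
move=> W; rewrite /pz; case: xgetP => [A' _ [B' W']|/(_ A)[]]; last by exists B.
by have [-> _] := wd_uniq W W'.
Qed.

Lemma wd_pzb f x A B a : wd f x A B -> pzb a f x = B a.
Proof.
move=> W; rewrite /pzb; case: xgetP => [B' _ [A' W']|/(_ B)[]]; last by exists A.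
by have [_ ->] := wd_uniq W W'.
Qed.

Lemma wdE f x A B : wd f x A B -> wd f x (fun a => pz a f x) (fun a => pzb a f x).
Proof.
move=> W; apply: eq_wd (W) => a; first by rewrite (wd_pz a W).
by rewrite (wd_pzb a W).
Qed.

End WirtingerDerivatives.

Section Composition.
Context {K : numClosedFieldType} {n m : nat}.

Lemma wd_comp (f : 'rV[K]_m -> K) (F : 'rV[K]_n -> 'rV[K]_m) x A B P Q :
  wd f (F x) A B -> (forall i, wd (fun y => F y 0 i) x (P i) (Q i)) ->
  wd (fun y => f (F y)) x
     (fun j => \sum_i (A i * P i j + B i * Num.conj (Q i j)))
     (fun j => \sum_i (A i * Q i j + B i * Num.conj (P i j))).
Proof.
move=> [p [q [cp ep E]]] W.
have cF : cont_at F x.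
  by apply: cont_mx => i j; rewrite ord1; exact: wd_cont (W j).
have /choice[p' W'] : forall i, exists p', exists q', [/\
  forall j, cont_at (p' j) x /\ cont_at (q' j) x,
  forall j, p' j x = P i j /\ q' j x = Q i j
  & \forall y \near x, F y 0 i = F x 0 i + \sum_j (p' j y * (y 0 j - x 0 j)
     + q' j y * Num.conj (y 0 j - x 0 j))] by exact: W.
have {W W'}/choice[q' W] := W'.
exists (fun j y => \sum_i (p i (F y) * p' i j y + q i (F y) * Num.conj (q' i j y))),
  (fun j y => \sum_i (p i (F y) * q' i j y + q i (F y) * Num.conj (p' i j y))).
split.
- move=> j; split; apply: cont_sum => i; have [cp' _ _] := W i;
    have [cp1 cp2] := cp' j; have [c1 c2] := cp i;
    have c3 : cont_at (fun y => p i (F y)) x by exact: continuous_comp cF c1.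
    have c4 : cont_at (fun y => q i (F y)) x by exact: continuous_comp cF c2.
    by apply: contD; apply: contM => //; exact: cont_conj.
  have c4 : cont_at (fun y => q i (F y)) x by exact: continuous_comp cF c2.
  by apply: contD; apply: contM => //; exact: cont_conj.
- move=> j; split; apply: eq_bigr => i _; have [_ ep' _] := W i;
  by have [-> ->] := ep' j; have [-> ->] := ep i.
have EF : \forall y \near x, forall i,
   F y 0 i - F x 0 i = \sum_j (p' i j y * (y 0 j - x 0 j)
     + q' i j y * Num.conj (y 0 j - x 0 j)).
  apply: near_forall => i; have [_ _ H] := W i.
  by apply: (@filterS _ _ (nbhs_filter x) _ _ _ H) => y ->; rewrite addrC addKr.
have Ef := cF _ E; apply: filterS2 EF Ef => y /= EF ->; congr (_ + _).
under eq_bigr => i _ do rewrite EF rmorph_sum/= !mulr_sumr -big_split/=.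
rewrite exchange_big/=; apply: eq_bigr => j _.
rewrite !mulr_suml -big_split/=; apply: eq_bigr => i _.
move: (y 0 j - x 0 j) => d; rewrite rmorphD !rmorphM /= conjCK; ring.
Qed.

End Composition.

Section SmoothFunctions.
Context {K : numClosedFieldType} {n : nat}.
Implicit Types (f g : 'rV[K]_n -> K) (x y : 'rV[K]_n) (U : set 'rV[K]_n).

(** The derivatives are quantified existentially, so that closure under an operation is proved by
    exhibiting them; on an open set [WCE] shows that they can be taken to be [pz] and [pzb]. *)
Fixpoint WC (k : nat) U f : Prop :=
  match k with
  | 0%N => forall x, U x -> cont_at f x
  | k'.+1 => exists A B : 'I_n -> 'rV[K]_n -> K,
      (forall x, U x -> wd f x (A^~ x) (B^~ x)) /\
      forall a, WC k' U (A a) /\ WC k' U (B a)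
  end.

Lemma open_near U x : open U -> U x -> \forall y \near x, U y.
Proof. by move=> oU Ux; apply: open_nbhs_nbhs. Qed.

Lemma WC_cont k U f x : WC k U f -> U x -> cont_at f x.
Proof.
case: k => [|k] /=; first by move=> H; exact: H.
by move=> [A [B [W _]]] /W /wd_cont.
Qed.

Lemma WC_weak k U f : WC k.+1 U f -> WC k U f.
Proof.
elim: k f => [|k IH] f; first by move=> H x Ux; exact: WC_cont H Ux.
move=> [A [B [W H]]]; exists A, B; split => // a.
by have [HA HB] := H a; split; apply: IH.
Qed.

Lemma WC_sub k U V f : V `<=` U -> WC k U f -> WC k V f.
Proof.
move=> VU; elim: k f => [|k IH] f; first by move=> H x /VU; exact: H.
move=> [A [B [W H]]]; exists A, B; split; first by move=> x /VU; exact: W.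
by move=> a; have [HA HB] := H a; split; apply: IH.
Qed.

Lemma eq_WC k U f g : open U -> (forall x, U x -> f x = g x) ->
  WC k U f -> WC k U g.
Proof.
move=> oU fg; have nfg x : U x -> \forall y \near x, f y = g y.
  by move=> Ux; apply: (@filterS _ _ (nbhs_filter x) _ _ _ (open_near oU Ux)).
case: k => [|k] /=.
  by move=> H x Ux; apply: cont_near_eq (nfg x Ux) (H x Ux).
move=> [A [B [W H]]]; exists A, B; split => // x Ux.
exact: wd_near (nfg x Ux) (W x Ux).
Qed.

Lemma WCE k U f : open U -> WC k.+1 U f <->
  (forall x, U x -> wd f x (fun a => pz a f x) (fun a => pzb a f x)) /\
  forall a, WC k U (pz a f) /\ WC k U (pzb a f).
Proof.
move=> oU; split=> [[A [B [W H]]]|[W H]]; last first.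
  by exists (fun a => pz a f), (fun a => pzb a f).
split; first by move=> x /W; exact: wdE.
move=> a; have [HA HB] := H a; split.
  by apply: eq_WC oU _ HA => x /W/(@wd_pz _ _ _ _ _ _ a) ->.
by apply: eq_WC oU _ HB => x /W/(@wd_pzb _ _ _ _ _ _ a) ->.
Qed.

Lemma WC_cst k U c : WC k U (fun=> c).
Proof.
elim: k c => [|k IH] c /=; first by move=> x _; exact: cont_cst.
exists (fun _ _ => 0), (fun _ _ => 0); split; first by move=> x _; exact: wd_cst.
by move=> a; split; exact: IH.
Qed.

Lemma WC_coord k U i : WC k U (fun y => y 0 i).
Proof.
case: k => [|k] /=; first by move=> x _; exact: cont_coord.
exists (fun j _ => (j == i)%:R), (fun _ _ => 0); split.
  by move=> x _; exact: wd_coord.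
by move=> a; split; exact: WC_cst.
Qed.

Lemma WCD k U f g : WC k U f -> WC k U g -> WC k U (fun y => f y + g y).
Proof.
elim: k f g => [|k IH] f g.
  by move=> Hf Hg x Ux; apply: contD; [exact: Hf|exact: Hg].
move=> [A [B [W H]]] [A' [B' [W' H']]].
exists (fun a y => A a y + A' a y), (fun a y => B a y + B' a y); split.
  by move=> x Ux; exact: wdD (W x Ux) (W' x Ux).
by move=> a; have [??] := H a; have [??] := H' a; split; apply: IH.
Qed.

Lemma WCM k U f g : WC k U f -> WC k U g -> WC k U (fun y => f y * g y).
Proof.
elim: k f g => [|k IH] f g.
  by move=> Hf Hg x Ux; apply: contM; [exact: Hf|exact: Hg].
move=> Hf Hg; have wf := WC_weak Hf; have wg := WC_weak Hg.
move: Hf Hg => [A [B [W H]]] [A' [B' [W' H']]].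
exists (fun a y => A a y * g y + f y * A' a y),
  (fun a y => B a y * g y + f y * B' a y); split.
  by move=> x Ux; exact: wdM (W x Ux) (W' x Ux).
by move=> a; have [??] := H a; have [??] := H' a; split; apply: WCD; apply: IH.
Qed.

Lemma WCZ k U c f : WC k U f -> WC k U (fun y => c * f y).
Proof. by apply: WCM; exact: WC_cst. Qed.

Lemma WCN k U f : WC k U f -> WC k U (fun y => - f y).
Proof.
move=> /(WCZ (-1)); rewrite (_ : (fun y => -1 * f y) = (fun y => - f y))//.
by apply/funext => y; rewrite mulN1r.
Qed.

Lemma WC_sum k U (I : Type) (r : seq I) (f : I -> 'rV[K]_n -> K) :
  (forall i, WC k U (f i)) -> WC k U (fun y => \sum_(i <- r) f i y).
Proof.
move=> H; elim: r => [|i r IH].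
  by under eq_fun do rewrite big_nil; exact: WC_cst.
by under eq_fun do rewrite big_cons; exact: WCD (H i) IH.
Qed.

Lemma WC_prod k U (I : Type) (r : seq I) (f : I -> 'rV[K]_n -> K) :
  (forall i, WC k U (f i)) -> WC k U (fun y => \prod_(i <- r) f i y).
Proof.
move=> H; elim: r => [|i r IH].
  by under eq_fun do rewrite big_nil; exact: WC_cst.
by under eq_fun do rewrite big_cons; exact: WCM (H i) IH.
Qed.

Lemma WC_conj k U f : WC k U f -> WC k U (fun y => Num.conj (f y)).
Proof.
elim: k f => [|k IH] f.
  by move=> Hf x Ux; apply: cont_conj; exact: Hf.
move=> [A [B [W H]]].
exists (fun a y => Num.conj (B a y)), (fun a y => Num.conj (A a y)); split.
  by move=> x Ux; exact: wd_conj (W x Ux).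
by move=> a; have [??] := H a; split; apply: IH.
Qed.

Lemma WCV k U f : (forall x, U x -> f x != 0) ->
  WC k U f -> WC k U (fun y => (f y)^-1).
Proof.
move=> f0; elim: k => [|k IH].
  by move=> Hf x Ux; apply: contV; [exact: f0|exact: Hf].
move=> Hf; have {}IH := IH (WC_weak Hf); move: Hf => [A [B [W H]]].
exists (fun a y => - A a y * ((f y)^-1 * (f y)^-1)),
  (fun a y => - B a y * ((f y)^-1 * (f y)^-1)); split.
  move=> x Ux; apply: eq_wd (wdV (f0 x Ux) (W x Ux)) => a;
  by rewrite expr2 invfM.
by move=> a; have [??] := H a; split; apply: WCM (WCN _) (WCM _ _).
Qed.

End SmoothFunctions.

Section SmoothComposition.
Context {K : numClosedFieldType}.

Lemma WC_comp n m k (U : set 'rV[K]_n) (V : set 'rV[K]_m) f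
    (F : 'rV[K]_n -> 'rV[K]_m) :
  (forall x, U x -> V (F x)) -> WC k V f -> (forall i, WC k U (fun y => F y 0 i)) ->
  WC k U (fun y => f (F y)).
Proof.
move=> UV; elim: k f => [|k IH] f.
  move=> Hf HF x Ux; apply: (@continuous_comp _ _ _ F f).
    by apply: cont_mx => i j; rewrite ord1; exact: HF.
  exact: Hf (UV x Ux).
move=> [A [B [W H]]] HF.
have {}IH g : WC k V g -> WC k U (fun y => g (F y)).
  by move=> Hg; apply: IH => // i; exact: WC_weak (HF i).
have /choice[P] : forall i, exists P, exists Q : 'I_n -> 'rV[K]_n -> K,
  (forall x, U x -> wd (fun y => F y 0 i) x (P^~ x) (Q^~ x)) /\
  forall a, WC k U (P a) /\ WC k U (Q a) by exact: HF.
move=> /choice[Q HPQ].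
exists (fun j y => \sum_i (A i (F y) * P i j y + B i (F y) * Num.conj (Q i j y))),
  (fun j y => \sum_i (A i (F y) * Q i j y + B i (F y) * Num.conj (P i j y))).
split=> [x Ux|a].
  apply: (wd_comp (W (F x) (UV x Ux))) => i; have [WF _] := HPQ i.
  exact: WF x Ux.
split; apply: WC_sum => i; have [_ /(_ a)[WP WQ]] := HPQ i;
  have [WA WB] := H i; apply: WCD.
- by apply: WCM WP; apply: IH.
- by apply: WCM; [apply: IH|apply: WC_conj].
- by apply: WCM WQ; apply: IH.
- by apply: WCM; [apply: IH|apply: WC_conj].
Qed.

End SmoothComposition.

Section Holomorphic.
Context {K : numClosedFieldType}.

Definition smooth n (U : set 'rV[K]_n) f : Prop := forall k, WC k U f.

Definition hol n (U : set 'rV[K]_n) f : Prop :=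
  smooth U f /\ forall x a, U x -> pzb a f x = 0.

Section OneDomain.
Context {n : nat} (U : set 'rV[K]_n) (oU : open U).
Implicit Types f g : 'rV[K]_n -> K.

Lemma smooth_wd f x : smooth U f -> U x ->
  wd f x (fun a => pz a f x) (fun a => pzb a f x).
Proof. by move=> /(_ 1%N)/(WCE _ _ oU)[W _] /W. Qed.

Lemma smooth_pz f a : smooth U f -> smooth U (pz a f).
Proof. by move=> H k; have /(WCE _ _ oU)[_ /(_ a)[]] := H k.+1. Qed.

Lemma smooth_pzb f a : smooth U f -> smooth U (pzb a f).
Proof. by move=> H k; have /(WCE _ _ oU)[_ /(_ a)[]] := H k.+1. Qed.

Lemma smooth_cont f x : smooth U f -> U x -> cont_at f x.
Proof. by move=> /(_ 0%N); exact: WC_cont. Qed.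

Lemma smooth_sub (V : set 'rV[K]_n) f : V `<=` U -> smooth U f -> smooth V f.
Proof. by move=> VU H k; exact: WC_sub VU (H k). Qed.

Lemma eq_smooth f g : (forall x, U x -> f x = g x) -> smooth U f -> smooth U g.
Proof. by move=> fg H k; exact: eq_WC oU fg (H k). Qed.

Lemma near_pz f g x a : (\forall y \near x, f y = g y) -> pz a f x = pz a g x.
Proof.
move=> fg; rewrite /pz; congr (xget _ _ a); apply/seteqP; split => A [B W].
  by exists B; exact: wd_near W.
by exists B; apply: wd_near W; apply: filterS fg => y ->.
Qed.

Lemma near_pzb f g x a : (\forall y \near x, f y = g y) -> pzb a f x = pzb a g x.
Proof.
move=> fg; rewrite /pzb; congr (xget _ _ a); apply/seteqP; split => A [B W].
  by exists B; exact: wd_near W.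
by exists B; apply: wd_near W; apply: filterS fg => y ->.
Qed.

Lemma eq_pz f g x a : (forall x, U x -> f x = g x) -> U x ->
  pz a f x = pz a g x.
Proof.
move=> fg Ux; apply: near_pz.
exact: (@filterS _ _ (nbhs_filter x) _ _ fg (open_near oU Ux)).
Qed.

Lemma eq_pzb f g x a : (forall x, U x -> f x = g x) -> U x ->
  pzb a f x = pzb a g x.
Proof.
move=> fg Ux; apply: near_pzb.
exact: (@filterS _ _ (nbhs_filter x) _ _ fg (open_near oU Ux)).
Qed.

Lemma eq_hol f g : (forall x, U x -> f x = g x) -> hol U f -> hol U g.
Proof.
move=> fg [sf hf]; split; first exact: eq_smooth sf.
by move=> x a Ux; rewrite -(eq_pzb a fg Ux); exact: hf.
Qed.

Lemma hol_wd f x : hol U f -> U x -> wd f x (fun a => pz a f x) (fun=> 0).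
Proof.
move=> [sf hf] Ux; apply: eq_wd (smooth_wd sf Ux) => // a; exact: hf.
Qed.

Lemma hol_sub (V : set 'rV[K]_n) f : V `<=` U -> hol U f -> hol V f.
Proof.
by move=> VU [sf hf]; split; [exact: smooth_sub sf|move=> x a /VU; exact: hf].
Qed.

Lemma holP f (A : 'I_n -> 'rV[K]_n -> K) :
  smooth U f -> (forall x, U x -> wd f x (A^~ x) (fun=> 0)) -> hol U f.
Proof. by move=> sf W; split => // x a /W /(@wd_pzb _ _ _ _ _ _ a). Qed.

End OneDomain.

Lemma smooth_comp n m (U : set 'rV[K]_n) (V : set 'rV[K]_m) f
    (F : 'rV[K]_n -> 'rV[K]_m) :
  (forall x, U x -> V (F x)) -> smooth V f ->
  (forall i, smooth U (fun y => F y 0 i)) -> smooth U (fun y => f (F y)).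
Proof. by move=> UV Hf HF k; apply: WC_comp UV (Hf k) _ => i; exact: HF. Qed.

Lemma hol_comp n m (U : set 'rV[K]_n) (V : set 'rV[K]_m) f
    (F : 'rV[K]_n -> 'rV[K]_m) : open U -> open V ->
  (forall x, U x -> V (F x)) -> hol V f -> (forall i, hol U (fun y => F y 0 i)) ->
  hol U (fun y => f (F y)).
Proof.
move=> oU oV UV hf hF; apply: (holP (A := fun j x =>
   \sum_i pz i f (F x) * pz j (fun y => F y 0 i) x)).
  by apply: smooth_comp UV hf.1 _ => i; exact: (hF i).1.
move=> x Ux.
apply: eq_wd (wd_comp (hol_wd oV hf (UV x Ux)) (fun i => hol_wd oU (hF i) Ux)).
  by move=> j; apply: eq_bigr => i _; rewrite mul0r addr0.
by move=> j; rewrite big1 // => i _; rewrite mulr0 mul0r addr0.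
Qed.

End Holomorphic.

(** * 2-jets of holomorphic curves and the Levi form *)

Section SecondJets.
Context {K : numClosedFieldType}.

Definition jacobian n m (F : 'rV[K]_n -> 'rV[K]_m) x : 'M[K]_(n, m) :=
  \matrix_(a, j) pz a (fun y => F y 0 j) x.

Definition hol_map n m (U : set 'rV[K]_n) (F : 'rV[K]_n -> 'rV[K]_m) :=
  forall j, hol U (fun y => F y 0 j).

(** The quadratic part of the push-forward of 2-jets: [F] sends [(xi, eta)] at [x] to [(xi *m
    jacobian F x, eta *m jacobian F x + hess F x xi)]. *)
Definition hess n m (F : 'rV[K]_n -> 'rV[K]_m) x (xi : 'rV[K]_n) : 'rV[K]_m :=
  \row_j \sum_a \sum_b
    pz b (pz a (fun y => F y 0 j)) x * xi 0 b * xi 0 a.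

Definition pull n m (J : 'M[K]_(n, m)) (h : 'M[K]_m) : 'M[K]_n :=
  J *m h *m (map_mx Num.conj J)^T.

(* For a holomorphic curve g with g 0 = x, g' 0 = xi and g'' 0 = eta, this is
   the value at 0 of d/dz d/dzbar |g'|^2. *)
Definition levi n (h : 'rV[K]_n -> 'M[K]_n) x (xi eta : 'rV[K]_n) : K :=
  \sum_g \sum_d
   ((\sum_b (\sum_a pz a (pzb b (fun y => h y g d)) x * xi 0 a)
        * Num.conj (xi 0 b)) * (xi 0 g * Num.conj (xi 0 d))
    + (\sum_b pzb b (fun y => h y g d) x * Num.conj (xi 0 b))
        * (eta 0 g * Num.conj (xi 0 d))
    + ((\sum_a pz a (fun y => h y g d) x * xi 0 a)
        * (xi 0 g * Num.conj (eta 0 d))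
    + h x g d * (eta 0 g * Num.conj (eta 0 d)))).

(* The symmetry of second derivatives, like the other analytic facts about C
   below, is a hypothesis on K, established for complexN R only. *)
Definition schwarz : Prop :=
  forall n (U : set 'rV[K]_n) f x, open U -> smooth U f -> U x ->
  forall a b, pz a (pz b f) x = pz b (pz a f) x /\
              pzb a (pz b f) x = pz b (pzb a f) x.

Hypothesis K_schwarz : schwarz.

(** d/dzbar commutes with d/dz, hence kills [pz a f] as soon as it kills [f]. *)
Lemma hol_pz n (U : set 'rV[K]_n) f a : open U -> hol U f -> hol U (pz a f).
Proof.
move=> oU [sf hf]; split; first exact: smooth_pz.
move=> x b Ux; have [_ ->] := K_schwarz oU sf Ux b a.
rewrite (eq_pz (g := fun=> 0) oU _ _ Ux) => [|y Uy]; last exact: hf.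
exact: wd_pz (wd_cst 0 x).
Qed.

Lemma wd_comp_hol n m (f : 'rV[K]_m -> K) (F : 'rV[K]_n -> 'rV[K]_m) x A B P :
  wd f (F x) A B -> (forall i, wd (fun y => F y 0 i) x (P i) (fun=> 0)) ->
  wd (fun y => f (F y)) x (fun j => \sum_i A i * P i j)
     (fun j => \sum_i B i * Num.conj (P i j)).
Proof.
move=> Wf WF; apply: eq_wd (wd_comp Wf WF) => j; apply: eq_bigr => i _.
  by rewrite conjC0 mulr0 addr0.
by rewrite mulr0 add0r.
Qed.

Lemma wd_conj_hol n (f : 'rV[K]_n -> K) x A : wd f x A (fun=> 0) ->
  wd (fun y => Num.conj (f y)) x (fun=> 0) (fun j => Num.conj (A j)).
Proof. by move=> W; apply: eq_wd (wd_conj W) => j //; rewrite conjC0. Qed.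

Definition vel n (s : 'rV[K]_1 -> 'rV[K]_n) z : 'rV[K]_n :=
  \row_j pz 0 (fun y => s y 0 j) z.

Lemma hol_vel n (O : set 'rV[K]_1) (s : 'rV[K]_1 -> 'rV[K]_n) :
  open O -> hol_map O s -> hol_map O (vel s).
Proof. by move=> oO hs j; under eq_fun do rewrite mxE; apply: hol_pz. Qed.

Lemma wd_vel n (O : set 'rV[K]_1) (s : 'rV[K]_1 -> 'rV[K]_n) y i :
  open O -> hol_map O s -> O y ->
  wd (fun u => s u 0 i) y (fun=> vel s y 0 i) (fun=> 0).
Proof.
by move=> oO hs Oy; apply: eq_wd (hol_wd oO (hs i) Oy) => // a; rewrite mxE ord1.
Qed.

(** The velocity is holomorphic, so d/dzbar meets only the metric and the conjugate velocity, and
    d/dz then produces exactly the four groups of terms of [levi]. Invariance and reality of [levi]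
    are both read off the left-hand side. *)
Lemma levi_curve n (U : set 'rV[K]_n) (O : set 'rV[K]_1)
    (h : 'rV[K]_n -> 'M[K]_n) (s : 'rV[K]_1 -> 'rV[K]_n) z :
  open U -> open O -> (forall y, O y -> U (s y)) ->
  (forall g d, smooth U (fun y => h y g d)) -> hol_map O s -> O z ->
  pz 0 (pzb 0 (fun y => \sum_g \sum_d
    h (s y) g d * (vel s y 0 g * Num.conj (vel s y 0 d)))) z =
  levi h (s z) (vel s z) (vel (vel s) z).
Proof.
move=> oU oO OU sh hs Oz.
have hv := hol_vel oO hs; have hvv := hol_vel oO hv.
have Ws y i := wd_vel i oO hs (y := y); have Wv y i := wd_vel i oO hv (y := y).
have Wvc y i : O y ->
    wd (fun u => Num.conj (vel s u 0 i)) y (fun=> 0)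
       (fun=> Num.conj (vel (vel s) y 0 i)).
  by move=> Oy; apply: wd_conj_hol; exact: Wv.
have Wc f y : O y -> smooth U f -> wd (fun u => f (s u)) y
    (fun=> \sum_i pz i f (s y) * vel s y 0 i)
    (fun=> \sum_i pzb i f (s y) * Num.conj (vel s y 0 i)).
  move=> Oy sf; apply: eq_wd (wd_comp_hol (smooth_wd oU sf (OU y Oy))
    (fun i => Ws y i Oy)) => //.
(* The antiholomorphic derivative of one term of the squared velocity. *)
pose H g d u := (\sum_b pzb b (fun y => h y g d) (s u) * Num.conj (vel s u 0 b))
    * (vel s u 0 g * Num.conj (vel s u 0 d))
  + h (s u) g d * (vel s u 0 g * Num.conj (vel (vel s) u 0 d)).
rewrite (eq_pz (g := fun u => \sum_g \sum_d H g d u) oO _ _ Oz); last first.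
  move=> y Oy; have W g d := wdM (Wc _ y Oy (sh g d)) (wdM (Wv y g Oy) (Wvc y d Oy)).
  rewrite (wd_pzb 0 (wd_sum (index_enum _)
    (fun g => wd_sum (index_enum _) (fun d => W g d)))).
  by apply: eq_bigr => g _; apply: eq_bigr => d _; rewrite /H mul0r add0r.
have Wb g d b := wdM (Wc _ z Oz (smooth_pzb oU b (sh g d))) (Wvc z b Oz).
have W1 g d := wdM (wd_sum (index_enum _) (Wb g d)) (wdM (Wv z g Oz) (Wvc z d Oz)).
have Wvvc i := wd_conj_hol (wd_vel i oO hvv Oz).
have W2 g d := wdM (Wc _ z Oz (sh g d)) (wdM (Wv z g Oz) (Wvvc d)).
rewrite (wd_pz 0 (wd_sum (index_enum _)
    (fun g => wd_sum (index_enum _) (fun d => wdD (W1 g d) (W2 g d))))).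
apply: eq_bigr => g _; apply: eq_bigr => d _.
rewrite !mulr0 !addr0; congr (_ * _ + _ + _).
by apply: eq_bigr => b _; rewrite mulr0 addr0.
Qed.

(** A holomorphic curve realizing an arbitrary 2-jet at 0; the factor 1/2 makes [eta] its second
    derivative. *)
Definition parab n (x xi eta : 'rV[K]_n) (s : 'rV[K]_1) : 'rV[K]_n :=
  x + s 0 0 *: xi + (2^-1 * (s 0 0 * s 0 0)) *: eta.

Lemma parab0 n (x xi eta : 'rV[K]_n) : parab x xi eta 0 = x.
Proof. by rewrite /parab !mxE !mul0r mulr0 !scale0r !addr0. Qed.

Lemma wd_parab n (x xi eta : 'rV[K]_n) s j :
  wd (fun u => parab x xi eta u 0 j) s (fun=> (xi + s 0 0 *: eta) 0 j) (fun=> 0).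
Proof.
have W := wdD (wdD (wd_cst (x 0 j) s) (wdM (wd_coord 0 s) (wd_cst (xi 0 j) s)))
  (wdM (wdZ 2^-1 (wdM (wd_coord 0 s) (wd_coord 0 s))) (wd_cst (eta 0 j) s)).
apply: (wd_near (f := fun u : 'rV[K]_1 => x 0 j + u 0 0 * xi 0 j +
  2^-1 * (u 0 0 * u 0 0) * eta 0 j)).
  by apply: filterE => u; rewrite !mxE.
apply: eq_wd W => a.
  by rewrite !mxE ord1 eqxx mulr1n; field.
by rewrite !(mulr0, mul0r, addr0).
Qed.

Lemma hol_parab n (x xi eta : 'rV[K]_n) O : hol_map O (parab x xi eta).
Proof.
move=> j; apply: (holP (A := fun _ s => (xi + s 0 0 *: eta) 0 j)) => [k|s _].
  apply: (WC_sub (U := setT)) => //.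
  apply: (eq_WC (f := fun u : 'rV[K]_1 => x 0 j + u 0 0 * xi 0 j +
    2^-1 * (u 0 0 * u 0 0) * eta 0 j)); first exact: openT.
    by move=> u _; rewrite !mxE.
  by repeat (apply: WCD || apply: WCM || apply: WC_cst || apply: WC_coord).
exact: wd_parab.
Qed.

Lemma vel_parab n (x xi eta : 'rV[K]_n) s : vel (parab x xi eta) s = xi + s 0 0 *: eta.
Proof. by apply/rowP => j; rewrite [LHS]mxE (wd_pz 0 (wd_parab _ _ _ _ _)). Qed.

Lemma vel_parab0 n (x xi eta : 'rV[K]_n) : vel (parab x xi eta) 0 = xi.
Proof. by rewrite vel_parab mxE scale0r addr0. Qed.

Lemma vel2_parab n (x xi eta : 'rV[K]_n) s : vel (vel (parab x xi eta)) s = eta.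
Proof.
apply/rowP => j; rewrite [LHS]mxE.
under [X in pz _ X]eq_fun do rewrite vel_parab !mxE.
have W := wdD (wd_cst (xi 0 j) s) (wdM (wd_coord 0 s) (wd_cst (eta 0 j) s)).
by rewrite (wd_pz 0 W) eqxx mulr0 addr0 add0r mul1r.
Qed.

Lemma cont_parab n (x xi eta : 'rV[K]_n) s : cont_at (parab x xi eta) s.
Proof.
apply: cont_addmx; first apply: cont_addmx; first exact: cont_cst.
  by apply: cont_scalemx; [exact: cont_coord|exact: cont_cst].
apply: cont_scalemx; last exact: cont_cst.
apply: contM; first exact: cont_cst.
by apply: contM; exact: cont_coord.
Qed.

Section Pullback.
Context {n m : nat} (U : set 'rV[K]_n) (V : set 'rV[K]_m).
Hypotheses (oU : open U) (oV : open V).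
Variables (F : 'rV[K]_n -> 'rV[K]_m).
Hypotheses (UV : forall y, U y -> V (F y)) (hF : hol_map U F).

Lemma vel_comp (O : set 'rV[K]_1) s z : open O -> (forall y, O y -> U (s y)) ->
  hol_map O s -> O z -> vel (fun u => F (s u)) z = vel s z *m jacobian F (s z).
Proof.
move=> oO OU hs Oz; apply/rowP => j; rewrite [LHS]mxE mxE.
rewrite (wd_pz 0 (wd_comp_hol (hol_wd oU (hF j) (OU z Oz))
  (fun i => wd_vel i oO hs Oz))).
by apply: eq_bigr => i _; rewrite [jacobian _ _ _ _]mxE mulrC.
Qed.

Lemma jet_comp x xi eta : U x ->
  let c := fun u => F (parab x xi eta u) in
  vel c 0 = xi *m jacobian F x /\
  vel (vel c) 0 = eta *m jacobian F x + hess F x xi.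
Proof.
move=> Ux c; pose s := parab x xi eta; pose O := s @^-1` U.
have oO : open O by apply: open_comp => // y _; exact: cont_parab.
have O0 : O 0 by rewrite /O/= /s parab0.
have vc z : O z -> vel c z = vel s z *m jacobian F (s z).
  by move=> Oz; apply: (vel_comp oO (fun y => id) _ Oz); exact: hol_parab.
split; first by rewrite vc// vel_parab0 /s parab0.
apply/rowP => j; rewrite [LHS]mxE.
have v0 y : O y -> vel c y 0 j = \sum_a vel s y 0 a * pz a (fun y => F y 0 j) (s y).
  move=> Oy; rewrite vc// [LHS]mxE; apply: eq_bigr => a _.
  by rewrite [jacobian _ _ _ _]mxE.
rewrite (eq_pz oO 0 v0 O0).
have Wv a := wd_vel a oO (hol_vel oO (hol_parab x xi eta O)) O0.
have Ws a := wd_vel a oO (hol_parab x xi eta O) O0.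
have Wp a := hol_wd oU (hol_pz a oU (hF j)) O0.
rewrite (wd_pz 0 (wd_sum (index_enum _) (fun a => wdM (Wv a) (wd_comp_hol (Wp a) Ws)))).
rewrite vel2_parab [in RHS]mxE [in RHS]mxE [X in _ = _ + X]mxE -big_split/=.
apply: eq_bigr => a _; rewrite [jacobian _ _ _ _]mxE /s parab0; congr (_ + _).
rewrite mulr_sumr; apply: eq_bigr => b _.
by rewrite !vel_parab0 mulrC.
Qed.

(** A parabola with 2-jet [(xi, eta)] measured by [h'] and its image under [F] measured by [h] have
    the same squared velocity at every parameter, so [levi_curve] computes both sides from one
    function. *)
Lemma levi_pull (h : 'rV[K]_m -> 'M[K]_m) (h' : 'rV[K]_n -> 'M[K]_n) x xi eta :
  (forall g d, smooth V (fun y => h y g d)) ->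
  (forall y, U y -> h' y = pull (jacobian F y) (h (F y))) ->
  (forall g d, smooth U (fun y => h' y g d)) -> U x ->
  levi h' x xi eta =
  levi h (F x) (xi *m jacobian F x) (eta *m jacobian F x + hess F x xi).
Proof.
move=> sh hh' sh' Ux; pose s := parab x xi eta; pose O := s @^-1` U.
have oO : open O by apply: open_comp => // y _; exact: cont_parab.
have O0 : O 0 by rewrite /O/= /s parab0.
have [v1 v2] := jet_comp xi eta Ux.
have hs := hol_parab x xi eta O.
have hFs : hol_map O (fun u => F (s u)).
  by move=> j; apply: (hol_comp oO oU (fun y => id) (hF j)) => i; exact: hs.
have L1 := levi_curve oU oO (fun y => id) sh' hs O0.
have L2 := levi_curve oV oO (fun y Oy => UV Oy) sh hFs O0.
rewrite vel_parab0 vel2_parab -/s in L1.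
rewrite -v1 -v2 -{1 2}(parab0 x xi eta) -/s -L1 -L2.
apply: (eq_pz oO _ _ O0) => y Oy; apply: near_pzb.
apply: (@filterS _ _ (nbhs_filter y) _ _ _ (open_near oO Oy)) => u Ou.
have sumE k (M : 'M[K]_k) (v : 'rV[K]_k) :
    \sum_g \sum_d M g d * (v 0 g * Num.conj (v 0 d)) =
    (v *m M *m (map_mx Num.conj v)^T) 0 0.
  rewrite exchange_big mxE; apply: eq_bigr => d _; rewrite mxE mulr_suml.
  by apply: eq_bigr => g _; rewrite !mxE; ring.
rewrite !sumE (vel_comp oO (fun y => id) hs Ou) hh'// /pull.
by rewrite map_mxM trmx_mul !mulmxA.
Qed.

End Pullback.

End SecondJets.

(** * The Levi form and the curvature *)

Section HermitianForms.
Context {K : numClosedFieldType}.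

Definition hq n (M : 'M[K]_n) (xi : 'rV[K]_n) : K :=
  \sum_a \sum_b M a b * xi 0 a * Num.conj (xi 0 b).

Lemma hqE n (M : 'M[K]_n) v : hq M v = (v *m M *m (map_mx Num.conj v)^T) 0 0.
Proof.
rewrite /hq exchange_big mxE; apply: eq_bigr => d _; rewrite mxE mulr_suml.
by apply: eq_bigr => g _; rewrite !mxE; ring.
Qed.

Lemma hq_pull n m (J : 'M[K]_(n, m)) (M : 'M[K]_m) v :
  hq (pull J M) v = hq M (v *m J).
Proof. by rewrite !hqE /pull map_mxM trmx_mul !mulmxA. Qed.

Lemma hq0 n (M : 'M[K]_n) : hq M 0 = 0.
Proof. by rewrite hqE !mul0mx mxE. Qed.

Definition pos_def n (M : 'M[K]_n) := forall v, v != 0 -> 0 < hq M v.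

Definition hermitian n (M : 'M[K]_n) := forall a b, M a b = Num.conj (M b a).

(** A nonzero row of the kernel would be a nonzero vector of norm 0. *)
Lemma pos_def_unit n (M : 'M[K]_n) : pos_def M -> M \in unitmx.
Proof.
move=> pM; rewrite -row_free_unit -kermx_eq0; apply/eqP/row_matrixP => i.
rewrite row0; apply/eqP; apply: contraT => /pM.
by rewrite hqE -row_mul mulmx_ker row0 mul0mx mxE ltxx.
Qed.

Lemma pos_def_ge0 n (M : 'M[K]_n) v : pos_def M -> 0 <= hq M v.
Proof. by move=> pM; have [->|/pM/ltW//] := eqVneq v 0; rewrite hq0. Qed.

Lemma hermitianE n (M : 'M[K]_n) : hermitian M -> (map_mx Num.conj M)^T = M.
Proof. by move=> hM; apply/matrixP => a b; rewrite !mxE [RHS]hM. Qed.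

Lemma invmx_hermitian n (M : 'M[K]_n) : hermitian M -> hermitian (invmx M).
Proof.
move=> /hermitianE hM a b.
by rewrite -{1}hM -trmx_inv -map_invmx !mxE.
Qed.

Lemma pull_hermitian n m (J : 'M[K]_(n, m)) (M : 'M[K]_m) :
  hermitian M -> hermitian (pull J M).
Proof.
move=> /hermitianE hM a b; rewrite /pull.
rewrite -[in LHS]hM; set J' := map_mx _ J.
have -> : J *m (map_mx Num.conj M)^T *m J'^T =
  (map_mx Num.conj (J *m M *m J'^T))^T.
  rewrite !map_mxM !trmx_mul mulmxA; congr (_ *m _ *m _).
  by apply/matrixP => i j; rewrite /J' !mxE /= conjCK.
by rewrite !mxE.
Qed.

End HermitianForms.

(** Factors the part of the curvature that is quadratic in first derivatives, contracted with four
    vectors, into row times inverse metric times column. *)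
Lemma sum_contract (K : comPzRingType) n (P Q : 'I_n -> 'I_n -> 'I_n -> K)
    (M : 'M[K]_n) :
  \sum_g \sum_d \sum_b \sum_a \sum_mu \sum_nu M mu nu * P a g mu * Q b d nu =
  \sum_mu \sum_nu M mu nu * (\sum_a \sum_g P a g mu) * (\sum_b \sum_d Q b d nu).
Proof.
under eq_bigr => g _ do under eq_bigr => d _ do rewrite pair_big/=.
rewrite pair_big/=.
under eq_bigr => p _ do under eq_bigr => q _ do rewrite pair_big/=.
rewrite exchange_big/=; under eq_bigr => q _ do rewrite exchange_big/=.
rewrite exchange_big/= [RHS]pair_big/=; apply: eq_bigr => -[mu nu] _ /=.
rewrite -(pair_big xpredT xpredT (fun b a => \sum_j
  M mu nu * P a j.1 mu * Q b j.2 nu))/=.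
rewrite -mulrA mulr_suml mulr_sumr exchange_big/=; apply: eq_bigr => a _.
rewrite mulr_suml !mulr_sumr.
under eq_bigr => b _ do rewrite -(pair_big xpredT xpredT (fun g d =>
  M mu nu * P a g mu * Q b d nu))/=.
rewrite exchange_big/=; apply: eq_bigr => g _; rewrite !mulr_sumr.
apply: eq_bigr => b _; rewrite !mulr_sumr.
by apply: eq_bigr => d _; rewrite mulrA.
Qed.

Section CurvatureForm.
Context {K : numClosedFieldType} {n : nat}.
Variable h : 'rV[K]_n -> 'M[K]_n.

Definition riem (x : 'rV[K]_n) (g d a b : 'I_n) : K :=
  - pz a (pzb b (fun y => h y g d)) x
  + \sum_mu \sum_nu invmx (h x) mu nu
      * pz a (fun y => h y g mu) x * pzb b (fun y => h y nu d) x.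

(* the numerator of the holomorphic sectional curvature *)
Definition quart (x xi : 'rV[K]_n) : K :=
  \sum_g \sum_d \sum_a \sum_b
     riem x g d a b * xi 0 a * Num.conj (xi 0 b) * xi 0 g * Num.conj (xi 0 d).

(** The vector Gamma(xi, xi), with the first derivatives of [h] raised by the inverse metric;
    [- christoffel h x xi] is the second-order part of a geodesic jet. *)
Definition christoffel (x xi : 'rV[K]_n) : 'rV[K]_n :=
  (\row_d \sum_a \sum_g pz a (fun y => h y g d) x * xi 0 a * xi 0 g)
  *m invmx (h x).

Lemma wd_hermitian (U : set 'rV[K]_n) x g d a : open U -> U x ->
  (forall y, U y -> hermitian (h y)) -> smooth U (fun y => h y d g) ->
  pzb a (fun y => h y g d) x = Num.conj (pz a (fun y => h y d g) x).
Proof.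
move=> oU Ux hh sh.
rewrite (eq_pzb (g := fun y => Num.conj (h y d g)) oU _ _ Ux); last first.
  by move=> y /hh ->.
by rewrite (wd_pzb a (wd_conj (smooth_wd oU sh Ux))).
Qed.

(** With [D] the contraction of the first derivatives of [h] with [xi] twice, [levi] is a
    second-derivative term plus the cross terms of [eta] with [D] plus the norm of [eta]. Completing
    the square costs [D] times the inverse metric times the adjoint of [D], which is precisely the
    second term of the curvature. Hermitian symmetry of [h] identifies the dbar-derivatives with the
    adjoint of [D]. *)
Lemma levi_square (U : set 'rV[K]_n) x xi eta : open U -> U x ->
  (forall y, U y -> hermitian (h y)) ->
  (forall g d, smooth U (fun y => h y g d)) -> h x \in unitmx ->
  levi h x xi eta = - quart x xi + hq (h x) (eta + christoffel x xi).
Proof.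
move=> oU Ux hh sh ux.
set D := \row_d \sum_a \sum_g pz a (fun y => h y g d) x * xi 0 a * xi 0 g.
set Dc := (map_mx Num.conj D)^T.
(* The second derivatives of the metric, which enter [levi] with sign + and [quart] with sign -. *)
pose T1 := \sum_g \sum_d (\sum_b (\sum_a pz a (pzb b (fun y => h y g d)) x * xi 0 a)
        * Num.conj (xi 0 b)) * (xi 0 g * Num.conj (xi 0 d)).
have Dcnu nu : Dc nu 0 = \sum_b \sum_d
    pzb b (fun y => h y nu d) x * Num.conj (xi 0 b) * Num.conj (xi 0 d).
  rewrite !mxE rmorph_sum; apply: eq_bigr => b _; rewrite rmorph_sum.
  apply: eq_bigr => d _; rewrite !rmorphM/=.
  by rewrite (wd_hermitian _ oU Ux hh (sh d nu)).
have EQ : quart x xi = - T1 + (D *m invmx (h x) *m Dc) 0 0.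
  rewrite -sumrN -mulmxA mxE.
  under [X in _ = _ + X]eq_bigr => mu _.
    rewrite !mxE (eq_bigr _ (fun nu _ => congr1 _ (Dcnu nu))) mulr_sumr.
    under eq_bigr => nu _ do rewrite mulrCA mulrA.
    over.
  rewrite -(sum_contract (fun a g mu => pz a (fun y => h y g mu) x * xi 0 a * xi 0 g)
    (fun b d nu => pzb b (fun y => h y nu d) x * Num.conj (xi 0 b) * Num.conj (xi 0 d))).
  rewrite -big_split/=; apply: eq_bigr => g _.
  rewrite -sumrN -big_split/=; apply: eq_bigr => d _.
  rewrite mulr_suml -sumrN exchange_big -big_split/=; apply: eq_bigr => b _.
  rewrite mulr_suml mulr_suml -sumrN -big_split/=; apply: eq_bigr => a _.
  rewrite /riem !mulrDl; congr (_ + _); first by ring.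
  rewrite !mulr_suml; apply: eq_bigr => mu _.
  by rewrite !mulr_suml; apply: eq_bigr => nu _; ring.
have EL : levi h x xi eta = T1 + (eta *m Dc) 0 0 +
   ((D *m (map_mx Num.conj eta)^T) 0 0 + hq (h x) eta).
  rewrite !mxE /hq -addrA.
  have -> : \sum_j eta 0 j * Dc j 0 = \sum_g \sum_d
     (\sum_b pzb b (fun y => h y g d) x * Num.conj (xi 0 b))
        * (eta 0 g * Num.conj (xi 0 d)).
    apply: eq_bigr => g _; rewrite Dcnu exchange_big mulr_sumr.
    apply: eq_bigr => d _; rewrite mulr_suml mulr_sumr.
    by apply: eq_bigr => b _; ring.
  have -> : \sum_j D 0 j * (map_mx Num.conj eta)^T j 0 = \sum_g \sum_d
     (\sum_a pz a (fun y => h y g d) x * xi 0 a)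
        * (xi 0 g * Num.conj (eta 0 d)).
    rewrite [RHS]exchange_big; apply: eq_bigr => d _; rewrite !mxE exchange_big mulr_suml.
    apply: eq_bigr => g _; rewrite !mulr_suml.
    by apply: eq_bigr => a _; ring.
  rewrite /T1 /levi -!big_split/=; apply: eq_bigr => g _.
  rewrite -!big_split/=; apply: eq_bigr => d _; ring.
rewrite EQ EL /christoffel -/D !hqE.
have hi := invmx_hermitian (hh x Ux).
rewrite map_mxD map_mxM [(_ + _)^T]raddfD/= trmx_mul (hermitianE hi) -/Dc.
rewrite mulmxDl mulmxDr !mulmxDl !mulmxA !(mulmxKV ux) (mulmxK ux).
rewrite !mxE; ring.
Qed.

Section Signs.
Variables (U : set 'rV[K]_n) (x : 'rV[K]_n).
Hypotheses (oU : open U) (Ux : U x) (hh : forall y, U y -> hermitian (h y)).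
Hypothesis sh : forall g d, smooth U (fun y => h y g d).

Lemma levi0 eta : levi h x 0 eta = hq (h x) eta.
Proof.
rewrite /levi /hq; apply: eq_bigr => g _; apply: eq_bigr => d _.
rewrite !mxE conjC0 !(mul0r, mulr0) !add0r.
by rewrite mulrA.
Qed.

Lemma levi_christoffel xi : h x \in unitmx ->
  levi h x xi (- christoffel x xi) = - quart x xi.
Proof.
by move=> ux; rewrite (levi_square _ _ oU Ux hh sh ux) addNr hq0 addr0.
Qed.

Lemma sqr_hq_gt0 xi : pos_def (h x) -> xi != 0 -> 0 < hq (h x) xi ^+ 2.
Proof. by move=> ph /ph h0; rewrite exprn_gt0. Qed.

Lemma neg_levi : pos_def (h x) ->
  (forall xi, xi != 0 -> quart x xi / hq (h x) xi ^+ 2 < 0) ->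
  forall xi eta, (xi != 0) || (eta != 0) -> 0 < levi h x xi eta.
Proof.
move=> ph nh xi eta; have [->|xi0 _] := eqVneq xi 0.
  by rewrite /= levi0; exact: ph.
rewrite (levi_square _ _ oU Ux hh sh (pos_def_unit ph)) ltr_wpDr//.
  exact: pos_def_ge0.
by have := nh _ xi0; rewrite pmulr_llt0 ?oppr_gt0// invr_gt0 sqr_hq_gt0.
Qed.

(** Jets of the form [(0, v)] give positive definiteness, and the geodesic jets
    [(xi, - christoffel h x xi)] give the sign of the curvature. *)
Lemma levi_neg : (forall xi eta, (xi != 0) || (eta != 0) -> 0 < levi h x xi eta) ->
  pos_def (h x) /\ forall xi, xi != 0 -> quart x xi / hq (h x) xi ^+ 2 < 0.
Proof.
move=> H; have ph : pos_def (h x).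
  by move=> v v0; rewrite -levi0; apply: H; rewrite v0 orbT.
split => // xi xi0; rewrite pmulr_llt0 ?invr_gt0 ?sqr_hq_gt0//.
rewrite -oppr_gt0 -levi_christoffel; last exact: pos_def_unit.
by apply: H; rewrite xi0.
Qed.

Lemma pos_quart : pos_def (h x) ->
  (forall xi, xi != 0 -> 0 < quart x xi / hq (h x) xi ^+ 2) ->
  forall xi, xi != 0 -> 0 < quart x xi.
Proof.
move=> ph nh xi xi0; have := nh _ xi0.
by rewrite pmulr_lgt0// invr_gt0 sqr_hq_gt0.
Qed.

Lemma pos_levi : pos_def (h x) ->
  (forall xi, xi != 0 -> 0 < quart x xi / hq (h x) xi ^+ 2) ->
  forall xi, xi != 0 -> exists eta, levi h x xi eta < 0.
Proof.
move=> ph nh xi xi0; exists (- christoffel x xi).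
rewrite levi_christoffel; last exact: pos_def_unit.
by rewrite oppr_lt0; exact: pos_quart.
Qed.

(** The square in [levi_square] is nonnegative, so a negative value of [levi] forces [quart] to be
    positive, whatever [eta] is. *)
Lemma levi_pos : pos_def (h x) ->
  (forall xi, xi != 0 -> exists eta, levi h x xi eta < 0) ->
  forall xi, xi != 0 -> 0 < quart x xi / hq (h x) xi ^+ 2.
Proof.
move=> ph H xi xi0; rewrite pmulr_lgt0 ?invr_gt0 ?sqr_hq_gt0//.
have [eta] := H _ xi0.
rewrite (levi_square _ _ oU Ux hh sh (pos_def_unit ph)) => lt0.
rewrite -oppr_lt0; apply: le_lt_trans lt0; rewrite lerDl.
exact: pos_def_ge0.
Qed.

End Signs.

End CurvatureForm.

Section LeviAlgebra.
Context {K : numClosedFieldType} {n : nat}.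
Variables (U : set 'rV[K]_n) (x : 'rV[K]_n).
Hypotheses (oU : open U) (Ux : U x).
Implicit Types h : 'rV[K]_n -> 'M[K]_n.

Lemma eq_levi h h' xi eta : (forall y, U y -> h y = h' y) ->
  levi h x xi eta = levi h' x xi eta.
Proof.
move=> hh'; have e y g d : U y -> h y g d = h' y g d by move=> /hh' ->.
rewrite /levi; apply: eq_bigr => g _; apply: eq_bigr => d _.
have e1 a := eq_pz oU a (fun y => e y g d) Ux.
have e2 b := eq_pzb oU b (fun y => e y g d) Ux.
have e3 a b := eq_pz oU a (fun y Uy => eq_pzb oU b (fun y => e y g d) Uy) Ux.
rewrite e//; under [in RHS]eq_bigr => b _ do
  under [X in X * _]eq_bigr => a _ do rewrite -e3.
under [in X in _ = _ + X * _ + _]eq_bigr => b _ do rewrite -e2.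
by under [in X in _ = _ + (X * _ + _)]eq_bigr => a _ do rewrite -e1.
Qed.

Lemma leviD h h' c xi eta : (forall g d, smooth U (fun y => h y g d)) ->
  (forall g d, smooth U (fun y => h' y g d)) ->
  levi (fun y => h y + c *: h' y) x xi eta = levi h x xi eta + c * levi h' x xi eta.
Proof.
move=> sh sh'; rewrite /levi mulr_sumr -big_split/=; apply: eq_bigr => g _.
rewrite mulr_sumr -big_split/=; apply: eq_bigr => d _.
have W y Uy := wdD (smooth_wd oU (sh g d) Uy) (wdZ c (smooth_wd (x := y) oU (sh' g d) Uy)).
have mxD y : (h y + c *: h' y) g d = h y g d + c * h' y g d by rewrite !mxE.
rewrite (_ : (fun y => _) = (fun y => h y g d + c * h' y g d)); last first.
  exact/funext.
have e1 a := wd_pz a (W x Ux).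
have e2 b y (Uy : U y) := wd_pzb b (W y Uy).
have e3 a b : pz a (pzb b (fun y => h y g d + c * h' y g d)) x =
    pz a (pzb b (fun y => h y g d)) x + c * pz a (pzb b (fun y => h' y g d)) x.
  rewrite (eq_pz oU a (e2 b) Ux).
  by rewrite (wd_pz a (wdD (smooth_wd oU (smooth_pzb oU b (sh g d)) Ux)
    (wdZ c (smooth_wd oU (smooth_pzb oU b (sh' g d)) Ux)))).
have S1 a : pz a (fun y => h y g d + c * h' y g d) x * xi 0 a =
    pz a (fun y => h y g d) x * xi 0 a + c * (pz a (fun y => h' y g d) x * xi 0 a).
  by rewrite e1; ring.
have S2 b : pzb b (fun y => h y g d + c * h' y g d) x * Num.conj (xi 0 b) =
    pzb b (fun y => h y g d) x * Num.conj (xi 0 b)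
    + c * (pzb b (fun y => h' y g d) x * Num.conj (xi 0 b)).
  by rewrite e2//; ring.
have S3 b : (\sum_a pz a (pzb b (fun y => h y g d + c * h' y g d)) x * xi 0 a)
      * Num.conj (xi 0 b) =
    (\sum_a pz a (pzb b (fun y => h y g d)) x * xi 0 a) * Num.conj (xi 0 b) +
    c * ((\sum_a pz a (pzb b (fun y => h' y g d)) x * xi 0 a) * Num.conj (xi 0 b)).
  rewrite mulrA -mulrDl; congr (_ * _); rewrite mulr_sumr -big_split/=.
  by apply: eq_bigr => a _; rewrite e3; ring.
rewrite (eq_bigr _ (fun a _ => S1 a)) (eq_bigr _ (fun a _ => S2 a)).
rewrite (eq_bigr _ (fun a _ => S3 a)) !big_split/= -!mulr_sumr mxD; ring.
Qed.

(** [levi] is d dbar of a real function along the parabola; conjugation exchanges d and dbar, and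
    these commute. *)
Lemma levi_real h xi eta : schwarz (K := K) -> (forall y, U y -> hermitian (h y)) ->
  (forall g d, smooth U (fun y => h y g d)) ->
  Num.conj (levi h x xi eta) = levi h x xi eta.
Proof.
move=> KS hh sh; pose s := parab x xi eta; pose O := s @^-1` U.
have oO : open O by apply: open_comp => // y _; exact: cont_parab.
have O0 : O 0 by rewrite /O/= /s parab0.
have hs := hol_parab x xi eta O.
have := levi_curve KS oU oO (fun y => id) sh hs O0.
rewrite /s parab0 vel_parab0 vel2_parab -/s => <-; set G := fun y => \sum_g _.
have sG : smooth O G.
  have sv g : smooth O (fun y => vel s y 0 g) := (hol_vel KS oO hs g).1.
  move=> k; apply: WC_sum => g; apply: WC_sum => d; apply: WCM.
    apply: (@WC_comp _ _ _ _ O U (fun y => h y g d) s) => //; first exact: sh.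
    by move=> i; exact: (hs i).1.
  by apply: WCM; [exact: sv|apply: WC_conj; exact: sv].
have cG y : O y -> Num.conj (G y) = G y.
  move=> Oy; rewrite /G [in LHS]exchange_big rmorph_sum; apply: eq_bigr => d _.
  rewrite rmorph_sum; apply: eq_bigr => g _; rewrite !rmorphM/= conjCK.
  by rewrite -(hh _ Oy); ring.
have [e1 e2] := KS _ _ _ _ oO sG O0 0 0.
rewrite -(wd_pzb 0 (wd_conj (smooth_wd oO (smooth_pzb oO 0 sG) O0))).
rewrite -e2; apply: (eq_pzb oO _ _ O0) => y Oy.
rewrite -(wd_pz 0 (wd_conj (smooth_wd oO sG Oy))).
by rewrite (eq_pz oO 0 cG Oy).
Qed.

Lemma cont_levi h : (forall g d, smooth U (fun y => h y g d)) ->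
  forall (T : topologicalType) (X xi eta : T -> 'rV[K]_n) t, X t = x ->
  cont_at X t -> cont_at xi t -> cont_at eta t ->
  cont_at (fun u => levi h (X u) (xi u) (eta u)) t.
Proof.
move=> sh T X xi eta t Xt cX cxi ceta.
have cf f : smooth U f -> cont_at (fun u => f (X u)) t.
  move=> sf; apply: (@continuous_comp _ _ _ X f) => //.
  by apply: (smooth_cont sf); rewrite Xt.
have c1 i : cont_at (fun u => xi u 0 i) t by exact: cont_entry.
have c2 i : cont_at (fun u => eta u 0 i) t by exact: cont_entry.
have c1c i := cont_conj (c1 i); have c2c i := cont_conj (c2 i).
apply: cont_sum => g; apply: cont_sum => d; apply: contD; apply: contD.
- apply: contM; last exact: contM.
  apply: cont_sum => b; apply: contM => //; apply: cont_sum => a.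
  apply: contM => //; apply: cf; apply: smooth_pz => //; exact: smooth_pzb.
- apply: contM; last exact: contM.
  apply: cont_sum => b; apply: contM => //; apply: cf; exact: smooth_pzb.
- apply: contM; last exact: contM.
  apply: cont_sum => b; apply: contM => //; apply: cf; exact: smooth_pz.
- apply: contM; last exact: contM.
  exact: (cf (fun y => h y g d)).
Qed.

(** Effect of the reparametrization z -> a z of a curve: [xi] has weight 1 and [eta] has weight
    2. *)
Lemma leviZ h a xi eta :
  levi h x (a *: xi) (a ^+ 2 *: eta) = (a * Num.conj a) ^+ 2 * levi h x xi eta.
Proof.
rewrite /levi mulr_sumr; apply: eq_bigr => g _.
rewrite mulr_sumr; apply: eq_bigr => d _; rewrite !mulrDr; congr (_ + _ + (_ + _)).
- rewrite !mxE rmorphM/= [LHS]mulrC [in RHS]mulrCA.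
  have -> : \sum_b (\sum_a0 pz a0 (pzb b (fun y => h y g d)) x * (a *: xi) 0 a0)
      * Num.conj ((a *: xi) 0 b) = (a * Num.conj a) *
    \sum_b (\sum_a0 pz a0 (pzb b (fun y => h y g d)) x * xi 0 a0)
      * Num.conj (xi 0 b).
    rewrite mulr_sumr; apply: eq_bigr => b _; rewrite mulr_suml mulr_suml mulr_sumr.
    by apply: eq_bigr => c _; rewrite !mxE rmorphM/=; ring.
  ring.
- have -> : \sum_b pzb b (fun y => h y g d) x * Num.conj ((a *: xi) 0 b) =
     Num.conj a * \sum_b pzb b (fun y => h y g d) x * Num.conj (xi 0 b).
    rewrite mulr_sumr; apply: eq_bigr => b _.
    by rewrite !mxE rmorphM/=; ring.
  by rewrite !mxE rmorphM/=; ring.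
- have -> : \sum_b pz b (fun y => h y g d) x * (a *: xi) 0 b =
     a * \sum_b pz b (fun y => h y g d) x * xi 0 b.
    by rewrite mulr_sumr; apply: eq_bigr => b _; rewrite !mxE; ring.
  by rewrite !mxE !rmorphM/=; ring.
by rewrite !mxE !rmorphM/=; ring.
Qed.

End LeviAlgebra.

(** * Metrics h + k F^* b in local coordinates *)

Section PositivityNear.
Context {K : numClosedFieldType}.

(** The order of [K] compares real elements only: a small distance gives an inequality once the
    values are known to be real. *)
Lemma near_gt0 (T : topologicalType) (f : T -> K) p :
  cont_at f p -> (\forall q \near p, f q \is Num.real) -> 0 < f p ->
  \forall q \near p, f p / 2 < f q.
Proof.
move=> cf rf f0; have f20 : 0 < f p / 2 by rewrite divr_gt0.
have := cf _ (near_dist _ f20) => /= H.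
apply: filterS2 rf H => q rq /= H.
have : f p - f q < f p / 2.
  by apply: le_lt_trans H; apply: real_ler_norm; rewrite rpredB// gtr0_real.
by rewrite ltrBlDr -ltrBlDl {1}[f p]splitr addrK.
Qed.

Lemma near_bounded (T : topologicalType) (f : T -> K) p :
  cont_at f p -> (\forall q \near p, f q \is Num.real) ->
  \forall q \near p, f p - 1 < f q.
Proof.
move=> cf rf; have rp := nbhs_singleton rf.
have := cf _ (near_dist _ (@ltr01 K)) => /= H.
apply: filterS2 rf H => q rq /= H.
rewrite ltrBlDl -ltrBlDr; apply: le_lt_trans H.
by apply: real_ler_norm; rewrite rpredB.
Qed.

(** If [f] is positive at [p], every positive k works near [p] because [g] is nonnegative; if [g] is
    positive at [p], a large k outweighs [f], which is bounded below near [p]. *)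
Lemma near_combination (T : topologicalType) (f g : T -> K) p :
  cont_at f p -> cont_at g p ->
  (\forall q \near p, f q \is Num.real) -> (\forall q \near p, 0 <= g q) ->
  0 < f p \/ 0 < g p ->
  \forall q \near p & k \near (pinfty_nbhs K), 0 < f q + k * g q.
Proof.
move=> cf cg rf pg [f0|g0].
  have H := near_gt0 cf rf f0.
  exists ([set q | f p / 2 < f q /\ 0 <= g q], [set k | 0 < k]) => /=.
    by split; [exact: filterI|exists 0; split => //; exact: real0].
  move=> [q k] /= [[fq gq] k0]; apply: ltr_pwDl.
    by apply: lt_trans fq; rewrite divr_gt0.
  by rewrite mulr_ge0// ltW.
have rg : \forall q \near p, g q \is Num.real.
  by apply: filterS pg => q /ger0_real.
have H := near_gt0 cg rg g0; have H' := near_bounded cf rf.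
have r1 : f p - 1 \is Num.real.
  by apply: rpredB; [exact: (nbhs_singleton rf)|exact: real1].
have g20 : 0 < g p / 2 by rewrite divr_gt0.
(* Near [p] one has [f > f p - 1] and [g > g p / 2]; beyond this threshold k times [g p / 2] exceeds
   the absolute value of [f p - 1]. *)
exists ([set q | f p - 1 < f q /\ g p / 2 < g q],
        [set k | `|f p - 1| / (g p / 2) < k]) => /=.
  split; first exact: filterI.
  by exists (`|f p - 1| / (g p / 2)); split => //; rewrite ger0_real// divr_ge0// ltW.
move=> [q k] /= [[fq gq]]; rewrite ltr_pdivrMr// => kl.
have k0 : 0 < k.
  by rewrite -(pmulr_lgt0 _ g20); apply: le_lt_trans kl.
apply: lt_trans (_ : 0 < f p - 1 + k * (g p / 2)) _.
  rewrite -ltrBlDl sub0r; apply: le_lt_trans kl; rewrite -normrN.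
  by apply: real_ler_norm; rewrite rpredN.
by apply: ltrD => //; rewrite ltr_pM2l.
Qed.

(** A tube lemma with the extra parameter k: near-covering compactness of [C] is applied to the
    product of the neighbourhood filter of [t0] with the filter of large k, so that neither the
    neighbourhood nor the bound on k depends on [w]. *)
Lemma compact_combination (T W : topologicalType) (C : set W) (P : T -> K -> W -> Prop)
    (t0 : T) :
  compact C ->
  (forall w, C w ->
    \forall q \near (t0, w) & k \near (pinfty_nbhs K), P q.1 k q.2) ->
  \forall t \near t0 & k \near (pinfty_nbhs K), forall w, C w -> P t k w.
Proof.
move=> /compact_near_coveringP cC H.
pose F := filter_prod (nbhs t0) (pinfty_nbhs K).
apply: (cC (T * K)%type F (fun i w => P i.1 i.2 w)) => w Cw.
have [[A B] /= [[[A1 A2] /= [A1n A2n] A12] Bn] AB] := H w Cw.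
exists (A2, [set i | A1 i.1 /\ B i.2]) => /=.
  by split => //; exists (A1, B).
move=> [w' [t k]] /= [A2w [A1t Bk]].
by apply: (AB ((t, w'), k)); split => //; exact: A12.
Qed.

Lemma near_forall2 (T : topologicalType) (I : finType) (P : I -> T -> K -> Prop)
    (t0 : T) :
  (forall i, \forall t \near t0 & k \near (pinfty_nbhs K), P i t k) ->
  \forall t \near t0 & k \near (pinfty_nbhs K), forall i, P i t k.
Proof.
exact: (@filter_forall _ I (fun i => [set q | P i q.1 q.2])
  (filter_prod (nbhs t0) (pinfty_nbhs K)) _).
Qed.

End PositivityNear.

Definition compact_disc (K : numClosedFieldType) :=
  forall r, compact [set z : K | `|z| <= r].

(** * Compact sets of normalized vectors and jets *)

Section NormalizedVectors.
Context {K : numClosedFieldType} {n : nat}.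

(** The vectors of the unit polydisc whose coordinate [i] equals 1. The implication makes this a
    product of compact subsets of [K], one for each coordinate, and every nonzero vector has a
    scalar multiple in some face. *)
Definition face (i : 'I_n) : set 'rV[K]_n :=
  [set v | forall j, [set z | `|z| <= 1 /\ (j = i -> z = 1)] (v 0 j)].

Definition cube : set 'rV[K]_n := [set v | forall j, [set z | `|z| <= 1] (v 0 j)].

Lemma compact_cube : compact_disc K -> compact cube.
Proof. by move=> cD; exact: (rV_compact (fun=> cD 1)). Qed.

Lemma compact_face i : compact_disc K -> compact (face i).
Proof.
move=> cD; pose A j := [set z : K | `|z| <= 1 /\ (j = i -> z = 1)].
suff cA j : compact (A j) by exact: (rV_compact cA).
rewrite /A.
have [->|ji] := eqVneq j i.
  rewrite (_ : [set z | _] = [set 1]); first exact: compact_set1.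
  by apply/seteqP; split => z /=; [case=> _ ->|move=> ->; rewrite normr1].
rewrite (_ : [set z | _] = [set z | `|z| <= 1]); first exact: cD.
apply/seteqP; split => z /=; first by case.
by move=> z1; split => // /eqP; rewrite (negPf ji).
Qed.

Lemma face_neq0 i v : face i v -> v != 0.
Proof.
move=> /(_ i)[_ /(_ erefl) vi]; apply/eqP => v0; move: vi.
by rewrite v0 mxE => /esym/eqP; rewrite oner_eq0.
Qed.

Lemma max_coord (v : 'rV[K]_n) : v != 0 ->
  exists i, v 0 i != 0 /\ forall j, `|v 0 j| <= `|v 0 i|.
Proof.
move=> v0; have nv : mx_norm v != 0.
  by apply: contra v0 => /eqP/mx_norm_eq0 ->.
have [[a i] /= vi] := mx_norm_neq0 nv; rewrite [a]ord1 in vi; exists i.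
split; first by rewrite -normr_eq0 -vi.
move=> j; rewrite -vi mx_normE.
exact: (le_bigmax _ (fun i : 'I_1 * 'I_n => `|v i.1 i.2|%:nng) (0, j)).
Qed.

Lemma scale_face (v : 'rV[K]_n) : v != 0 -> exists i a, a != 0 /\ face i (a *: v).
Proof.
move=> /max_coord[i [vi0 vi]]; exists i, (v 0 i)^-1; split.
  by rewrite invr_eq0.
move=> j /=; rewrite mxE; split; last by move=> ->; rewrite mulVf.
by rewrite normrM normfV mulrC ler_pdivrMr ?normr_gt0// mul1r.
Qed.

(** The scaling has weights 1 and 2, as in [leviZ]. A single scalar cannot in general normalize both
    components; it brings one of them to a face and the other into the cube. *)
Lemma scale_faces (v w : 'rV[K]_n) : (v != 0) || (w != 0) ->
  exists i a, a != 0 /\ ((face i (a *: v) /\ cube (a ^+ 2 *: w)) \/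
    (cube (a *: v) /\ face i (a ^+ 2 *: w))).
Proof.
have [->|w0] := eqVneq w 0.
  rewrite orbF => /scale_face[i [a [a0 f]]]; exists i, a; split => //; left.
  by split => // j /=; rewrite scaler0 mxE normr0 ler01.
have [i [wi0 wi]] := max_coord w0 => _.
(* A square root, because [w] is multiplied by [a ^+ 2], which must bring its largest coordinate to
   1. *)
pose a := sqrtC (w 0 i)^-1; have a2 : a ^+ 2 = (w 0 i)^-1 by exact: sqrtCK.
have a0 : a != 0 by rewrite sqrtC_eq0 invr_eq0.
have fw : face i (a ^+ 2 *: w).
  move=> j /=; rewrite a2 mxE; split; last by move=> ->; rewrite mulVf.
  by rewrite normrM normfV mulrC ler_pdivrMr ?normr_gt0// mul1r.
(* If every coordinate of [v] has squared modulus at most that of [w 0 i], normalizing [w] leaves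
   [v] in the cube. Otherwise the largest coordinate of [v] is normalized: its square dominates all
   coordinates of [w], which therefore lands in the cube. *)
have [vs|] := pselect (forall j, `|v 0 j| ^+ 2 <= `|w 0 i|).
  exists i, a; split => //; right; split => // j /=.
  rewrite mxE -(@ler_pXn2r _ 2) ?nnegrE ?ler01 ?normr_ge0// expr1n.
  rewrite normrM exprMn -normrX a2 normfV mulrC.
  by rewrite ler_pdivrMr ?normr_gt0// mul1r.
move=> /existsNP[j0 /negP].
rewrite -real_ltNge ?ger0_real ?exprn_ge0// => wv.
have v0 : v != 0.
  by apply: contraTneq wv => ->; rewrite mxE normr0 expr2 mul0r -real_leNgt ?real0 ?normr_real //.
have [i' [vi0 vi]] := max_coord v0; exists i', (v 0 i')^-1; split.
  by rewrite invr_eq0.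
left; split => j /=; rewrite mxE.
  split; last by move=> ->; rewrite mulVf.
  by rewrite normrM normfV mulrC ler_pdivrMr ?normr_gt0// mul1r.
rewrite normrM normrX normfV mulrC exprVn ler_pdivrMr ?exprn_gt0 ?normr_gt0// mul1r.
apply: le_trans (wi j) _; apply: le_trans (ltW wv) _.
by rewrite ler_pXn2r ?nnegrE ?normr_ge0.
Qed.

End NormalizedVectors.

Section CurvatureLemmas.
Context {K : numClosedFieldType} {n : nat}.

Lemma hqD (M N : 'M[K]_n) v : hq (M + N) v = hq M v + hq N v.
Proof. by rewrite !hqE mulmxDr mulmxDl mxE. Qed.

Lemma hqZl a (M : 'M[K]_n) v : hq (a *: M) v = a * hq M v.
Proof. by rewrite !hqE -scalemxAr -scalemxAl mxE. Qed.

Lemma hqZ a (M : 'M[K]_n) v : hq M (a *: v) = (a * Num.conj a) * hq M v.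
Proof.
rewrite /hq mulr_sumr; apply: eq_bigr => i _; rewrite mulr_sumr.
by apply: eq_bigr => j _; rewrite !mxE rmorphM/=; ring.
Qed.

Lemma christoffel0 (h : 'rV[K]_n -> 'M[K]_n) x : christoffel h x 0 = 0.
Proof.
rewrite /christoffel (_ : \row_d _ = 0) ?mul0mx//; apply/rowP => d; rewrite !mxE.
by apply: big1 => a _; apply: big1 => g _; rewrite !mxE !mulr0.
Qed.

Lemma quart0 (h : 'rV[K]_n -> 'M[K]_n) x : quart h x 0 = 0.
Proof.
apply: big1 => g _; apply: big1 => d _; apply: big1 => a _; apply: big1 => b _.
by rewrite !mxE conjC0 mulr0.
Qed.

Lemma cont_christoffel (U : set 'rV[K]_n) (h : 'rV[K]_n -> 'M[K]_n)
    (T : topologicalType) (X xi : T -> 'rV[K]_n) t :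
  open U -> (forall g d, smooth U (fun y => h y g d)) -> U (X t) ->
  h (X t) \in unitmx -> cont_at X t -> cont_at xi t ->
  cont_at (fun u => christoffel h (X u) (xi u)) t.
Proof.
move=> oU sh Ut ut cX cxi.
have cf f : smooth U f -> cont_at (fun u => f (X u)) t.
  move=> sf; apply: (@continuous_comp _ _ _ X f) => //; exact: smooth_cont sf Ut.
apply: cont_mulmx; last first.
  apply: (cont_invmx (F := fun u => h (X u))) => //; apply: cont_mx => i j.
  exact: (cf (fun y => h y i j)).
apply: cont_mx => i j; apply: (eq_cont (g := fun u => \sum_a \sum_g
   pz a (fun y => h y g j) (X u) * xi u 0 a * xi u 0 g)) => [u|]; first by rewrite mxE.
apply: cont_sum => a; apply: cont_sum => g; apply: contM; last exact: cont_entry.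
apply: contM; last exact: cont_entry.
by apply: (cf (pz a (fun y => h y g j))); exact: smooth_pz (sh g j).
Qed.

End CurvatureLemmas.

(** * Sign of the Levi form of h + k F^* b near a point *)

Section LocalFibration.
Context {K : numClosedFieldType} {n m : nat}.
Hypotheses (KS : schwarz (K := K)) (cD : compact_disc K).
Variables (U : set 'rV[K]_n) (V : set 'rV[K]_m) (F : 'rV[K]_n -> 'rV[K]_m).
Hypotheses (oU : open U) (oV : open V).
Hypotheses (UV : forall y, U y -> V (F y)) (hF : hol_map U F).
Variables (h : 'rV[K]_n -> 'M[K]_n) (b : 'rV[K]_m -> 'M[K]_m).
Hypotheses (hh : forall y, U y -> hermitian (h y))
  (sh : forall g d, smooth U (fun y => h y g d)).
Hypotheses (hb : forall y, V y -> hermitian (b y))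
  (sb : forall g d, smooth V (fun y => b y g d)).
Variable t0 : 'rV[K]_n.
Hypothesis Ut0 : U t0.

Let pb y := pull (jacobian F y) (b (F y)).

Lemma smooth_pull g d : smooth U (fun y => pb y g d).
Proof.
have sJ i j : smooth U (fun y => jacobian F y i j).
  by under eq_fun do rewrite mxE; exact: smooth_pz (hF j).1.
have sbF i j : smooth U (fun y => b (F y) i j).
  by apply: (smooth_comp (f := fun y => b y i j) UV) => // k; exact: (hF k).1.
move=> k.
rewrite (_ : (fun y => _) = (fun y => \sum_j (\sum_i jacobian F y g i * b (F y) i j)
    * Num.conj (jacobian F y d j))); last first.
  apply/funext => y; rewrite /pb /pull mxE; apply: eq_bigr => j _.
  by rewrite !mxE.
apply: WC_sum => j; apply: WCM; last by apply: WC_conj; exact: sJ.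
by apply: WC_sum => i; apply: WCM; [exact: sJ|exact: sbF].
Qed.

Let hk k y := h y + k *: pb y.

Lemma levi_hk k x xi eta : U x -> levi (hk k) x xi eta = levi h x xi eta
  + k * levi b (F x) (xi *m jacobian F x) (eta *m jacobian F x + hess F x xi).
Proof.
move=> Ux; rewrite (leviD oU Ux _ _ _ sh smooth_pull); congr (_ + _ * _).
exact: (levi_pull KS oU oV UV hF xi eta sb (fun y _ => erefl) smooth_pull Ux).
Qed.

Section Continuity.
Context {T : topologicalType} (t : T) (X xi eta : T -> 'rV[K]_n).
Hypotheses (Xt : U (X t)) (cX : cont_at X t) (cxi : cont_at xi t).

Lemma cont_at_F : cont_at (fun u => F (X u)) t.
Proof.
apply: (@continuous_comp _ _ _ X F) => //; apply: cont_mx => i j; rewrite ord1.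
exact: (smooth_cont (hF j).1).
Qed.

Lemma cont_jac : cont_at (fun u => jacobian F (X u)) t.
Proof.
apply: cont_mx => i j.
apply: (eq_cont (g := fun u => pz i (fun y => F y 0 j) (X u))) => [u|].
  by rewrite mxE.
apply: (@continuous_comp _ _ _ X (pz i (fun y => F y 0 j))) => //.
by apply: (smooth_cont (U := U)) => //; exact: smooth_pz (hF j).1.
Qed.

Lemma cont_hess : cont_at (fun u => hess F (X u) (xi u)) t.
Proof.
apply: cont_mx => i j.
apply: (eq_cont (g := fun u => \sum_a \sum_b0
   pz b0 (pz a (fun y => F y 0 j)) (X u) * xi u 0 b0 * xi u 0 a)) => [u|].
  by rewrite mxE.
apply: cont_sum => a; apply: cont_sum => c; apply: contM; last exact: cont_entry.
apply: contM; last exact: cont_entry.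
apply: (@continuous_comp _ _ _ X (pz c (pz a (fun y => F y 0 j)))) => //.
by apply: (smooth_cont (U := U)) => //; do 2!apply: smooth_pz => //; exact: (hF j).1.
Qed.

Lemma cont_hq k (M : T -> 'M[K]_k) (v : T -> 'rV[K]_k) : cont_at M t ->
  cont_at v t -> cont_at (fun u => hq (M u) (v u)) t.
Proof.
move=> cM cv; apply: cont_sum => a; apply: cont_sum => c.
apply: contM; last by apply: cont_conj; exact: cont_entry.
by apply: contM; exact: cont_entry.
Qed.

End Continuity.

Lemma levi_h_real x xi eta : U x -> levi h x xi eta \is Num.real.
Proof. by move=> Ux; apply/CrealP; exact: (levi_real oU Ux _ _ KS). Qed.

Lemma near_U (T : topologicalType) (w : T) :
  \forall q \near (t0, w), U q.1.
Proof. by exists (U, setT) => /=; [split; [exact: open_near|exact: filterT]|case=> ? ? []]. Qed.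

(** At a normalized jet over [t0], either the push-forward vanishes and [vpos] makes the first term
    positive, or the base term is positive; the base term is nonnegative at all nearby jets, so
    [near_combination] applies in both cases. *)
Lemma local_levi_gt0 :
  (forall y u v, V y -> (u != 0) || (v != 0) -> 0 < levi b y u v) ->
  (forall xi eta, (xi != 0) || (eta != 0) -> xi *m jacobian F t0 = 0 ->
    eta *m jacobian F t0 + hess F t0 xi = 0 -> 0 < levi h t0 xi eta) ->
  \forall t \near t0 & k \near (pinfty_nbhs K),
    U t -> forall xi eta, (xi != 0) || (eta != 0) -> 0 < levi (hk k) t xi eta.
Proof.
move=> bpos vpos.
pose P t k (w : 'rV[K]_n * 'rV[K]_n) := U t -> 0 < levi (hk k) t w.1 w.2.
have key (C : set ('rV[K]_n * 'rV[K]_n)) : compact C ->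
    (forall w, C w -> (w.1 != 0) || (w.2 != 0)) ->
    \forall t \near t0 & k \near (pinfty_nbhs K), forall w, C w -> P t k w.
  move=> cC C0; apply: (compact_combination cC) => w Cw.
  pose u q : 'rV[K]_m := (q : 'rV[K]_n * ('rV[K]_n * 'rV[K]_n)).2.1 *m jacobian F q.1.
  pose v q : 'rV[K]_m := (q : 'rV[K]_n * ('rV[K]_n * 'rV[K]_n)).2.2 *m jacobian F q.1
    + hess F q.1 q.2.1.
  have c1 : cont_at (fun q : 'rV[K]_n * ('rV[K]_n * 'rV[K]_n) => q.1) (t0, w).
    exact: cvg_fst.
  have c2 : cont_at (fun q : 'rV[K]_n * ('rV[K]_n * 'rV[K]_n) => q.2) (t0, w).
    exact: cvg_snd.
  have c21 : cont_at (fun q : 'rV[K]_n * ('rV[K]_n * 'rV[K]_n) => q.2.1) (t0, w).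
    by apply: (continuous_comp c2); exact: cvg_fst.
  have c22 : cont_at (fun q : 'rV[K]_n * ('rV[K]_n * 'rV[K]_n) => q.2.2) (t0, w).
    by apply: (continuous_comp c2); exact: cvg_snd.
  have cj := cont_jac (X := fun q : 'rV[K]_n * ('rV[K]_n * 'rV[K]_n) => q.1)
    (t := (t0, w)) Ut0 c1.
  have cu : cont_at u (t0, w) := cont_mulmx c21 cj.
  have cv : cont_at v (t0, w).
    exact: cont_addmx (cont_mulmx c22 cj) (cont_hess (t := (t0, w)) Ut0 c1 c21).
  pose f q := levi h q.1 (q.2.1) (q : 'rV[K]_n * ('rV[K]_n * 'rV[K]_n)).2.2.
  pose g q := levi b (F q.1) (u q) (v q).
  have cf : cont_at f (t0, w) := cont_levi oU Ut0 sh (t := (t0, w)) erefl c1 c21 c22.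
  have cg : cont_at g (t0, w).
    exact: (cont_levi oV (UV Ut0) sb (t := (t0, w)) erefl (cont_at_F (t := (t0, w)) Ut0 c1) cu cv).
  have nU := near_U w.
  have gge q : U q.1 -> 0 <= g q.
    move=> Uq; have [nz|] := boolP ((u q != 0) || (v q != 0)).
      by apply/ltW/bpos => //; exact: UV.
    rewrite negb_or !negbK => /andP[/eqP u0 /eqP v0].
    by rewrite /g u0 v0 levi0 hq0.
  have comb : \forall q \near (t0, w) & k \near (pinfty_nbhs K), 0 < f q + k * g q.
    apply: near_combination => //.
    - by apply: (@filterS _ _ (nbhs_filter (t0, w)) _ _ _ nU) => q Uq; exact: levi_h_real.
    - by apply: (@filterS _ _ (nbhs_filter (t0, w)) _ _ _ nU) => q /gge.
    have [nz|] := boolP ((u (t0, w) != 0) || (v (t0, w) != 0)).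
      by right; apply: bpos => //; exact: UV.
    rewrite negb_or !negbK => /andP[/eqP u0 /eqP v0]; left.
    by apply: vpos => //; exact: C0.
  apply: filterS comb => -[q k] /= H Uq.
  by rewrite levi_hk.
(* A normalized jet has one of its two components on a face, hence two families of compact sets. *)
have k1 i := key _ (compact_setX (compact_face (i := i) cD) (compact_cube cD)).
have k2 i := key _ (compact_setX (compact_cube cD) (compact_face (i := i) cD)).
have {k1 k2} : \forall t \near t0 & k \near (pinfty_nbhs K), forall i,
   (forall w, (face i `*` cube) w -> P t k w) /\
   (forall w, (cube `*` face i) w -> P t k w).
  apply: near_forall2 => i; apply: filterI.
    by apply: k1 => w [/face_neq0 -> _].
  by apply: k2 => w [_ /face_neq0 ->]; rewrite orbT.
apply: filterS => -[t k] /= H Ut xi eta nz.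
have [i [a [a0 fc]]] := scale_faces nz.
have {fc} : 0 < levi (hk k) t (a *: xi) (a ^+ 2 *: eta).
  have [H1 H2] := H i.
  case: fc => fc; first exact: (H1 (a *: xi, a ^+ 2 *: eta) fc Ut).
  exact: (H2 (a *: xi, a ^+ 2 *: eta) fc Ut).
by rewrite leviZ pmulr_rgt0// exprn_gt0// mul_conjC_gt0.
Qed.

(** Negative values of the Levi form say nothing about positive definiteness, so the positive case
    obtains the latter from a compactness argument of its own. *)
Lemma local_pos_def : (forall y, V y -> pos_def (b y)) ->
  (forall xi, xi != 0 -> xi *m jacobian F t0 = 0 -> 0 < hq (h t0) xi) ->
  \forall t \near t0 & k \near (pinfty_nbhs K), U t -> pos_def (hk k t).
Proof.
move=> bpos vpos.
pose P t k (w : 'rV[K]_n) := U t -> 0 < hq (hk k t) w.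
have key i : \forall t \near t0 & k \near (pinfty_nbhs K),
    forall w, face i w -> P t k w.
  apply: (compact_combination (compact_face (i := i) cD)) => w Cw.
  have c1 : cont_at (fun q : 'rV[K]_n * 'rV[K]_n => q.1) (t0, w) by exact: cvg_fst.
  have c2 : cont_at (fun q : 'rV[K]_n * 'rV[K]_n => q.2) (t0, w) by exact: cvg_snd.
  pose f q := hq (h q.1) (q : 'rV[K]_n * 'rV[K]_n).2.
  pose u q : 'rV[K]_m := (q : 'rV[K]_n * 'rV[K]_n).2 *m jacobian F q.1.
  pose g q := hq (b (F q.1)) (u q).
  have cu : cont_at u (t0, w) := cont_mulmx c2 (cont_jac (t := (t0, w)) Ut0 c1).
  have cf : cont_at f (t0, w).
    apply: (cont_hq _ c2); apply: cont_mx => a c.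
    apply: (@continuous_comp _ _ _ (fun q : 'rV[K]_n * 'rV[K]_n => q.1)
      (fun y => h y a c)) => //.
    exact: smooth_cont (sh a c) Ut0.
  have cg : cont_at g (t0, w).
    apply: (cont_hq _ cu); apply: cont_mx => a c.
    apply: (@continuous_comp _ _ _ (fun q : 'rV[K]_n * 'rV[K]_n => F q.1)
      (fun y => b y a c)); first exact: (cont_at_F (t := (t0, w)) Ut0 c1).
    exact: smooth_cont (sb a c) (UV Ut0).
  have nU := near_U w.
  have comb : \forall q \near (t0, w) & k \near (pinfty_nbhs K), 0 < f q + k * g q.
    apply: near_combination => //.
    - apply: (@filterS _ _ (nbhs_filter (t0, w)) _ _ _ nU) => q Uq.
      by rewrite /f -levi0; exact: levi_h_real.
    - apply: (@filterS _ _ (nbhs_filter (t0, w)) _ _ _ nU) => q Uq.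
      by apply: pos_def_ge0; apply: bpos; exact: UV.
    have [u0|nz] := eqVneq (u (t0, w)) 0; [left|right].
      by apply: vpos => //; exact: face_neq0 Cw.
    by apply: bpos => //; exact: UV.
  apply: filterS comb => -[q k] /= H Uq.
  by rewrite hqD hqZl hq_pull.
have {key} := near_forall2 key; apply: filterS => -[t k] /= H Ut xi nz.
have [i [a [a0 fc]]] := scale_face nz.
by have := H i _ fc Ut; rewrite hqZ pmulr_rgt0// mul_conjC_gt0.
Qed.

(* The second-order part is chosen so that its projection to the base is
   - christoffel, which turns the base contribution into - quart. *)
Lemma local_levi_lt0 (M : 'M[K]_(m, n)) : M *m jacobian F t0 = 1%:M ->
  (forall y, V y -> pos_def (b y)) ->
  (forall y u, V y -> u != 0 -> 0 < quart b y u) ->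
  (forall xi, xi != 0 -> xi *m jacobian F t0 = 0 ->
    exists eta, eta *m jacobian F t0 + hess F t0 xi = 0 /\ levi h t0 xi eta < 0) ->
  \forall t \near t0 & k \near (pinfty_nbhs K),
    U t -> forall xi, xi != 0 -> exists eta, levi (hk k) t xi eta < 0.
Proof.
move=> MJ bpos bq vneg.
pose P t k (w : 'rV[K]_n) := U t -> exists eta, levi (hk k) t w eta < 0.
have key i : \forall t \near t0 & k \near (pinfty_nbhs K),
    forall w, face i w -> P t k w.
  apply: (compact_combination (compact_face (i := i) cD)) => w Cw.
  have c1 : cont_at (fun q : 'rV[K]_n * 'rV[K]_n => q.1) (t0, w) by exact: cvg_fst.
  have c2 : cont_at (fun q : 'rV[K]_n * 'rV[K]_n => q.2) (t0, w) by exact: cvg_snd.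
  have cj := cont_jac (t := (t0, w)) Ut0 c1.
  have cF := cont_at_F (t := (t0, w)) Ut0 c1.
  pose u q : 'rV[K]_m := (q : 'rV[K]_n * 'rV[K]_n).2 *m jacobian F q.1.
  have cu : cont_at u (t0, w) := cont_mulmx c2 cj.
  (* If [w] is not vertical at [t0], the base term is already positive there and any starting value
     serves; 0 is taken. *)
  have [eta0 eta0P] : exists eta0, u (t0, w) = 0 ->
      eta0 *m jacobian F t0 + hess F t0 w = 0 /\ levi h t0 w eta0 < 0.
    have [u0|nz] := eqVneq (u (t0, w)) 0; last by exists 0 => u0; rewrite u0 eqxx in nz.
    by have [eta0 ?] := vneg w (face_neq0 Cw) u0; exists eta0.
  (* A continuous family of sections of the differential: [S q *m jacobian F q.1] is the identity
     wherever [M *m jacobian F q.1] is invertible, hence near [t0]. *)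
  pose S q := invmx (M *m jacobian F (q : 'rV[K]_n * 'rV[K]_n).1) *m M.
  have cMJ : cont_at (fun q : 'rV[K]_n * 'rV[K]_n => M *m jacobian F q.1) (t0, w).
    refine (cont_mulmx (F := fun=> M) _ cj); exact: cst_continuous.
  have uMJ : M *m jacobian F t0 \in unitmx by rewrite MJ unitmx1.
  have cS : cont_at S (t0, w).
    refine (cont_mulmx (G := fun=> M) (cont_invmx (x := (t0, w)) uMJ cMJ) _).
    exact: cst_continuous.
  (* The failure of the jet [(q.2, eta0)] to project onto a geodesic jet of the base; [eta] below
     corrects it by means of [S]. At [(t0, w)] with [w] vertical this defect vanishes, so that [eta]
     takes there the value [eta0] provided by the fibre. *)
  pose d q := eta0 *m jacobian F (q : 'rV[K]_n * 'rV[K]_n).1 + hess F q.1 q.2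
    + christoffel b (F q.1) (u q).
  have cd : cont_at d (t0, w).
    apply: cont_addmx.
      refine (cont_addmx (cont_mulmx (F := fun=> eta0) _ cj)
        (cont_hess (t := (t0, w)) Ut0 c1 c2)); exact: cst_continuous.
    exact: (cont_christoffel oV sb (t := (t0, w)) (UV Ut0) (pos_def_unit (bpos _ (UV Ut0))) cF cu).
  pose eta q := eta0 - d q *m S q.
  have ceta : cont_at eta (t0, w).
    apply: cont_addmx; first exact: cont_cst.
    by apply: (@continuousN); exact: cont_mulmx.
  pose f q := - levi h q.1 (q : 'rV[K]_n * 'rV[K]_n).2 (eta q).
  pose g q := - levi b (F q.1) (u q) (- christoffel b (F q.1) (u q)).
  have cf : cont_at f (t0, w).
    by apply: contN; exact: (cont_levi oU Ut0 sh (t := (t0, w)) erefl c1 c2 ceta).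
  have cg : cont_at g (t0, w).
    apply: contN; apply: (cont_levi oV (UV Ut0) sb (t := (t0, w)) erefl cF cu).
    apply: (@continuousN).
    exact: (cont_christoffel oV sb (t := (t0, w)) (UV Ut0) (pos_def_unit (bpos _ (UV Ut0))) cF cu).
  have nU := near_U w.
  have gE q : U q.1 -> g q = quart b (F q.1) (u q).
    move=> Uq; have Vq := UV Uq.
    by rewrite /g (levi_christoffel oV Vq hb sb) ?opprK//; exact: pos_def_unit (bpos _ Vq).
  have nunit : \forall q \near (t0, w), M *m jacobian F q.1 \in unitmx.
    have := near_neq0 (cont_det cMJ); rewrite /= -unitfE -unitmxE => /(_ uMJ).
    by apply: filterS => q; rewrite unitmxE unitfE.
  have comb : \forall q \near (t0, w) & k \near (pinfty_nbhs K), 0 < f q + k * g q.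
    apply: near_combination => //.
    - apply: (@filterS _ _ (nbhs_filter (t0, w)) _ _ _ nU) => q Uq.
      by rewrite rpredN; exact: levi_h_real.
    - apply: (@filterS _ _ (nbhs_filter (t0, w)) _ _ _ nU) => q Uq.
      rewrite gE//; have [->|nz] := eqVneq (u q) 0; last by apply/ltW/bq => //; exact: UV.
      by rewrite quart0.
    have [u0|nz] := eqVneq (u (t0, w)) 0; [left|right].
      have [eq0 lt0] := eta0P u0; rewrite oppr_gt0 /eta /d u0 christoffel0 addr0 eq0.
      by rewrite mul0mx subr0.
    by rewrite gE//; apply: bq => //; exact: UV.
  have H2 : \forall q \near (t0, w) & k \near (pinfty_nbhs K), M *m jacobian F q.1 \in unitmx.
    exists ([set q | M *m jacobian F q.1 \in unitmx], setT) => /=; last by case=> ? ? [].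
    by split => //; exact: filterT.
  apply: filterS2 H2 comb => -[q k] /= uq H Uq; exists (eta q).
  rewrite levi_hk// -/(u q) (_ : eta q *m _ + _ = - christoffel b (F q.1) (u q)).
    by rewrite -oppr_gt0 opprD -mulrN.
  rewrite /eta mulmxBl -mulmxA /S -mulmxA mulVmx// mulmx1 /d.
  by rewrite addrAC opprD addrA subrr sub0r.
have {key} := near_forall2 key; apply: filterS => -[t k] /= H Ut xi nz.
have [i [a [a0 fc]]] := scale_face nz.
(* Undoes the normalization of [xi] by [a], under which the second component has weight 2. *)
have [eta lt0] := H i _ fc Ut; exists (a ^- 2 *: eta).
move: lt0; rewrite -{1}(scale1r eta) -(divff (expf_neq0 2 a0)) -scalerA leviZ.
by rewrite pmulr_rlt0// exprn_gt0// mul_conjC_gt0.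
Qed.

End LocalFibration.

(** * The implicit function theorem *)

Section MatrixNorm.
Context {K : numClosedFieldType}.

Lemma coord_le_norm n (v : 'rV[K]_n) j : `|v 0 j| <= `|v|.
Proof.
rewrite [leRHS]mx_normE.
exact: (le_bigmax _ (fun i : 'I_1 * 'I_n => `|v i.1 i.2|%:nng) (0, j)).
Qed.

Lemma norm_le_coord n (v : 'rV[K]_n) c :
  0 <= c -> (forall j, `|v 0 j| <= c) -> `|v| <= c.
Proof.
move=> c0 H; have [v0|nv] := eqVneq `|v| 0; first by rewrite v0.
have [[a j] /= e] := mx_norm_neq0 nv.
by rewrite [X in X <= _](_ : _ = mx_norm v)// e [a]ord1.
Qed.

Lemma cont_norm (T : topologicalType) n (F : T -> 'rV[K]_n) x :
  cont_at F x -> cont_at (fun y => `|F y|) x.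
Proof.
move=> cF; apply: (@continuous_comp _ _ _ F (fun v : 'rV[K]_n => `|v|)) => //.
exact: norm_continuous.
Qed.

Lemma near_ball n (x : 'rV[K]_n) (Q : 'rV[K]_n -> Prop) :
  (\forall y \near x, Q y) -> exists2 d, 0 < d & forall y, `|y - x| < d -> Q y.
Proof.
move=> /(nbhs_ballP x Q)[d /= d0 Hd]; exists d => // y yd; apply: Hd.
by rewrite mx_norm_ball /ball_/= distrC.
Qed.

Lemma ball_near n (x : 'rV[K]_n) d : 0 < d -> \forall y \near x, `|y - x| < d.
Proof.
move=> d0; apply/(nbhs_ballP x); exists d => // y.
by rewrite mx_norm_ball /ball_/= distrC.
Qed.

Lemma open_norm_lt n m (f : 'rV[K]_n -> 'rV[K]_m) r : (forall x, cont_at f x) ->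
  open [set x | `|f x| < r].
Proof.
move=> cf; rewrite openE => x /= xr; rewrite /interior.
have d0 : 0 < r - `|f x| by rewrite subr_gt0.
apply: (@filterS _ _ (nbhs_filter x) _ _ _ (cf x _ (ball_near (f x) d0))) => y /=.
rewrite ltrBrDl; apply: le_lt_trans; rewrite -{1}(subrK (f x) (f y)) addrC.
exact: ler_normD.
Qed.

Lemma norm_mulmx n m (S : 'M[K]_(n, m)) :
  exists2 c, 0 < c & forall v : 'rV[K]_n, `|v *m S| <= c * `|v|.
Proof.
exists (1 + \sum_i \sum_j `|S i j|).
  by rewrite ltr_pwDl// sumr_ge0// => i _; rewrite sumr_ge0.
move=> v; apply: norm_le_coord => [|j].
  by rewrite mulr_ge0// addr_ge0// sumr_ge0// => i _; rewrite sumr_ge0.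
rewrite mxE; apply: le_trans (ler_norm_sum _ _ _) _.
rewrite mulrDl mul1r; apply: ler_wpDl => //; rewrite mulr_suml.
apply: ler_sum => i _; rewrite normrM mulrC; apply: ler_pM => //.
  by rewrite (bigD1 j)//= lerDl sumr_ge0.
exact: coord_le_norm.
Qed.

Lemma half_le (x a : K) : x <= a + 2^-1 * x -> x <= 2 * a.
Proof.
rewrite -lerBlDr (_ : x - 2^-1 * x = 2^-1 * x); last by field.
by rewrite ler_pdivrMl.
Qed.

Lemma finite_lower_bound (I : finType) (d : I -> K) : (forall i, 0 < d i) ->
  exists2 D, 0 < D & forall i, D <= d i.
Proof.
move=> d0; suff [D D0 DP] : exists2 D, 0 < D & forall i, i \in enum I -> D <= d i.
  by exists D => // i; apply: DP; rewrite mem_enum.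
elim: (enum I) => [|j r [D D0 IH]]; first by exists 1.
have [Dd|dD] := real_leP (gtr0_real D0) (gtr0_real (d0 j)).
  by exists D => // i; rewrite inE => /orP[/eqP ->|/IH].
exists (d j) => // i; rewrite inE => /orP[/eqP ->//|/IH]; exact/le_trans/ltW.
Qed.

(** For row vectors, [K0] includes the kernel of [J], [S] is a section of [J], and [P] is the
    projection onto the kernel along the image of [S]: every [v] equals
    [v *m P *m K0 + v *m J *m S]. *)
Lemma split_kernel n m (J : 'M[K]_(n, m)) : row_full J ->
  exists (K0 : 'M[K]_(n - m, n)) (S : 'M[K]_(m, n)) (P : 'M[K]_(n, n - m)),
    [/\ K0 *m J = 0, S *m J = 1%:M, K0 *m P = 1%:M, S *m P = 0
      & P *m K0 + J *m S = 1%:M].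
Proof.
move=> /[dup] /row_fullP[S SJ] /eqP rJ.
have [K0 [kfree kker]] : exists K0 : 'M[K]_(n - m, n),
    row_free K0 /\ (K0 == kermx J)%MS.
  have := row_base_free (kermx J).
  have : (row_base (kermx J) == kermx J)%MS by apply/eqmxP; exact: eq_row_base.
  move: (row_base _); rewrite mxrank_ker rJ => K0 kk kf; by exists K0.
have K0J : K0 *m J = 0 by apply/sub_kermxP; have /andP[] := kker.
have [P0 KP0] := row_freeP kfree.
have [Q QE] : exists Q, 1%:M - J *m S = Q *m K0.
  apply/submxP; have /andP[_ kk] := kker; apply: submx_trans kk.
  apply/sub_kermxP; rewrite mulmxBl mul1mx -mulmxA SJ mulmx1 subrr//.
exists K0, S, ((1%:M - J *m S) *m P0); split => //.
- by rewrite mulmxA mulmxBr mulmx1 mulmxA K0J mul0mx subr0.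
- by rewrite mulmxA mulmxBr mulmx1 mulmxA SJ mul1mx subrr mul0mx.
- by rewrite QE -!mulmxA (mulmxA K0) KP0 mul1mx -QE subrK.
Qed.

End MatrixNorm.

Section SmoothInverse.
Context {K : numClosedFieldType} {n : nat}.

Lemma WC_det k (U : set 'rV[K]_n) m (M : 'rV[K]_n -> 'M[K]_m) :
  (forall i j, WC k U (fun y => M y i j)) -> WC k U (fun y => \det (M y)).
Proof.
move=> H; apply: WC_sum => s; apply: WCM; first exact: WC_cst.
by apply: WC_prod => i; exact: H.
Qed.

Lemma WC_invmx k (U : set 'rV[K]_n) m (M : 'rV[K]_n -> 'M[K]_m) i j :
  open U -> (forall y, U y -> M y \in unitmx) ->
  (forall i j, WC k U (fun y => M y i j)) -> WC k U (fun y => invmx (M y) i j).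
Proof.
move=> oU uM H.
apply: (eq_WC (f := fun y => (\det (M y))^-1 * ((-1) ^+ (j + i) *
    \det (row' j (col' i (M y)))))) => //.
  by move=> y Uy; rewrite /invmx (uM y Uy) !mxE.
apply: WCM.
  by apply: WCV; [move=> y /uM; rewrite unitmxE unitfE|exact: WC_det].
apply: WCM; first exact: WC_cst.
apply: WC_det => a b.
by under eq_fun do rewrite !mxE; exact: H.
Qed.

Lemma WC_mulmx k (U : set 'rV[K]_n) m p q (M : 'rV[K]_n -> 'M[K]_(m, p))
    (N : 'rV[K]_n -> 'M[K]_(p, q)) i j :
  (forall i j, WC k U (fun y => M y i j)) ->
  (forall i j, WC k U (fun y => N y i j)) ->
  WC k U (fun y => (M y *m N y) i j).
Proof.
move=> HM HN; under eq_fun do rewrite mxE.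
by apply: WC_sum => a; exact: WCM.
Qed.

(** An antiholomorphic slope that vanishes at [x] can be absorbed into the holomorphic one: conj d
    is d times conj d / d, a factor of modulus at most 1, so the product still tends to 0. *)
Lemma hol_caratheodory (f : 'rV[K]_n -> K) x A : wd f x A (fun=> 0) ->
  exists phi : 'I_n -> 'rV[K]_n -> K,
    [/\ forall j, cont_at (phi j) x, forall j, phi j x = A j
      & \forall y \near x, f y = f x + \sum_j phi j y * (y 0 j - x 0 j)].
Proof.
move=> [p [q [cp ep E]]].
pose d (y : 'rV[K]_n) j := y 0 j - x 0 j.
pose th j y := q j y * (Num.conj (d y j) / d y j).
exists (fun j y => p j y + th j y); split.
- move=> j; have [cpj cqj] := cp j; apply: contD => //.
  have th0 : th j x = 0 by rewrite /th (ep j).2 mul0r.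
  rewrite /cont_at /prop_for /continuous_at th0.
  apply/(@cvgrPdist_lt _ K^o _ (nbhs x) (nbhs_filter x)) => e e0.
  apply: (@filterS _ _ (nbhs_filter x) _ _ _ (cqj _ (near_dist _ e0))) => y /=.
  rewrite (ep j).2 !sub0r !normrN; apply: le_lt_trans.
  rewrite /th normrM ler_piMr// normrM normfV norm_conjC.
  have [->|dn] := eqVneq (d y j) 0; first by rewrite normr0 mul0r ler01.
  by rewrite divff// normr_eq0.
- by move=> j; rewrite /th (ep j).1 (ep j).2 mul0r addr0.
apply: filterS E => y ->; congr (_ + _); apply: eq_bigr => j _.
rewrite mulrDl /th -/(d y j); congr (_ + _).
have [->|dn] := eqVneq (d y j) 0; first by rewrite conjC0 !mulr0.
by rewrite -!mulrA mulVf// mulr1.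
Qed.

End SmoothInverse.

(** The increment is taken between two arbitrary points near [x]; this uniformity is what yields a
    contraction in the implicit function theorem. *)
Definition strict_differentiability (K : numClosedFieldType) : Prop :=
  forall n (U : set 'rV[K]_n) f x, open U -> smooth U f -> U x ->
  forall e, 0 < e -> exists2 d, 0 < d & forall y z, `|y - x| < d -> `|z - x| < d ->
  `|f y - f z - \sum_j (pz j f x * (y 0 j - z 0 j)
     + pzb j f x * Num.conj (y 0 j - z 0 j))| <= e * `|y - z|.

(** Takes the place of completeness in the fixed point argument: the fixed point is a minimum of the
    displacement. *)
Definition attains_min (K : numClosedFieldType) : Prop :=
  forall (T : topologicalType) (A : set T) (f : T -> K), A !=set0 -> compact A ->
  (forall x, A x -> cont_at f x) -> (forall x, A x -> 0 <= f x) ->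
  exists2 c, A c & forall t, A t -> f c <= f t.

Section ImplicitFunction.
Context {K : numClosedFieldType}.
Hypotheses (KS : schwarz (K := K)) (KD : strict_differentiability K).
Hypotheses (KC : compact_disc K) (KM : attains_min K).
Context {n m p : nat}.
Variables (U : set 'rV[K]_n) (F : 'rV[K]_n -> 'rV[K]_m) (t0 : 'rV[K]_n).
Hypotheses (oU : open U) (hF : hol_map U F) (Ut0 : U t0).
Let J := jacobian F t0.
Variables (K0 : 'M[K]_(p, n)) (S : 'M[K]_(m, n)) (P : 'M[K]_(n, p)).
Hypotheses (K0J : K0 *m J = 0) (SJ : S *m J = 1%:M) (K0P : K0 *m P = 1%:M)
  (SP : S *m P = 0) (PKJS : P *m K0 + J *m S = 1%:M).

Lemma map_strict e : 0 < e -> exists2 d, 0 < d &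
  forall y z, `|y - t0| < d -> `|z - t0| < d ->
  `|F y - F z - (y - z) *m J| <= e * `|y - z|.
Proof.
move=> e0.
have H j : exists d, 0 < d /\ forall y z, `|y - t0| < d -> `|z - t0| < d ->
    `|(F y - F z - (y - z) *m J) 0 j| <= e * `|y - z|.
  have [d d0 Hd] := KD oU (hF j).1 Ut0 e0; exists d; split => // y z yd zd.
  have := Hd y z yd zd; congr (`|_| <= _).
  rewrite !mxE; congr (_ - _); apply: eq_bigr => i _.
  by rewrite (hF j).2// mul0r addr0 mulrC !mxE.
have /choice[d Hd] := H.
have [D D0 DP] := finite_lower_bound (fun j => (Hd j).1).
exists D => // y z yd zd; apply: norm_le_coord => [|j].
  by rewrite mulr_ge0// ltW.
by apply: (Hd j).2; [apply: lt_le_trans yd _|apply: lt_le_trans zd _]; exact: DP.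
Qed.

(* F (t0 + y K0 + w S) = F t0 is solved for w as a fixed point of the contraction
   T w = w - (F (t0 + y K0 + w S) - F t0), found by minimizing |w - T w| on a
   compact ball. *)
Lemma implicit_param : exists (O : set 'rV[K]_p) (N : set 'rV[K]_n)
    (s : 'rV[K]_p -> 'rV[K]_n),
  [/\ [/\ open O, O 0, open N, N t0 & N `<=` U],
      forall y, O y -> [/\ N (s y), F (s y) = F t0 & (s y - t0) *m P = y],
      forall t, N t -> F t = F t0 -> O ((t - t0) *m P) /\ s ((t - t0) *m P) = t
    & hol_map O s].
Proof.
have [cS cS0 HS] := norm_mulmx S; have [cK cK0 HK] := norm_mulmx K0.
(* With [e * cS] equal to 1/2, the error of the linear approximation of [F] under a change of [w]
   alone is at most half of that change. *)
pose e := (2 * cS)^-1; have e0 : 0 < e by rewrite invr_gt0 mulr_gt0.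
have [d1 d10 Hd1] := map_strict e0.
have unitSJ : \forall t \near t0, S *m jacobian F t \in unitmx.
  have cSJ : cont_at (fun t => S *m jacobian F t) t0.
    refine (cont_mulmx (F := fun=> S) _ (cont_jac oU hF Ut0 _)).
      exact: cst_continuous.
    exact: (fun=> id).
  have := near_neq0 (cont_det cSJ); rewrite -/J SJ det1 oner_eq0 => /(_ isT).
  by apply: filterS => t; rewrite unitmxE unitfE.
have [d2 d20 Hd2] := near_ball (filterI (open_near oU Ut0) unitSJ).
have [d dd0 dd] : exists2 d, 0 < d & d <= d1 /\ d <= d2.
  have [D D0 HD] := finite_lower_bound (d := fun b : bool => if b then d1 else d2)
    (fun b => match b with true => d10 | false => d20 end).
  by exists D => //; split; [exact: (HD true)|exact: (HD false)].
have {Hd1}est y z : `|y - t0| < d -> `|z - t0| < d ->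
    `|F y - F z - (y - z) *m J| <= e * `|y - z|.
  by move=> yd zd; apply: Hd1; apply: lt_le_trans dd.1.
have inU t : `|t - t0| < d -> U t.
  by move=> td; have [] := Hd2 t (lt_le_trans td dd.2).
have unitS t : `|t - t0| < d -> S *m jacobian F t \in unitmx.
  by move=> td; have [] := Hd2 t (lt_le_trans td dd.2).
(* These radii keep [y *m K0] and [w *m S] within d / 4, so that [par y w] stays in the ball where
   [est] holds; moreover [e * cK * r = rho / 2], which bounds the displacement of 0 by [T]. *)
pose rho := d / (4 * cS); have rho0 : 0 < rho by rewrite divr_gt0// mulr_gt0.
pose r := d / (4 * cK); have r0 : 0 < r by rewrite divr_gt0// mulr_gt0.
pose par (y : 'rV[K]_p) (w : 'rV[K]_m) := t0 + y *m K0 + w *m S.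
have parB y w y' w' : par y w - par y' w' = (y - y') *m K0 + (w - w') *m S.
  rewrite /par !mulmxBl; apply/rowP => j; rewrite !mxE; ring.
have par0 : par 0 0 = t0 by rewrite /par !mul0mx !addr0.
have par_d y w : `|y| < r -> `|w| <= rho -> `|par y w - t0| < d.
  move=> yr wr; rewrite -par0 parB !subr0; apply: le_lt_trans (ler_normD _ _) _.
  apply: le_lt_trans (lerD (HK y) (HS w)) _.
  have h1 : cK * `|y| < d / 4.
    by rewrite (_ : d / 4 = cK * r) ?ltr_pM2l// /r; field; rewrite gt_eqF.
  have h2 : cS * `|w| <= d / 4.
    by rewrite (_ : d / 4 = cS * rho) ?ler_pM2l// /rho; field; rewrite gt_eqF.
  apply: lt_le_trans (ltr_leD h1 h2) _.
  rewrite (_ : d / 4 + d / 4 = d / 2); last by field.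
  by rewrite ler_pdivrMr// ler_peMr ?ler1n// ltW.
have parJ y w : (par y w - t0) *m J = w.
  by rewrite -par0 parB !subr0 mulmxDl -!mulmxA K0J SJ mulmx0 mulmx1 add0r.
have parP y w : (par y w - t0) *m P = y.
  by rewrite -par0 parB !subr0 mulmxDl -!mulmxA K0P SP mulmx0 mulmx1 addr0.
have parK t : par ((t - t0) *m P) ((t - t0) *m J) = t.
  by rewrite /par -addrA -!mulmxA -mulmxDr PKJS mulmx1 addrC subrK.
have ecS : e * cS = 2^-1 by rewrite /e; field; rewrite gt_eqF.
(* On a level set of [F], the component [w] is a Lipschitz function of [y]; with [y = y'] this is
   uniqueness of the solution, and otherwise it gives continuity. *)
have lip y y' w w' : `|y| < r -> `|y'| < r -> `|w| <= rho -> `|w'| <= rho ->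
    F (par y w) = F (par y' w') -> `|w - w'| <= 2 * (e * cK * `|y - y'|).
  move=> yr yr' wr wr' FF.
  have := est _ _ (par_d _ _ yr wr) (par_d _ _ yr' wr').
  rewrite FF subrr sub0r normrN.
  have -> : (par y w - par y' w') *m J = w - w'.
    by rewrite -(subrKA t0) mulmxDl parJ -[t0 - _]opprB mulNmx parJ.
  move=> H; apply: half_le; apply: le_trans H _.
  rewrite -ecS (_ : _ + _ = e * (cK * `|y - y'| + cS * `|w - w'|)); last by ring.
  rewrite ler_pM2l// parB.
  exact: le_trans (ler_normD _ _) (lerD (HK _) (HS _)).
have FparC y w : `|y| < r -> `|w| <= rho ->
    cont_at (fun v : 'rV[K]_m => F (par y v)) w.
  move=> yr wr; refine (cont_at_F (t := w) hF (inU _ (par_d _ _ yr wr)) _).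
  refine (cont_addmx (F := fun=> t0 + y *m K0) _
    (cont_mulmx (F := fun v => v) (G := fun=> S) _ _)); try exact: cst_continuous.
  exact: (fun=> id).
have sol y : exists w, `|y| < r -> `|w| < rho /\ F (par y w) = F t0.
  have [yr|] := boolP (`|y| < r); last by move=> _; exists 0.
  pose T w := w - (F (par y w) - F t0).
  pose A (j : 'I_m) := [set z : K | `|z| <= rho].
  have cA j : compact (A j) by exact: KC.
  pose B := [set w : 'rV[K]_m | forall j, A j (w 0 j)].
  have rhoC : compact B by exact: (rV_compact cA).
  have TB w w' : `|w| <= rho -> `|w'| <= rho -> `|T w - T w'| <= 2^-1 * `|w - w'|.
    move=> wr wr'; have -> : T w - T w' = - (F (par y w) - F (par y w')
        - (par y w - par y w') *m J).
      rewrite (_ : (par y w - par y w') *m J = w - w'); last first.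
        by rewrite -(subrKA t0) mulmxDl parJ -[t0 - _]opprB mulNmx parJ.
      by rewrite /T; apply/rowP => j; rewrite !mxE; ring.
    rewrite normrN; apply: le_trans (est _ _ (par_d _ _ yr wr) (par_d _ _ yr wr')) _.
    by rewrite parB subrr mul0mx add0r -ecS -mulrA ler_pM2l// HS.
  have T0 : `|T 0| < rho / 2.
    have -> : T 0 = - (F (par y 0) - F (par 0 0) - (par y 0 - par 0 0) *m J).
      rewrite /T par0 parJ; apply/rowP => j; rewrite !mxE; ring.
    rewrite normrN; apply: le_lt_trans (est _ _ _ _) _.
    - by apply: par_d => //; rewrite normr0 ltW.
    - by apply: par_d; rewrite normr0 ?ltW.
    rewrite parB !subr0 mul0mx addr0.
    have -> : rho / 2 = e * (cK * r).
      by rewrite /rho /r /e; field; rewrite !gt_eqF.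
    rewrite ltr_pM2l//; apply: le_lt_trans (HK y) _.
    by rewrite ltr_pM2l.
  have Tin w : `|w| <= rho -> `|T w| < rho.
    move=> wr; rewrite -(subrK (T 0) (T w)); apply: le_lt_trans (ler_normD _ _) _.
    rewrite (_ : rho = 2^-1 * rho + rho / 2); last by field.
    apply: ler_ltD => //; apply: le_trans (TB _ _ wr _) _; first by rewrite normr0 ltW.
    by rewrite subr0 ler_pM2l.
  have inC (w : 'rV[K]_m) : `|w| <= rho <-> B w.
    split=> [wr j /=|H]; first by apply: le_trans (coord_le_norm w j) wr.
    by apply: norm_le_coord => //; exact: ltW.
  have cpsi (w : 'rV[K]_m) : `|w| <= rho ->
      cont_at (fun w : 'rV[K]_m => `|w - T w|) w.
    move=> wr; have -> : (fun w : 'rV[K]_m => `|w - T w|) =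
        fun w : 'rV[K]_m => `|F (par y w) - F t0|.
      by apply/funext => v; rewrite /T opprB addrC subrK.
    have c1 : cont_at (fun v : 'rV[K]_m => F (par y v) - F t0) w.
      refine (cont_addmx (F := fun v : 'rV[K]_m => F (par y v)) _ _); last exact: cst_continuous.
      exact: FparC.
    exact: cont_norm c1.
  have B0 : B !=set0 by exists 0; apply/inC; rewrite normr0 ltW.
  have cB w : B w -> cont_at (fun w : 'rV[K]_m => `|w - T w|) w by move=> /inC/cpsi.
  (* At a minimum, the displacement of [w] is at most that of [T w], hence at most half of itself,
     so it is zero. *)
  have [w /inC wr wmin] := KM B0 rhoC cB (fun w _ => normr_ge0 _).
  have Tw : w = T w.
    apply/eqP; rewrite -subr_eq0 -normr_eq0; apply/eqP.
    have := wmin (T w) (iffLR (inC _) (ltW (Tin w wr))).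
    move=> /le_trans /(_ (TB _ _ wr (ltW (Tin w wr)))) H.
    apply/eqP; rewrite eq_le normr_ge0 andbT.
    by have := @half_le K `|w - T w| 0; rewrite add0r mulr0; exact.
  exists w => _; split; first by rewrite Tw; exact: Tin.
  by move/eqP: Tw; rewrite /T -subr_eq0 opprB addrC subrK subr_eq0 => /eqP.
have /choice[om omP] := sol.
pose s y := par y (om y).
pose O := [set y : 'rV[K]_p | `|y| < r].
pose N := [set t : 'rV[K]_n | `|(t - t0) *m P| < r] `&`
  [set t : 'rV[K]_n | `|(t - t0) *m J| < rho].
have cM q (M : 'M[K]_(n, q)) t : cont_at (fun t : 'rV[K]_n => (t - t0) *m M) t.
  refine (cont_mulmx (F := fun t : 'rV[K]_n => t - t0) (G := fun=> M) _ _).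
    refine (cont_addmx (F := fun t : 'rV[K]_n => t) _ _); first exact: (fun=> id).
    exact: cst_continuous.
  exact: cst_continuous.
have oO : open O by apply: (open_norm_lt (f := fun y => y)) => x; exact: (fun=> id).
have Nd t : N t -> `|t - t0| < d.
  by move=> [tP tJ]; rewrite -(parK t) par_d// ltW.
have omJ y : (s y - t0) *m J = om y by exact: parJ.
have lipO y y' : O y -> O y' -> `|om y - om y'| <= 2 * (e * cK) * `|y - y'|.
  move=> yr yr'; have [h1 F1] := omP y yr; have [h2 F2] := omP y' yr'.
  by rewrite -mulrA lip ?(ltW h1) ?(ltW h2)// F1 F2.
have cs y : O y -> cont_at s y.
  move=> Oy; have co : cont_at om y.
    move=> A /near_ball[a a0 Ha].
    have ec0 : 0 < 2 * (e * cK) by rewrite !mulr_gt0.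
    have b0 : 0 < a / (2 * (e * cK)) by rewrite divr_gt0.
    apply: (@filterS2 _ _ (nbhs_filter y) _ _ _ _ (open_near oO Oy) (ball_near y b0)).
    move=> z Oz zy; apply: Ha; apply: le_lt_trans (lipO _ _ Oz Oy) _.
    by rewrite mulrC -ltr_pdivlMr.
  refine (cont_addmx (cont_addmx _ (cont_mulmx (F := fun y => y) (G := fun=> K0) _ _))
    (cont_mulmx (G := fun=> S) co _)); try exact: cst_continuous.
  exact: (fun=> id).
have sd y : O y -> `|s y - t0| < d.
  by move=> Oy; apply: par_d => //; exact: ltW (omP y Oy).1.
pose W := [set t : 'rV[K]_n | `|t - t0| < d].
(* The Jacobian of [s] found by implicit differentiation: it has the form K0 + A S for the
   derivative A of [om], and composing with the Jacobian of [F] must give 0, which determines A. *)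
pose G t := K0 - K0 *m jacobian F t *m invmx (S *m jacobian F t) *m S.
have ws y j : O y -> wd (fun z => s z 0 j) y (fun i => G (s y) i j) (fun=> 0).
  move=> Oy; have Wy := sd y Oy; have Uy := inU _ Wy.
  (* Exact slopes of [F] at [s y] instead of derivatives: as [F] is constant along [s], they
     annihilate the increments of [s], and this linear equation is solved without error terms to
     give the slopes [Xi] of [s]. *)
  have /choice[Phi HPhi] : forall j, exists phi : 'I_n -> 'rV[K]_n -> K,
    [/\ forall i, cont_at (phi i) (s y), forall i, phi i (s y) = pz i (fun t => F t 0 j) (s y)
      & \forall t \near (s y), F t 0 j = F (s y) 0 j
          + \sum_i phi i t * (t 0 i - s y 0 i)].
    by move=> j'; exact: hol_caratheodory (hol_wd oU (hF j') Uy).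
  pose Ph t : 'M[K]_(n, m) := \matrix_(i, j) Phi j i t.
  have Phs : Ph (s y) = jacobian F (s y).
    by apply/matrixP => i k; rewrite !mxE; have [_ -> _] := HPhi k.
  have cPh : cont_at Ph (s y).
    apply: cont_mx => i k; apply: (eq_cont (g := Phi k i)) => [t|].
      by rewrite mxE.
    by have [cP _ _] := HPhi k; exact: cP.
  have cPhs : cont_at (fun z => Ph (s z)) y by exact: (continuous_comp (cs y Oy) cPh).
  have cSPh : cont_at (fun z => S *m Ph (s z)) y.
    by refine (cont_mulmx (F := fun=> S) _ cPhs); exact: cst_continuous.
  have uSP : S *m Ph (s y) \in unitmx by rewrite Phs unitS.
  pose Xi z := K0 - K0 *m Ph (s z) *m invmx (S *m Ph (s z)) *m S.
  have cXi : cont_at Xi y.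
    have cc q1 q2 (M : 'M[K]_(q1, q2)) : cont_at (fun _ : 'rV[K]_p => M) y.
      exact: cst_continuous.
    refine (cont_addmx (F := fun=> K0) (cc _ _ _) (continuousN _)).
    refine (cont_mulmx (G := fun=> S) (cont_mulmx (cont_mulmx (F := fun=> K0)
      (cc _ _ _) cPhs) (cont_invmx (F := fun z => S *m Ph (s z)) (x := y) uSP cSPh)) (cc _ _ _)).
  exists (fun i z => Xi z i j), (fun _ _ => 0); split.
  - by move=> i; split; [exact: cont_entry|exact: cont_cst].
  - by move=> i; rewrite /Xi Phs.
  have nE : \forall z \near y, forall k, F (s z) 0 k = F (s y) 0 k
      + \sum_i Phi k i (s z) * (s z 0 i - s y 0 i).
    apply: near_forall => k; have [_ _ H] := HPhi k; exact: cs y Oy _ H.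
  have nu : \forall z \near y, S *m Ph (s z) \in unitmx.
    have := near_neq0 (cont_det cSPh); rewrite /= -unitfE -unitmxE => /(_ uSP).
    by apply: filterS => z; rewrite unitmxE unitfE.
  have nO := open_near oO Oy.
  apply: (@filterS3 _ _ (nbhs_filter y) _ _ _ _ _ nE nu nO) => z Ez uz Oz.
  have FE : (s z - s y) *m Ph (s z) = 0.
    apply/rowP => k; rewrite !mxE.
    have := congr1 (fun v => v - F t0 0 k) (Ez k).
    rewrite /= (omP z Oz).2 (omP y Oy).2 subrr addrC addKr => E.
    apply: etrans (esym E).
    by apply: eq_bigr => i _; rewrite !mxE mulrC.
  have omE : om z - om y = - ((z - y) *m K0 *m Ph (s z) *m invmx (S *m Ph (s z))).
    move: FE; rewrite parB mulmxDl -!mulmxA => /eqP; rewrite addrC addr_eq0 => /eqP H.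
    rewrite -[LHS]mulmx1 -(mulmxV uz) !mulmxA -[_ *m S *m _]mulmxA H mulNmx.
    by rewrite !mulmxA.
  have sE : s z - s y = (z - y) *m Xi z.
    by rewrite parB omE /Xi mulmxBr mulNmx !mulmxA.
  have -> : s z 0 j = s y 0 j + (s z - s y) 0 j.
    by move: (s z) (s y) => v v'; rewrite !mxE addrC subrK.
  rewrite sE [(_ *m _) 0 j]mxE; congr (_ + _); apply: eq_bigr => i _.
  rewrite mul0r addr0 mulrC; congr (_ * _).
  by rewrite [LHS]mxE [X in _ + X]mxE.
have oW : open W.
  apply: (open_norm_lt (f := fun t => t - t0)) => x.
  by have := cM _ 1%:M x; under [X in cont_at X]eq_fun do rewrite mulmx1.
have WU : W `<=` U by move=> t /inU.
have sJ k i j : WC k W (fun t => jacobian F t i j).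
  apply: (WC_sub WU); apply: (eq_WC oU (f := pz i (fun t => F t 0 j))).
    by move=> t _; rewrite mxE.
  exact: smooth_pz (hF j).1 k.
have cW k q1 q2 (M : 'M[K]_(q1, q2)) i j : WC k W (fun _ => M i j) by exact: WC_cst.
have sG k i j : WC k W (fun t => G t i j).
  apply: (eq_WC oW (f := fun t => K0 i j -
     (K0 *m jacobian F t *m invmx (S *m jacobian F t) *m S) i j)).
    by move=> t _; rewrite !mxE.
  apply: WCD => //; apply: WCN; apply: WC_mulmx => // i1 j1; apply: WC_mulmx.
    by move=> i2 j2; apply: WC_mulmx.
  move=> i2 j2; apply: (WC_invmx _ _ (M := fun t => S *m jacobian F t) oW).
    by move=> t Wt; exact: unitS.
  by move=> i3 j3; apply: WC_mulmx.
(* Bootstrap: the derivatives of [s] are the functions [G] composed with [s], so class C^k of [s]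
   implies class C^(k+1). *)
have ss k j : WC k O (fun y => s y 0 j).
  elim: k j => [|k IH] j.
    by move=> y Oy; apply: cont_entry; exact: cs.
  exists (fun i y => G (s y) i j), (fun _ _ => 0); split.
    by move=> y Oy; exact: ws.
  move=> i; split; last exact: WC_cst.
  by apply: (@WC_comp _ _ _ _ O W (fun t => G t i j) s).
exists O, N, s; split.
- split => //.
  + by rewrite /O/= normr0.
  + by apply: openI; exact: open_norm_lt.
  + by split; rewrite /= subrr mul0mx normr0.
  + by move=> t /Nd/inU.
- move=> y Oy; have [h1 F1] := omP y Oy; split => //; last exact: parP.
  by split; rewrite /= ?parP ?parJ.
- move=> t Nt Ft; have [tP tJ] := Nt; split => //.
  rewrite -[RHS](parK t) /s; congr (par _ _).
  have [h1 F1] := omP _ tP; apply/eqP; rewrite -subr_eq0 -normr_eq0.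
  rewrite eq_le normr_ge0 andbT; apply: le_trans (lip _ _ _ _ tP tP (ltW h1) (ltW tJ) _) _.
    by rewrite F1 parK.
  by rewrite subrr normr0 !mulr0.
by move=> j; apply: (holP (A := fun i y => G (s y) i j)) => [k|y Oy]; [exact: ss|exact: ws].
Qed.

End ImplicitFunction.

(** * Calculus over the complex numbers *)

Local Open Scope complex_scope.

Section RealLines.
Context {R : realType}.

Lemma real_mvt (F dF : R -> R) (s : R) :
  (forall t : R, `|t| <= `|s| -> is_derive t 1 F (dF t)) ->
  exists2 c, `|c| <= `|s| & F s - F 0 = dF c * s.
Proof.
have [s0|s0|<-] := ltgtP 0 s; last by move=> _; exists 0; rewrite ?mulr0 ?subrr.
- move=> H; have h (t : R) : t \in `[0, s] -> is_derive t 1 F (dF t).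
    by rewrite in_itv/= => /andP[t0 ts]; apply: H; rewrite !ger0_norm// ltW.
  have h1 (t : R) : t \in `]0, s[ -> is_derive t 1 F (dF t) by move=> /subset_itv_oo_cc/h.
  have h2 : {within `[0, s], continuous F}.
    by apply: derivable_within_continuous => t /h H1; exact: ex_derive.
  have [c cs ->] := MVT s0 h1 h2; exists c; last by rewrite subr0.
  by move: cs; rewrite in_itv/= => /andP[c0 cs]; rewrite !gtr0_norm// ltW.
- move=> H; have h (t : R) : t \in `[s, 0] -> is_derive t 1 F (dF t).
    by rewrite in_itv/= => /andP[t0 ts]; apply: H; rewrite !ler0_norm ?lerN2// ltW.
  have h1 (t : R) : t \in `]s, 0[ -> is_derive t 1 F (dF t) by move=> /subset_itv_oo_cc/h.
  have h2 : {within `[s, 0], continuous F}.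
    by apply: derivable_within_continuous => t /h H1; exact: ex_derive.
  have [c cs E] := MVT s0 h1 h2; exists c.
    by move: cs; rewrite in_itv/= => /andP[c0 cs]; rewrite !ltr0_norm// lerN2 ltW.
  by rewrite -opprB E sub0r mulrN opprK.
Qed.

Lemma is_derive_shift0 (F : R -> R) (t : R) :
  derivable (fun s : R => F (t + s)) (0 : R) 1 ->
  is_derive t 1 F (derive1 (fun s => F (t + s)) 0).
Proof.
move=> dF; have E : (fun h : R => h^-1 *: ((F \o shift t) (h *: (1 : R)) - F t)) =
  (fun h : R => h^-1 *: (((fun s => F (t + s)) \o shift 0) (h *: (1 : R)) - F (t + 0))).
  by apply/funext => h /=; rewrite !addr0 [t + _]addrC.
have dFt : derivable F t 1 by rewrite /derivable E.
apply: DeriveDef => //; rewrite derive1E /derive; congr (lim _).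
by rewrite E.
Qed.

Lemma caratheodory_derive (F G : R -> R) :
  G @ (0 : R) --> G 0 -> (\forall t \near (0 : R), F t = F 0 + t * G t) ->
  derivable F (0 : R) 1 /\ derive1 F 0 = G 0.
Proof.
move=> cG nF.
have H : (fun h : R => h^-1 *: ((F \o shift 0) (h *: (1 : R)) - F 0)) @ 0^' --> G 0.
  apply: (@cvg_trans _ (G @ 0^')); last exact: cvg_within_filter cG.
  apply: near_eq_cvg; near=> h.
  have h0 : h != 0 by near: h; exact: nbhs_dnbhs_neq.
  rewrite /= addr0 [h *: _]mulr1.
  have -> : F h = F 0 + h * G h by near: h; exact: nbhs_dnbhs nF.
  by rewrite addrC addKr; rewrite [_ *: _]mulKf.
split; first by apply: cvgP H.
by rewrite derive1E; apply: cvg_lim H.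
Unshelve. all: by end_near.
Qed.

End RealLines.

Lemma two_increments (K : comPzRingType) (a b c u v : K) :
  a - c - (u + v) = (b - c - u) + (a - b - v).
Proof. by ring. Qed.

Section ComplexParts.
Context {R : realType}.
Notation C := (complexN R).

Definition rc (t : R) : C := t%:C.
Definition reC (z : C) : R := complex.Re z.
Definition imC (z : C) : R := complex.Im z.
Definition iC : C := 'i%C.

Lemma cont_rc t : cont_at rc t.
Proof. exact: (@realC_continuous R). Qed.

Lemma cont_reC z : cont_at reC z.
Proof. exact: (@ReC_continuous R). Qed.

Lemma cont_imC z : cont_at imC z.
Proof. exact: (@ImC_continuous R). Qed.

Lemma rc0 : rc 0 = 0. Proof. by []. Qed.
Lemma rcD s t : rc (s + t) = rc s + rc t.
Proof. exact: (rmorphD (real_complex R)). Qed.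

Lemma rcM s t : rc (s * t) = rc s * rc t.
Proof. exact: (rmorphM (real_complex R)). Qed.

Lemma rc_nat k : rc k%:R = k%:R.
Proof. exact: (rmorph_nat (real_complex R)). Qed.

Lemma conj_rc t : Num.conj (rc t) = rc t.
Proof. by rewrite conj_Creal//; apply/complex_realP; exists t. Qed.

Lemma norm_rc t : `|rc t| = rc `|t|.
Proof. exact: norm_RC. Qed.

Lemma rc_le s t : (rc s <= rc t) = (s <= t).
Proof. exact: lecR. Qed.

Lemma rc_lt s t : (rc s < rc t) = (s < t).
Proof. exact: ltcR. Qed.

Lemma reC_rcM t z : reC (rc t * z) = t * reC z.
Proof. by case: z => a b; rewrite /reC /= mul0r subr0. Qed.

Lemma imC_rcM t z : imC (rc t * z) = t * imC z.
Proof. by case: z => a b; rewrite /imC /= mul0r addr0. Qed.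

Lemma reCD z w : reC (z + w) = reC z + reC w.
Proof. by case: z; case: w. Qed.

Lemma imCD z w : imC (z + w) = imC z + imC w.
Proof. by case: z; case: w. Qed.

Lemma reCN z : reC (- z) = - reC z.
Proof. by case: z. Qed.

Lemma imCN z : imC (- z) = - imC z.
Proof. by case: z. Qed.

Lemma reC_rc t : reC (rc t) = t. Proof. by []. Qed.
Lemma rectC z : z = rc (reC z) + iC * rc (imC z).
Proof. exact: complexE. Qed.

Lemma iC2 : iC * iC = -1.
Proof. by rewrite -expr2; exact: (@sqr_i R). Qed.

Lemma conj_iC : Num.conj iC = - iC.
Proof. by apply/eqP; rewrite eq_complex /= oppr0 !eqxx. Qed.

Lemma norm_reC z : `|rc (reC z)| <= `|z|.
Proof. exact: norm_Re_le. Qed.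

Lemma norm_imC z : `|rc (imC z)| <= `|z|.
Proof. exact: norm_Im_le. Qed.

Lemma reC_rect a b : reC (rc a + iC * rc b) = a.
Proof. by rewrite /reC /= mul0r mulr0 subrr addr0. Qed.

Lemma imC_rect a b : imC (rc a + iC * rc b) = b.
Proof. by rewrite /imC /= mul0r mul1r !add0r. Qed.

Lemma norm_iC : `|iC| = 1.
Proof.
by apply/eqP; rewrite -(@eqrXn2 _ 2)// expr1n -normrX expr2 iC2 normrN1.
Qed.

Lemma norm_parts z : `|z| <= rc `|reC z| + rc `|imC z|.
Proof.
rewrite {1}(rectC z); apply: le_trans (ler_normD _ _) _.
by rewrite normrM norm_iC mul1r !norm_rc.
Qed.

Lemma gt0_rc (e : C) : 0 < e -> exists2 r : R, 0 < r & e = rc r.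
Proof. exact: gt0_RC. Qed.

End ComplexParts.

Section Lines.
Context {R : realType} {n : nat}.
Notation C := (complexN R).
Implicit Types (f : 'rV[C]_n -> C) (x y v : 'rV[C]_n).

Definition line x v (t : R) : 'rV[C]_n := x + rc t *: v.

(** The derivative of the statement, typed over [complexN R] so that the theory of the abstract
    field applies to it. *)
Definition rd v f x : C := rderive v f x.

Lemma rdE v f x : rd v f x = rc (derive1 (fun t => reC (f (line x v t))) 0)
  + iC * rc (derive1 (fun t => imC (f (line x v t))) 0).
Proof. exact: complexE. Qed.

Definition rdable f v x : Prop :=
  derivable (fun t => reC (f (line x v t))) (0 : R) 1 /\
  derivable (fun t => imC (f (line x v t))) (0 : R) 1.

Definition exC (a : 'I_n) : 'rV[C]_n := delta_mx 0 a.
Definition eyC (a : 'I_n) : 'rV[C]_n := iC *: delta_mx 0 a.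

Lemma exCE a : exC a = delta_mx 0 a. Proof. by []. Qed.
Lemma eyCE a : eyC a = iC *: delta_mx 0 a. Proof. by []. Qed.

Lemma dzE a f x : dz a f x = 2^-1 * (rd (exC a) f x - iC * rd (eyC a) f x) :> C.
Proof. by []. Qed.

Lemma dzbE a f x : dzb a f x = 2^-1 * (rd (exC a) f x + iC * rd (eyC a) f x) :> C.
Proof. by []. Qed.

Lemma CkS k (U : set 'rV[C]_n) f : Ck k.+1 U f <->
  (forall x, U x -> cont_at f x) /\
  forall a, [/\ forall x, U x -> rdable f (exC a) x /\ rdable f (eyC a) x,
    Ck k U (rd (exC a) f) & Ck k U (rd (eyC a) f)].
Proof. by []. Qed.

Lemma Ck0 (U : set 'rV[C]_n) f : Ck 0 U f <-> (forall x, U x -> cont_at f x).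
Proof. by split=> [[]|]. Qed.

End Lines.

#[global] Opaque complexN rc reC imC iC rd exC eyC.

Section LinesTheory.
Context {R : realType} {n : nat}.
Notation C := (complexN R).
Implicit Types (f : 'rV[C]_n -> C) (x y v : 'rV[C]_n).

Lemma line0 x v : line x v 0 = x.
Proof. by rewrite /line rc0 scale0r addr0. Qed.

Lemma line_coordB x v t j : line x v t 0 j - x 0 j = rc t * v 0 j.
Proof. by rewrite /line !mxE; ring. Qed.

Lemma cont_line x v t : cont_at (line x v) t.
Proof.
refine (cont_addmx (F := fun=> x) _ (cont_scalemx (F := fun=> v) (@cont_rc _ t) _));
  exact: cst_continuous.
Qed.

Lemma cont_comp_line f x v : cont_at f x ->
  cont_at (fun t => f (line x v t)) (0 : R).
Proof.
rewrite -{1}(line0 x v) => cf.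
exact: (@continuous_comp _ _ _ (line x v) f 0 (@cont_line x v 0) cf).
Qed.

Lemma contRe (T : topologicalType) (f : T -> C) t :
  cont_at f t -> cont_at (fun s => reC (f s)) t.
Proof. by move=> cf; apply: (continuous_comp cf); exact: cont_reC. Qed.

Lemma contIm (T : topologicalType) (f : T -> C) t :
  cont_at f t -> cont_at (fun s => imC (f s)) t.
Proof. by move=> cf; apply: (continuous_comp cf); exact: cont_imC. Qed.

(** The slopes of [f] along the line combine into a continuous slope of its restriction, whose value
    at 0 is the asserted derivative. *)
Lemma wd_line f x A B v : wd f x A B ->
  rdable f v x /\
  rd v f x = \sum_j (A j * v 0 j + B j * Num.conj (v 0 j)).
Proof.
move=> [p [q [cp ep E]]].
pose g t := \sum_j (p j (line x v t) * v 0 j + q j (line x v t) * Num.conj (v 0 j)).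
have cg : cont_at g 0.
  apply: cont_sum => j; have [c1 c2] := cp j.
  have c3 := cont_comp_line (v := v) c1; have c4 := cont_comp_line (v := v) c2.
  apply: contD.
    apply: contM; first exact: c3.
    exact: cont_cst.
  apply: contM; first exact: c4.
  exact: cont_cst.
have nf : \forall t \near (0 : R), f (line x v t) = f x + rc t * g t.
  have := @cont_line x v 0; rewrite /cont_at /prop_for /continuous_at line0 => cl.
  apply: (@filterS _ _ (nbhs_filter (0 : R)) _ _ _ (cl _ E)) => t /= ->.
  congr (_ + _); rewrite /g mulr_sumr; apply: eq_bigr => j _.
  by rewrite line_coordB rmorphM/= conj_rc; ring.
have [d1 e1] : derivable (fun t => reC (f (line x v t))) (0 : R) 1 /\
    derive1 (fun t => reC (f (line x v t))) 0 = complex.Re (g 0).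
  apply: caratheodory_derive (contRe cg) _.
  apply: (@filterS _ _ (nbhs_filter (0 : R)) _ _ _ nf) => t E1.
  by rewrite line0 E1 reCD reC_rcM.
have [d2 e2] : derivable (fun t => imC (f (line x v t))) (0 : R) 1 /\
    derive1 (fun t => imC (f (line x v t))) 0 = complex.Im (g 0).
  apply: caratheodory_derive (contIm cg) _.
  apply: (@filterS _ _ (nbhs_filter (0 : R)) _ _ _ nf) => t E1.
  by rewrite line0 E1 imCD imC_rcM.
split; first by split.
rewrite rdE e1 e2 -rectC.
rewrite /g line0; apply: eq_bigr => j _; have [-> ->] := ep j; by [].
Qed.

Lemma line_line y v t s : line (line y v t) v s = line y v (t + s).
Proof. by rewrite /line rcD scalerDl addrA. Qed.

(** The mean value theorem is applied to the real and imaginary parts separately, at two different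
    intermediate points; this is the source of the factor 2. *)
Lemma mvt_line f y v (s : R) (c : C) (e : R) :
  (forall t : R, `|t| <= `|s| -> rdable f v (line y v t) /\
     `|rd v f (line y v t) - c| <= rc e) ->
  `|f (line y v s) - f y - rc s * c| <= rc (2 * e * `|s|).
Proof.
move=> H.
have H1 (t : R) : `|t| <= `|s| ->
    is_derive t 1 (fun t => reC (f (line y v t))) (reC (rd v f (line y v t))).
  move=> /H[[d1 _] _]; rewrite rdE reC_rect.
  have E : (fun s => reC (f (line (line y v t) v s))) =
     (fun s => (fun t => reC (f (line y v t))) (t + s)).
    by apply/funext => s'; rewrite line_line.
  by rewrite E; apply: is_derive_shift0; rewrite -E.
have H2 (t : R) : `|t| <= `|s| ->
    is_derive t 1 (fun t => imC (f (line y v t))) (imC (rd v f (line y v t))).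
  move=> /H[[_ d2] _]; rewrite rdE imC_rect.
  have E : (fun s => imC (f (line (line y v t) v s))) =
     (fun s => (fun t => imC (f (line y v t))) (t + s)).
    by apply/funext => s'; rewrite line_line.
  by rewrite E; apply: is_derive_shift0; rewrite -E.
have [t1 t1s E1] := real_mvt H1; have [t2 t2s E2] := real_mvt H2.
rewrite line0 in E1 E2.
apply: le_trans (norm_parts _) _.
rewrite -rcD rc_le (_ : 2 * e * `|s| = e * `|s| + e * `|s|); last by ring.
apply: lerD.
  rewrite !(reCD, reCN) E1 reC_rcM mulrC -mulrBr normrM mulrC.
  rewrite ler_wpM2r// -reCN -reCD -rc_le -norm_rc.
  by apply: le_trans (norm_reC _) _; exact: (H t1 t1s).2.
rewrite !(imCD, imCN) E2 imC_rcM mulrC -mulrBr normrM mulrC.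
rewrite ler_wpM2r// -imCN -imCD -rc_le -norm_rc.
by apply: le_trans (norm_imC _) _; exact: (H t2 t2s).2.
Qed.

Lemma two_steps (a : 'I_n) (q : 'rV[C]_n) (z : C) :
  line (line q (exC a) (reC z)) (eyC a) (imC z) = q + z *: delta_mx 0 a.
Proof. by rewrite /line exCE eyCE scalerA -addrA -scalerDl [rc (imC z) * _]mulrC -rectC. Qed.

Definition C1_on (U : set 'rV[C]_n) f := forall a,
  [/\ forall x, U x -> rdable f (exC a) x /\ rdable f (eyC a) x,
      forall x, U x -> cont_at (rd (exC a) f) x
    & forall x, U x -> cont_at (rd (eyC a) f) x].

(** A complex step in one coordinate is a real step followed by an imaginary one; the mean value
    estimate is used on each, the partial derivatives being close to their values at [x]. *)
Lemma C1_step (U : set 'rV[C]_n) f x : open U -> C1_on U f -> U x ->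
  forall e : R, 0 < e -> exists2 d : R, 0 < d & forall a (q : 'rV[C]_n) (z : C),
  (forall j, `|q 0 j - x 0 j| < rc d) -> `|z| < rc d ->
  `|f (q + z *: delta_mx 0 a) - f q -
     (rc (reC z) * rd (exC a) f x + rc (imC z) * rd (eyC a) f x)| <= rc e * `|z|.
Proof.
move=> oU C1 Ux e e0.
(* A quarter, because [mvt_line] loses a factor 2 and there are two steps, each of length at most
   the modulus of [z]. *)
have e40 : (0 : C) < rc (e / 4) by rewrite -rc0 rc_lt divr_gt0.
have near1 : \forall p \near x, U p /\ forall a,
    `|rd (exC a) f p - rd (exC a) f x| <= rc (e / 4) /\
    `|rd (eyC a) f p - rd (eyC a) f x| <= rc (e / 4).
  have h1 : \forall p \near x, forall a,
    `|rd (exC a) f p - rd (exC a) f x| <= rc (e / 4) /\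
    `|rd (eyC a) f p - rd (eyC a) f x| <= rc (e / 4).
    apply: near_forall => a; have [_ cx cy] := C1 a.
    have nx := cont_dist e40 (cx x Ux); have ny := cont_dist e40 (cy x Ux).
    exact: (@filterS2 _ _ (nbhs_filter x) _ _ _ (fun p h1 h2 => conj h1 h2) nx ny).
  exact: (@filterI _ _ (nbhs_filter x) _ _ (open_near oU Ux) h1).
have [D D0 HD] := near_ball near1.
have [d d0 DE] := gt0_rc D0; rewrite {}DE in HD.
(* Room for [q] at distance d / 4 from [x] in each coordinate and for a real and an imaginary move
   of size d / 4 each. *)
exists (d / 4); first by rewrite divr_gt0.
move=> a q z qx zd.
have Rez : `|rc (reC z)| < rc (d / 4) := le_lt_trans (norm_reC z) zd.
have Imz : `|rc (imC z)| < rc (d / 4) := le_lt_trans (norm_imC z) zd.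
have inD (c : C) : `|c| < rc (d / 4) + rc (d / 4) ->
    `|q + c *: delta_mx 0 a - x| < rc d.
  move=> cd; apply: le_lt_trans (_ : rc (3 * (d / 4)) < _); last first.
    by rewrite rc_lt; lra.
  apply: norm_le_coord => [|j]; first by rewrite -rc0 rc_le; lra.
  rewrite (_ : (_ - x) 0 j = q 0 j - x 0 j + c * (j == a)%:R); last first.
    by rewrite !mxE; ring.
  apply: le_trans (ler_normD _ _) _.
  rewrite (_ : 3 * (d / 4) = d / 4 + (d / 4 + d / 4)); last by lra.
  rewrite !rcD; apply: lerD; first exact: ltW.
  apply: le_trans (ltW cd); rewrite normrM; case: (j == a).
    by rewrite normr1 mulr1.
  by rewrite normr0 mulr0.
pose q1 := line q (exC a) (reC z).
have h1 : `|q1 - x| < rc d.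
  by apply: inD; apply: lt_le_trans Rez _; rewrite lerDl -rc0 rc_le; lra.
have s1 : `|f q1 - f q - rc (reC z) * rd (exC a) f x| <= rc (2 * (e / 4) * `|reC z|).
  apply: mvt_line => t ts.
  have pt : `|line q (exC a) t - x| < rc d.
    apply: inD; rewrite norm_rc -rcD rc_lt; apply: le_lt_trans ts _.
    by move: Rez; rewrite norm_rc rc_lt; lra.
  have [Up Hp] := HD _ pt; have [dr _ _] := C1 a; split; first exact: (dr _ Up).1.
  exact: (Hp a).1.
have s2 : `|f (line q1 (eyC a) (imC z)) - f q1 - rc (imC z) * rd (eyC a) f x|
    <= rc (2 * (e / 4) * `|imC z|).
  apply: mvt_line => t ts.
  have pt : `|line q1 (eyC a) t - x| < rc d.
    rewrite /q1 (_ : line _ _ _ = q + (rc (reC z) + iC * rc t) *: delta_mx 0 a).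
      apply: inD; apply: le_lt_trans (ler_normD _ _) _; apply: ltrD => //.
      rewrite normrM norm_iC mul1r norm_rc rc_lt; apply: le_lt_trans ts _.
      by move: Imz; rewrite norm_rc rc_lt.
    by rewrite -two_steps reC_rect imC_rect.
  have [Up Hp] := HD _ pt; have [dr _ _] := C1 a; split; first exact: (dr _ Up).2.
  exact: (Hp a).2.
rewrite -two_steps -/q1.
rewrite (two_increments _ (f q1)).
apply: le_trans (ler_normD _ _) _; apply: le_trans (lerD s1 s2) _.
rewrite -rcD (_ : _ + _ = e / 2 * `|reC z| + e / 2 * `|imC z|); last by field.
rewrite rcD [rc (_ * `|reC z|)]rcM [rc (_ * `|imC z|)]rcM -!norm_rc (_ : rc e = rc (e / 2) + rc (e / 2)); last first.
  by rewrite -rcD; congr rc; lra.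
have e2 : (0 : C) < rc (e / 2) by rewrite -rc0 rc_lt divr_gt0.
by rewrite mulrDl lerD// ler_pM2l// ?norm_reC ?norm_imC.
Qed.

(** Passes from [z] to [y] by changing the coordinates listed in [r] one at a time, so that the
    increment of a function telescopes into single-coordinate steps. *)
Definition mix (y z : 'rV[C]_n) (r : seq 'I_n) : 'rV[C]_n :=
  \row_j (if j \in r then y 0 j else z 0 j).

Lemma C1_strict (U : set 'rV[C]_n) f x : open U -> C1_on U f -> U x ->
  forall e : C, 0 < e -> exists2 d : C, 0 < d & forall y z,
  `|y - x| < d -> `|z - x| < d ->
  `|f y - f z - \sum_a (rc (reC (y 0 a - z 0 a)) * rd (exC a) f x +
      rc (imC (y 0 a - z 0 a)) * rd (eyC a) f x)| <= e * `|y - z|.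
Proof.
move=> oU C1 Ux e /gt0_rc[{}e e0 ->].
(* Each of the n coordinates contributes at most this multiple of the norm of [y - z]; [n.+1] in
   place of n keeps the bound positive when n is 0. *)
have en0 : 0 < e / n.+1%:R by rewrite divr_gt0// ltr0n.
have [d d0 Hd] := C1_step oU C1 Ux en0.
exists (rc (d / 2)); first by rewrite -rc0 rc_lt divr_gt0.
move=> y z yx zx.
have zr j : `|z 0 j - x 0 j| < rc (d / 2).
  by apply: le_lt_trans zx; have := coord_le_norm (z - x) j; rewrite !mxE.
have yr j : `|y 0 j - x 0 j| < rc (d / 2).
  by apply: le_lt_trans yx; have := coord_le_norm (y - x) j; rewrite !mxE.
have d2d : rc (d / 2) < rc d by rewrite rc_lt; lra.
have key r : uniq r -> `|f (mix y z r) - f z - \sum_(a <- r)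
    (rc (reC (y 0 a - z 0 a)) * rd (exC a) f x +
     rc (imC (y 0 a - z 0 a)) * rd (eyC a) f x)|
     <= \sum_(a <- r) rc (e / n.+1%:R) * `|y 0 a - z 0 a|.
  elim: r => [_|a r IH /= /andP[ar ur]].
    rewrite !big_nil (_ : mix y z [::] = z) ?subrr ?subr0 ?normr0//.
    by apply/rowP => j; rewrite mxE.
  rewrite !big_cons.
  have -> : mix y z (a :: r) = mix y z r + (y 0 a - z 0 a) *: delta_mx 0 a.
    apply/rowP => j; rewrite !mxE inE eqxx /=.
    have [->|ja] := eqVneq j a; first by rewrite (negPf ar) mulr1 addrC subrK.
    by rewrite mulr0 addr0.
  have qx j : `|mix y z r 0 j - x 0 j| < rc d.
    by apply: (lt_trans _ d2d); rewrite mxE; case: ifP => _; [exact: yr|exact: zr].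
  have zd : `|y 0 a - z 0 a| < rc d.
    rewrite -(subrKA (x 0 a)); apply: le_lt_trans (ler_normD _ _) _.
    rewrite (_ : rc d = rc (d / 2) + rc (d / 2)); last by rewrite -rcD; congr rc; lra.
    by apply: ltrD; [exact: yr|rewrite distrC; exact: zr].
  have := lerD (Hd a _ _ qx zd) (IH ur); apply: le_trans.
  rewrite [X in _ - X]addrC (two_increments _ (f (mix y z r))) addrC.
  exact: ler_normD.
have := key _ (index_enum_uniq 'I_n).
rewrite (_ : mix _ _ _ = y); last first.
  by apply/rowP => j; rewrite mxE mem_index_enum.
move=> /le_trans; apply; rewrite -mulr_sumr.
have en : (0 : C) < rc (e / n.+1%:R) by rewrite -rc0 rc_lt.
have sn : \sum_a `|y 0 a - z 0 a| <= n%:R * `|y - z|.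
  rewrite mulr_natl -[n in _ *+ n]card_ord -sumr_const; apply: ler_sum => a _.
  by have := coord_le_norm (y - z) a; rewrite !mxE.
rewrite -(ler_pM2l en) in sn; apply: le_trans sn _; rewrite mulrA.
apply: ler_wpM2r => //.
have -> : (n%:R : C) = rc n%:R by rewrite rc_nat.
have nn : n.+1%:R^-1 * n%:R <= 1 :> R.
  by rewrite mulrC ler_pdivrMr ?ltr0n// mul1r ler_nat leqnSn.
rewrite -rcM rc_le -mulrA; exact: ler_piMr (ltW e0) nn.
Qed.

End LinesTheory.

Local Close Scope complex_scope.

Section Frechet.
Context {K : numClosedFieldType} {n : nat}.

(** The remainder [r] is distributed over the coordinates with weights conj d_j / sum of |d_i|^2, so
    that multiplying back by d_j and summing returns [r]; as [r] is small compared with the norm of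
    d, the added slopes tend to 0. *)
Lemma frechet_wd (f : 'rV[K]_n -> K) x A B :
  (forall e, 0 < e -> exists2 d, 0 < d & forall y, `|y - x| < d ->
   `|f y - f x - \sum_j (A j * (y 0 j - x 0 j) + B j * Num.conj (y 0 j - x 0 j))|
     <= e * `|y - x|) -> wd f x A B.
Proof.
move=> H.
pose r y := f y - f x -
  \sum_j (A j * (y 0 j - x 0 j) + B j * Num.conj (y 0 j - x 0 j)).
pose q (y : 'rV[K]_n) := \sum_j `|y 0 j - x 0 j| ^+ 2.
pose th j y := r y * (Num.conj (y 0 j - x 0 j) / q y).
have rx : r x = 0.
  rewrite /r subrr big1 ?subrr// => j _; by rewrite subrr conjC0 !mulr0 addr0.
have q0 y : 0 <= q y by apply: sumr_ge0 => j _; rewrite exprn_ge0.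
have qj (y : 'rV[K]_n) j : `|y 0 j - x 0 j| ^+ 2 <= q y.
  by rewrite /q (bigD1 j)//= lerDl sumr_ge0// => i _; rewrite exprn_ge0.
have nq (y : 'rV[K]_n) : `|y - x| ^+ 2 <= q y.
  have [v0|nv] := eqVneq `|y - x| 0; first by rewrite v0 expr0n/= q0.
  have [[a j] /= e] := mx_norm_neq0 nv.
  by rewrite [`|y - x|](_ : _ = mx_norm (y - x))// e [a]ord1 !mxE.
have th0 j : th j x = 0 by rewrite /th rx mul0r.
exists (fun j y => A j + th j y), (fun j _ => B j); split.
- move=> j; split; last exact: cont_cst.
  apply: contD; first exact: cont_cst.
  rewrite /cont_at /prop_for /continuous_at th0.
  apply/(@cvgrPdist_lt _ K^o _ (nbhs x) (nbhs_filter x)) => e e0.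
  have e20 : 0 < e / 2 by rewrite divr_gt0.
  have [d d0 Hd] := H _ e20.
  apply: (@filterS _ _ (nbhs_filter x) _ _ _ (ball_near x d0)) => y yd.
  rewrite sub0r normrN; apply: le_lt_trans (_ : e / 2 < e); last first.
    by rewrite ltr_pdivrMr// ltr_pMr// ltr1n.
  have [v0|nv] := eqVneq `|y - x| 0.
    have -> : y = x by apply/eqP; rewrite -subr_eq0 -normr_eq0 v0.
    by rewrite th0 normr0 ltW.
  have v0 : 0 < `|y - x| by rewrite lt_def nv normr_ge0.
  have qp : 0 < q y by apply: lt_le_trans (nq y); rewrite exprn_gt0.
  rewrite /th !normrM norm_conjC normfV (ger0_norm (q0 y)) mulrA ler_pdivrMr//.
  apply: le_trans (_ : e / 2 * `|y - x| * `|y - x| <= _); last first.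
    by rewrite -mulrA -expr2 ler_pM2l.
  apply: ler_pM => //; first exact: Hd.
  by have := coord_le_norm (y - x) j; rewrite !mxE.
- by move=> j; rewrite th0 addr0.
apply: filterE => y.
have [qy|qn] := eqVneq (q y) 0.
  have -> : y = x.
    apply/eqP; rewrite -subr_eq0 -normr_eq0 -sqrf_eq0 eq_le; apply/andP; split.
      by rewrite -qy; exact: nq.
    by rewrite exprn_ge0.
  by rewrite big1 ?addr0// => j _; rewrite subrr conjC0 !mulr0 addr0.
have rE : \sum_j th j y * (y 0 j - x 0 j) = r y.
  under eq_bigr => j _ do rewrite /th -mulrA mulrAC.
  rewrite -mulr_sumr -mulr_suml (_ : \sum_i _ = q y) ?divff ?mulr1//.
  by apply: eq_bigr => j _; rewrite mulrC -normCK.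
under eq_bigr => j _ do rewrite mulrDl addrAC.
rewrite big_split/= rE /r; ring.
Qed.

End Frechet.

Lemma wd_shift (K : numClosedFieldType) n (f : 'rV[K]_n -> K) x c A B :
  wd f (x + c) A B -> wd (fun y => f (y + c)) x A B.
Proof.
have cc : cont_at (fun y : 'rV[K]_n => y + c) x.
  by refine (cont_addmx (F := fun y => y) _ _); [exact: (fun=> id)|exact: cst_continuous].
move=> [p [q [cp ep E]]].
exists (fun j y => p j (y + c)), (fun j y => q j (y + c)); split => //.
  move=> j; have [c1 c2] := cp j.
  by split; [exact: (continuous_comp cc c1)|exact: (continuous_comp cc c2)].
apply: (@filterS _ _ (nbhs_filter x) _ _ _ (cc _ E)) => y /= ->; congr (_ + _).
by apply: eq_bigr => j _; rewrite !mxE opprD addrACA subrr addr0.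
Qed.

(* Polarization of a real-bilinear identity into its four Wirtinger components;
   i stands for the imaginary unit. *)
Lemma four_directions (K : numFieldType) (i m1 m2 m3 m4 m1' m2' m3' m4' : K) :
  i * i = -1 ->
  1 * (1 * m1 + 1 * m2) + 1 * (1 * m3 + 1 * m4) =
  1 * (1 * m1' + 1 * m3') + 1 * (1 * m2' + 1 * m4') ->
  1 * (i * m1 + - i * m2) + 1 * (i * m3 + - i * m4) =
  i * (1 * m1' + 1 * m3') + - i * (1 * m2' + 1 * m4') ->
  i * (1 * m1 + 1 * m2) + - i * (1 * m3 + 1 * m4) =
  1 * (i * m1' + - i * m3') + 1 * (i * m2' + - i * m4') ->
  i * (i * m1 + - i * m2) + - i * (i * m3 + - i * m4) =
  i * (i * m1' + - i * m3') + - i * (i * m2' + - i * m4') ->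
  m1 = m1' /\ m3 = m3'.
Proof.
move=> ii h1 h2 h3 h4.
have four0 : (4 : K) != 0 by rewrite pnatr_eq0.
have k1 : m1 - m1' + (m2 - m2') + (m3 - m3') + (m4 - m4') = 0.
  by move/eqP: h1; rewrite -subr_eq0 => /eqP <-; ring.
have k2 : m1 - m1' - (m2 - m2') + (m3 - m3') - (m4 - m4') = 0.
  move/eqP: h2; rewrite -subr_eq0 => /eqP/(congr1 (fun z => - i * z)).
  rewrite mulr0 => <-.
  transitivity (- (i * i) * (m1 - m1' - (m2 - m2') + (m3 - m3') - (m4 - m4'))).
    by rewrite ii opprK mul1r.
  ring.
have k3 : m1 - m1' + (m2 - m2') - (m3 - m3') - (m4 - m4') = 0.
  move/eqP: h3; rewrite -subr_eq0 => /eqP/(congr1 (fun z => - i * z)).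
  rewrite mulr0 => <-.
  transitivity (- (i * i) * (m1 - m1' + (m2 - m2') - (m3 - m3') - (m4 - m4'))).
    by rewrite ii opprK mul1r.
  ring.
have k4 : - (m1 - m1') + (m2 - m2') + (m3 - m3') - (m4 - m4') = 0.
  move/eqP: h4; rewrite -subr_eq0 => /eqP <-.
  transitivity ((i * i) * ((m1 - m1') - (m2 - m2') - (m3 - m3') + (m4 - m4'))).
    by rewrite ii; ring.
  ring.
split; apply/eqP; rewrite -subr_eq0; apply/eqP; apply: (mulfI four0); rewrite mulr0.
  have -> : 4 * (m1 - m1') = (m1 - m1' + (m2 - m2') + (m3 - m3') + (m4 - m4')) +
    (m1 - m1' - (m2 - m2') + (m3 - m3') - (m4 - m4')) +
    (m1 - m1' + (m2 - m2') - (m3 - m3') - (m4 - m4')) -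
    (- (m1 - m1') + (m2 - m2') + (m3 - m3') - (m4 - m4')) by ring.
  by rewrite k1 k2 k3 k4 subr0 !addr0.
have -> : 4 * (m3 - m3') = (m1 - m1' + (m2 - m2') + (m3 - m3') + (m4 - m4')) +
    (m1 - m1' - (m2 - m2') + (m3 - m3') - (m4 - m4')) -
    (m1 - m1' + (m2 - m2') - (m3 - m3') - (m4 - m4')) +
    (- (m1 - m1') + (m2 - m2') + (m3 - m3') - (m4 - m4')) by ring.
by rewrite k1 k2 k3 k4 subr0 !addr0.
Qed.

(** * Comparison with real partial derivatives, and symmetry of second derivatives *)

Section SmoothBridge.
Context {R : realType} {n : nat}.
Notation C := (complexN R).
Implicit Types (f : 'rV[C]_n -> C) (U : set 'rV[C]_n) (x v : 'rV[C]_n).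

Definition dzC a f x : C := 2^-1 * (rd (exC a) f x - iC * rd (eyC a) f x).
Definition dzbC a f x : C := 2^-1 * (rd (exC a) f x + iC * rd (eyC a) f x).

(** The real differential X dx + Y dy written in dz and dzbar. *)
Lemma dz_sum (X Y d : C) : rc (reC d) * X + rc (imC d) * Y =
  2^-1 * (X - iC * Y) * d + 2^-1 * (X + iC * Y) * Num.conj d.
Proof.
have E := rectC d.
have E' : Num.conj d = rc (reC d) - iC * rc (imC d).
  by rewrite {1}E rmorphD rmorphM/= !conj_rc conj_iC mulNr.
move: (rc (reC d)) (rc (imC d)) E E' => a b E ->; rewrite E.
rewrite [RHS](_ : _ = a * X - (iC * iC) * (b * Y)); last by field.
by rewrite iC2 mulN1r opprK.
Qed.

Lemma C1_wd U f x : open U -> C1_on U f -> U x ->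
  wd f x (fun a => dzC a f x) (fun a => dzbC a f x).
Proof.
move=> oU C1 Ux; apply: frechet_wd => e e0.
have [d d0 Hd] := C1_strict oU C1 Ux e0; exists d => // y yd.
have := Hd y x yd; rewrite subrr normr0 => /(_ d0).
congr (`|_ - _| <= _); apply: eq_bigr => a _; exact: dz_sum.
Qed.

Lemma Ck_cont k U f : Ck k U f -> forall x, U x -> cont_at f x.
Proof. by case: k => [/Ck0|k /CkS[]]. Qed.

Lemma Ck_C1 k U f : Ck k.+1 U f -> C1_on U f.
Proof.
move=> /CkS[_ H] a; have [dr Cx Cy] := H a.
by split; [exact: dr|exact: Ck_cont Cx|exact: Ck_cont Cy].
Qed.

(** Continuous real partial derivatives imply differentiability, by [C1_wd]; the Wirtinger
    derivatives are linear combinations of the real ones and lose one order. *)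
Lemma Ck_WC k U f : open U -> Ck k U f -> WC k U f.
Proof.
move=> oU; elim: k f => [|k IH] f; first by move/Ck0.
move=> H; exists (fun a => dzC a f), (fun a => dzbC a f); split.
  by move=> x Ux; apply: C1_wd oU (Ck_C1 H) Ux.
move=> a; move/CkS: H => [_ /(_ a)[_ /IH wx /IH wy]]; split.
  by apply: WCZ; apply: WCD wx (WCN (WCZ _ wy)).
by apply: WCZ; apply: WCD wx (WCZ _ wy).
Qed.

Lemma rd_exC f x A B a : wd f x A B -> rd (exC a) f x = A a + B a.
Proof.
move=> W; rewrite (wd_line (exC a) W).2 (bigD1 a)//= big1 => [|j ja].
  by rewrite exCE !mxE !eqxx conjC1 !mulr1 addr0.
by rewrite exCE !mxE (negPf ja) andbF conjC0 !mulr0 addr0.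
Qed.

Lemma rd_eyC f x A B a : wd f x A B -> rd (eyC a) f x = iC * (A a - B a).
Proof.
move=> W; rewrite (wd_line (eyC a) W).2 (bigD1 a)//= big1 => [|j ja].
  by rewrite eyCE !mxE !eqxx mulr1 conj_iC; ring.
by rewrite eyCE !mxE (negPf ja) andbF mulr0 conjC0 !mulr0 addr0.
Qed.

Lemma wd_rdable f x A B v : wd f x A B -> rdable f v x.
Proof. by move=> W; exact: (wd_line v W).1. Qed.

Lemma WC_Ck k U f : open U -> WC k U f -> Ck k U f.
Proof.
move=> oU; elim: k f => [|k IH] f H; first exact/Ck0.
apply/CkS; split; first by move=> x; exact: WC_cont H.
move: H => [A [B [W H]]] a; have [WA WB] := H a; split.
- by move=> x Ux; split; exact: wd_rdable (W x Ux).
- apply: IH; apply: (eq_WC oU (f := fun y => A a y + B a y)); last exact: WCD.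
  by move=> x /W/(rd_exC a).
apply: IH; apply: (eq_WC oU (f := fun y => iC * (A a y - B a y))).
  by move=> x /W/(rd_eyC a).
by apply: WCZ; apply: WCD WA (WCN WB).
Qed.

Lemma dzC_wd f x A B a : wd f x A B -> dzC a f x = A a /\ dzbC a f x = B a.
Proof.
move=> W; rewrite /dzC /dzbC (rd_exC a W) (rd_eyC a W) mulrA iC2.
by split; field.
Qed.

Lemma smooth_onE U f : open U -> smooth_on U f <-> smooth U f.
Proof. by move=> oU; split=> H k; [exact: Ck_WC|exact: WC_Ck]. Qed.

Lemma dz_pz U f x a : open U -> smooth U f -> U x ->
  dz a f x = pz a f x /\ dzb a f x = pzb a f x.
Proof.
move=> oU sf Ux; have [e1 e2] := dzC_wd a (smooth_wd oU sf Ux).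
by split; [rewrite dzE; exact: e1|rewrite dzbE; exact: e2].
Qed.

Lemma smooth_C1 U f : open U -> smooth U f -> C1_on U f.
Proof. by move=> oU sf; apply: (@Ck_C1 0); apply: WC_Ck oU (sf 1%N). Qed.

Lemma rd_wd f x A B v : wd f x A B ->
  rd v f x = \sum_j (A j * v 0 j + B j * Num.conj (v 0 j)).
Proof. by move=> /(wd_line v)[]. Qed.

Definition pd v f x : C := \sum_j (pz j f x * v 0 j + pzb j f x * Num.conj (v 0 j)).

Lemma smooth_pd U f v : open U -> smooth U f -> smooth U (pd v f).
Proof.
move=> oU sf k; apply: WC_sum => j; apply: WCD.
  exact: WCM (smooth_pz oU j sf k) (WC_cst _ _ _).
exact: WCM (smooth_pzb oU j sf k) (WC_cst _ _ _).
Qed.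

Lemma norm_rcE v : exists2 r : R, 0 <= r & `|v| = rc r.
Proof.
have [v0|nv] := eqVneq `|v| 0; first by exists 0; rewrite ?rc0.
have v0 : 0 < `|v| by rewrite lt_def nv normr_ge0.
by have [r r0 E] := gt0_rc v0; exists r => //; exact: ltW.
Qed.

(** The mean value estimate along [v] is applied to p -> f (p + h w) - f p, whose derivative is an
    increment of [pd v f]; strict differentiability of [pd v f] at [x] approximates that increment
    by h times its derivative along [w]. *)
Lemma second_difference U f x v w (e : R) : open U -> smooth U f -> U x -> 0 < e ->
  \forall h \near (0 : R), `|(f (line (line x w h) v h) - f (line x v h))
     - (f (line x w h) - f x) - rc h * (rc h * pd w (pd v f) x)|
   <= rc (e * `|h| * `|h|).
Proof.
move=> oU sf Ux e0; pose g := pd v f.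
have sg : smooth U g by exact: smooth_pd.
have [vn vn0 vE] := norm_rcE v; have [wn wn0 wE] := norm_rcE w.
(* The 2 compensates the factor of [mvt_line], and [1 + wn] absorbs the norm of [w], which may be
   0. *)
pose e1 := e / 2 / (1 + wn).
have e10 : 0 < e1 by rewrite !divr_gt0// ltr_pwDl.
have e1C : (0 : C) < rc e1 by rewrite -rc0 rc_lt.
have [d1 d10 Hd1] := C1_strict oU (smooth_C1 oU sg) Ux e1C.
have [d2 d20 Hd2] := near_ball (open_near oU Ux).
have [d d0 dd] : exists2 d : R, 0 < d & rc d <= d1 /\ rc d <= d2.
  have [D D0 HD] := finite_lower_bound (d := fun b : bool => if b then d1 else d2)
    (fun b => match b with true => d10 | false => d20 end).
  have [d d0 DE] := gt0_rc D0; exists d => //; rewrite -DE.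
  by split; [exact: (HD true)|exact: (HD false)].
(* For h below this bound the points x + t v + t' w with t and t' of modulus at most that of h all
   lie within d of [x]. *)
have b0 : 0 < d / (1 + vn + wn) by rewrite divr_gt0// !ltr_pwDl// ltr_wpDr.
have := near_dist (0 : R) b0.
apply: (@filterS _ _ (nbhs_filter (0 : R))) => h; rewrite sub0r normrN.
rewrite ltr_pdivlMr ?ltr_pwDl// ?ltr_wpDr// => hd.
have inb t t' : `|t| <= `|h| -> `|t'| <= `|h| -> `|line (line x v t) w t' - x| < rc d.
  move=> th th'; rewrite /line (_ : _ - x = rc t *: v + rc t' *: w); last first.
    by rewrite addrC addrA addrA addNr add0r.
  apply: le_lt_trans (ler_normD _ _) _; rewrite !normrZ !norm_rc vE wE -!rcM -rcD rc_lt.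
  apply: le_lt_trans hd; rewrite !mulrDr mulr1.
  have := ler_wpM2r vn0 th; have := ler_wpM2r wn0 th'; have := normr_ge0 h; lra.
have line_0 y u : line y u 0 = y by exact: line0.
have inb0 t : `|t| <= `|h| -> `|line x v t - x| < rc d.
  by move=> th; have := inb t 0 th; rewrite line_0 normr0; apply.
have inU p : `|p - x| < rc d -> U p.
  by move=> pd; apply: Hd2; apply: lt_le_trans dd.2.
pose f2 p := f (line p w h) - f p.
have -> : line (line x w h) v h = line (line x v h) w h by rewrite /line addrAC.
rewrite -/(f2 (line x v h)) -/(f2 x).
rewrite (_ : e * `|h| * `|h| = 2 * (e / 2 * `|h|) * `|h|); last by field.
apply: mvt_line => t th.
pose p := line x v t; have Up : U p by apply/inU/inb0.
have Uq : U (line p w h) by apply/inU/inb.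
have W2 := wdD (wd_shift (smooth_wd oU sf Uq)) (wdN (smooth_wd oU sf Up)).
split; first exact: wd_rdable W2.
rewrite (rd_wd v W2).
have -> : \sum_j ((pz j f (line p w h) - pz j f p) * v 0 j +
   (pzb j f (line p w h) - pzb j f p) * Num.conj (v 0 j)) = g (line p w h) - g p.
  rewrite /g /pd -sumrB; apply: eq_bigr => j _.
  by rewrite !mulrBl opprD addrACA.
have := Hd1 (line p w h) p (lt_le_trans (inb t h th (lexx _)) dd.1)
  (lt_le_trans (inb0 t th) dd.1).
have -> : \sum_a (rc (reC (line p w h 0 a - p 0 a)) * rd (exC a) g x +
    rc (imC (line p w h 0 a - p 0 a)) * rd (eyC a) g x) = rc h * pd w g x.
  rewrite /pd mulr_sumr; apply: eq_bigr => a _.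
  have [<- <-] := dzC_wd a (smooth_wd oU sg Ux).
  rewrite dz_sum line_coordB rmorphM/= conj_rc [RHS]mulrDr; congr (_ + _).
    by rewrite mulrCA.
  by rewrite mulrCA.
move=> H; apply: le_trans H _.
have -> : line p w h - p = rc h *: w by rewrite /line addrC addKr.
rewrite normrZ norm_rc wE -!rcM rc_le /e1.
rewrite (_ : e / 2 * `|h| = e / 2 / (1 + wn) * (`|h| * (1 + wn))); last first.
  by field; rewrite gt_eqF// ltr_pwDl.
by rewrite ler_pM2l// ler_wpM2l// lerDr.
Qed.

(** The second difference is symmetric in [v] and [w], and it approximates both iterated derivatives
    times the square of h. *)
Lemma pd_comm U f x v w : open U -> smooth U f -> U x ->
  pd w (pd v f) x = pd v (pd w f) x.
Proof.
move=> oU sf Ux; apply/eqP; rewrite -subr_eq0; apply: contraT => nz.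
have : 0 < `|pd w (pd v f) x - pd v (pd w f) x| by rewrite normr_gt0.
(* Two errors of c / 4 add up to c / 2, which is less than the supposed discrepancy c. *)
move=> /gt0_rc[c c0 cE]; have c40 : 0 < c / 4 by rewrite divr_gt0.
have n1 := second_difference v w oU sf Ux c40.
have n2 := second_difference w v oU sf Ux c40.
have [h h0 [H1 H2]] := near0_pos (@filterI _ _ (nbhs_filter (0 : R)) _ _ n1 n2).
move: H1 H2; rewrite (_ : line (line x v h) w h = line (line x w h) v h); last first.
  by rewrite /line addrAC.
move: (f (line _ v h)) (f (line x v h)) (f (line x w h)) (f x) => A1 A2 A3 A4 H1 H2.
have : rc h * rc h * `|pd w (pd v f) x - pd v (pd w f) x| <= rc (c / 2 * h * h).
  have -> : rc h * rc h * `|pd w (pd v f) x - pd v (pd w f) x| =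
    `|(A1 - A3 - (A2 - A4) - rc h * (rc h * pd v (pd w f) x)) -
      (A1 - A2 - (A3 - A4) - rc h * (rc h * pd w (pd v f) x))|.
    have hh : rc h * rc h = `|rc h * rc h| by rewrite -rcM norm_rc gtr0_norm// mulr_gt0.
    by rewrite {1}hh -normrM; congr (`|_|); ring.
  apply: le_trans (ler_normB _ _) _; apply: le_trans (lerD H2 H1) _.
  by rewrite -rcD rc_le gtr0_norm//; lra.
rewrite cE -!rcM rc_le leNgt => /negP[]; rewrite [_ * c]mulrC mulrA ltr_pM2r// ltr_pM2r//.
lra.
Qed.

End SmoothBridge.

Lemma complex_strict (R : realType) : strict_differentiability (complexN R).
Proof.
move=> n U f x oU sf Ux e e0.
have [d d0 Hd] := C1_strict oU (smooth_C1 oU sf) Ux e0; exists d => // y z yd zd.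
have := Hd y z yd zd; congr (`|_ - _| <= _); apply: eq_bigr => a _.
have [e1 e2] := dzC_wd a (smooth_wd oU sf Ux).
by rewrite -e1 -e2 dz_sum.
Qed.

Lemma pd_ee (R : realType) n (f : 'rV[complexN R]_n -> complexN R) U x a b
    (p q : complexN R) : open U -> smooth U f -> U x ->
  pd (q *: delta_mx 0 a) (pd (p *: delta_mx 0 b) f) x =
    q * (p * pz a (pz b f) x + Num.conj p * pz a (pzb b f) x) +
    Num.conj q * (p * pzb a (pz b f) x + Num.conj p * pzb a (pzb b f) x).
Proof.
move=> oU sf Ux.
have pdE (g : 'rV[complexN R]_n -> complexN R) y c (s : complexN R) :
    pd (s *: delta_mx 0 c) g y = s * pz c g y + Num.conj s * pzb c g y.
  rewrite /pd (bigD1 c)//= big1 => [|j jc]; last first.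
    by rewrite !mxE (negPf jc) andbF mulr0 conjC0 !mulr0 addr0.
  by rewrite !mxE !eqxx mulr1 addr0; ring.
have W := wdD (wdZ p (smooth_wd oU (smooth_pz oU b sf) Ux))
  (wdZ (Num.conj p) (smooth_wd oU (smooth_pzb oU b sf) Ux)).
rewrite pdE (_ : pd _ f = fun y => p * pz b f y + Num.conj p * pzb b f y).
  by rewrite (wd_pz a W) (wd_pzb a W).
by apply/funext => y; rewrite pdE.
Qed.

(** Directional derivatives commute in each of the four pairs of directions formed with 1 and the
    imaginary unit in coordinates [a] and [b]; [four_directions] extracts the Wirtinger
    components. *)
Lemma complex_schwarz (R : realType) : schwarz (K := complexN R).
Proof.
move=> n U f x oU sf Ux a b.
have H p q := pd_comm (q *: delta_mx 0 a) (p *: delta_mx 0 b) oU sf Ux.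
have {}H p q := etrans (esym (pd_ee a b p q oU sf Ux))
   (etrans (esym (H p q)) (pd_ee b a q p oU sf Ux)).
have h1 := H 1 1; have h2 := H iC 1; have h3 := H 1 iC; have h4 := H iC iC.
rewrite !conjC1 !conj_iC in h1 h2 h3 h4.
have [e1 e3] := four_directions (@iC2 R) h1 h2 h3 h4.
by split.
Qed.

Lemma ge0_rc (R : realType) (z : complexN R) : 0 <= z -> exists2 t : R, 0 <= t & z = rc t.
Proof.
rewrite le_eqVlt => /orP[/eqP <-|/gt0_rc[t t0 ->]]; first by exists 0; rewrite ?rc0.
by exists t => //; exact: ltW.
Qed.

Lemma cont_normK (K : numFieldType) (z : K) : cont_at (fun w : K => `|w|) z.
Proof. exact: (@norm_continuous K K^o z). Qed.

Lemma complex_compact_disc (R : realType) : compact_disc (complexN R).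
Proof.
move=> r.
have [r0|nr] := pselect (0 <= r); last first.
  rewrite (_ : [set z | _] = set0); first exact: compact0.
  by apply/seteqP; split => z //= /(le_trans (normr_ge0 z)).
have [t t0 ->] := ge0_rc r0.
pose g (p : R * R) : complexN R := rc p.1 + iC * rc p.2.
have cg p : cont_at g p.
  have c1 : cont_at (fun p : R * R => rc p.1) p.
    exact: (@continuous_comp _ _ _ (fun p : R * R => p.1) (@rc R) p cvg_fst (@cont_rc R p.1)).
  have c2 : cont_at (fun p : R * R => rc p.2) p.
    exact: (@continuous_comp _ _ _ (fun p : R * R => p.2) (@rc R) p cvg_snd (@cont_rc R p.2)).
  by apply: contD; [exact: c1|apply: contM; [exact: cont_cst|exact: c2]].
have cI : compact (`[- t, t]%classic `*` `[- t, t]%classic : set (R * R)).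
  by apply: compact_setX; exact: segment_compact.
have cgI : compact (g @` (`[- t, t]%classic `*` `[- t, t]%classic)).
  apply: continuous_compact cI.
  by apply: continuous_in_subspaceT => p _; exact: cg.
apply: (subclosed_compact _ cgI); last first.
  move=> z zt; exists (reC z, imC z); last by rewrite /g /= -rectC.
  have re : `|reC z| <= t.
    by rewrite -rc_le -norm_rc; exact: le_trans (norm_reC z) zt.
  have im : `|imC z| <= t.
    by rewrite -rc_le -norm_rc; exact: le_trans (norm_imC z) zt.
  by split; rewrite /= in_itv/= -ler_norml.
rewrite (_ : [set z | _] = (fun z : complexN R => reC `|z|) @^-1` [set x | x <= t]).
  apply: closed_comp; last exact: closed_le.
  by move=> z _; exact: contRe (@cont_normK _ z).
apply/seteqP; split => z /=; have [s s0 ->] := ge0_rc (normr_ge0 z).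
  by rewrite rc_le reC_rc.
by rewrite reC_rc rc_le.
Qed.

(** The values of [f] on [A] are nonnegative, hence real, and their order is that of the real
    parts. *)
Lemma complex_attains_min (R : realType) : attains_min (complexN R).
Proof.
move=> T A f A0 cA cf f0.
have cRe : {within A, continuous (fun x => reC (f x))}.
  by apply: continuous_in_subspaceT => x /set_mem Ax; exact: contRe (cf x Ax).
have [c /set_mem cA' Hc] := compact_EVT_min A0 cA cRe.
exists c => // t At; have := Hc t (mem_set At).
have [r r0 ->] := ge0_rc (f0 t At); have [r' r0' ->] := ge0_rc (f0 c cA').
by rewrite !reC_rc rc_le.
Qed.

(** * Local nature of smoothness, and closed forms under pull-back *)

Section LocalCalculus.
Context {K : numClosedFieldType}.

(** [pz] and [pzb] are defined globally by the germ of the function, so the derivatives found on the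
    small open sets agree and no gluing is required. *)
Lemma WC_local n k (U : set 'rV[K]_n) f :
  (forall x, U x -> exists W : set 'rV[K]_n, [/\ open W, W x & WC k W f]) -> WC k U f.
Proof.
elim: k f => [|k IH] f H.
  by move=> x /H[W [oW Wx WC0]]; exact: WC0.
exists (fun a => pz a f), (fun a => pzb a f); split.
  by move=> x /H[W [oW Wx /(WCE _ _ oW)[wf _]]]; exact: wf.
by move=> a; split; apply: IH => x /H[W [oW Wx /(WCE _ _ oW)[_ /(_ a)[Wa Wb]]]];
  exists W.
Qed.

Lemma smooth_local n (U : set 'rV[K]_n) f :
  (forall x, U x -> exists W : set 'rV[K]_n, [/\ open W, W x & smooth W f]) ->
  smooth U f.
Proof.
move=> H k; apply: WC_local => x /H[W [oW Wx sW]]; exists W; split => //; exact: sW.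
Qed.

Lemma near_jacobian n m (F G : 'rV[K]_n -> 'rV[K]_m) x :
  (\forall y \near x, F y = G y) -> jacobian F x = jacobian G x.
Proof.
move=> FG; apply/matrixP => a j; rewrite !mxE; apply: near_pz.
by apply: (@filterS _ _ (nbhs_filter x) _ _ _ FG) => y ->.
Qed.

Lemma jacobian_comp n m q (U : set 'rV[K]_n) (V : set 'rV[K]_m)
    (F : 'rV[K]_n -> 'rV[K]_m) (G : 'rV[K]_m -> 'rV[K]_q) x :
  open U -> open V -> hol_map U F -> hol_map V G -> U x -> V (F x) ->
  jacobian (fun y => G (F y)) x = jacobian F x *m jacobian G (F x).
Proof.
move=> oU oV hF hG Ux Vx; apply/matrixP => a j; rewrite !mxE.
rewrite (wd_pz a (wd_comp_hol (hol_wd oV (hG j) Vx) (fun i => hol_wd oU (hF i) Ux))).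
by apply: eq_bigr => i _; rewrite !mxE mulrC.
Qed.

Lemma pull_comp n m q (J : 'M[K]_(n, m)) (J' : 'M[K]_(m, q)) M :
  pull (J *m J') M = pull J (pull J' M).
Proof. by rewrite /pull map_mxM trmx_mul !mulmxA. Qed.

(** Vanishing of the (2,1) part of the differential; for a hermitian matrix of coefficients the
    (1,2) part follows by conjugation. *)
Definition pz_closed n (U : set 'rV[K]_n) (h : 'rV[K]_n -> 'M[K]_n) :=
  forall x g a b, U x -> pz g (fun y => h y a b) x = pz a (fun y => h y g b) x.

Lemma pzb_closed n (U : set 'rV[K]_n) (h : 'rV[K]_n -> 'M[K]_n) x g a b :
  open U -> U x -> (forall y, U y -> hermitian (h y)) ->
  (forall g d, smooth U (fun y => h y g d)) -> pz_closed U h ->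
  pzb g (fun y => h y a b) x = pzb b (fun y => h y a g) x.
Proof.
move=> oU Ux hh sh ch.
by rewrite !(wd_hermitian _ oU Ux hh (sh _ _)) ch.
Qed.

(** The conjugate Jacobian is antiholomorphic and has no holomorphic derivative. Of the two
    remaining terms, one is symmetric because second derivatives of [F] commute, the other because
    [b] is closed. *)
Lemma pull_closed n m (U : set 'rV[K]_n) (V : set 'rV[K]_m)
    (F : 'rV[K]_n -> 'rV[K]_m) (b : 'rV[K]_m -> 'M[K]_m) :
  schwarz (K := K) -> open U -> open V -> (forall y, U y -> V (F y)) -> hol_map U F ->
  (forall g d, smooth V (fun y => b y g d)) -> pz_closed V b ->
  pz_closed U (fun y => pull (jacobian F y) (b (F y))).
Proof.
move=> KS oU oV UV hF sb cb x g a d Ux.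
pose D g a := \sum_j \sum_i ((pz g (pz a (fun y => F y 0 i)) x * b (F x) i j
   + pz a (fun y => F y 0 i) x * \sum_k (pz k (fun y => b y i j) (F x) *
       pz g (fun y => F y 0 k) x)) * Num.conj (pz d (fun y => F y 0 j) x)).
have DE g' a' : pz g' (fun y => pull (jacobian F y) (b (F y)) a' d) x = D g' a'.
  have E : (fun y => pull (jacobian F y) (b (F y)) a' d) = fun y => \sum_j
     (\sum_i pz a' (fun y => F y 0 i) y * b (F y) i j) *
       Num.conj (pz d (fun y => F y 0 j) y).
    apply/funext => y; rewrite /pull mxE; apply: eq_bigr => j _; rewrite mxE !mxE.
    by congr (_ * _); apply: eq_bigr => i _; rewrite !mxE.
  have W i j := wdM (hol_wd oU (hol_pz KS a' oU (hF i)) Ux)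
    (wd_comp_hol (smooth_wd oV (sb i j) (UV _ Ux)) (fun k => hol_wd oU (hF k) Ux)).
  have Wc j := wd_conj_hol (hol_wd oU (hol_pz KS d oU (hF j)) Ux).
  rewrite E (wd_pz g' (wd_sum (index_enum _) (fun j =>
    wdM (wd_sum (index_enum _) (fun i => W i j)) (Wc j)))).
  by apply: eq_bigr => j _; rewrite mulr0 addr0 mulr_suml.
rewrite !DE; apply: eq_bigr => j _.
rewrite -!mulr_suml; congr (_ * _); rewrite !big_split/=; congr (_ + _).
  by apply: eq_bigr => i _; have [-> _] := KS _ _ _ _ oU (hF i).1 Ux g a.
under eq_bigr => i _ do rewrite mulr_sumr.
under [in RHS]eq_bigr => i _ do rewrite mulr_sumr.
rewrite [in RHS]exchange_big; apply: eq_bigr => i _; apply: eq_bigr => k _.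
by rewrite (cb _ i k j (UV _ Ux)); ring.
Qed.

End LocalCalculus.

Section Bridge.
Context {R : realType}.
Notation C := (complexN R).

Lemma holomorphic_mapE n m (U : set 'rV[C]_n) (F : 'rV[C]_n -> 'rV[C]_m) : open U ->
  holomorphic_map_on U F <-> hol_map U F.
Proof.
move=> oU; split=> H j; have [sf hf] := H j.
  have sf' := (smooth_onE _ oU).1 sf; split => // x a Ux.
  by have [_ <-] := dz_pz a oU sf' Ux; exact: hf.
split; first exact/(smooth_onE _ oU).
by move=> x Ux a; have [_ ->] := dz_pz a oU sf Ux; exact: hf.
Qed.

Lemma jacE n m (U : set 'rV[C]_n) (F : 'rV[C]_n -> 'rV[C]_m) x : open U ->
  hol_map U F -> U x -> jac F x = jacobian F x.
Proof.
move=> oU hF Ux; apply/matrixP => a j.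
have [e _] := dz_pz a oU (hF j).1 Ux.
by rewrite [RHS]mxE -e mxE.
Qed.

Lemma curvE n (h : 'rV[C]_n -> 'M[C]_n) (U : set 'rV[C]_n) x g d a b : open U ->
  (forall g d, smooth U (fun y => h y g d)) -> U x ->
  curv h x g d a b = riem h x g d a b :> C.
Proof.
move=> oU sh Ux; rewrite /curv /riem.
have e1 : dz a (dzb b (fun y => h y g d)) x = pz a (pzb b (fun y => h y g d)) x :> C.
  pose db : 'rV[C]_n -> C := fun y => dzb b (fun y => h y g d) y.
  have E y : U y -> pzb b (fun y => h y g d) y = db y.
    by move=> Uy; have [_ e] := dz_pz b oU (sh g d) Uy; rewrite /db e.
  have s1 : smooth U db := eq_smooth oU E (smooth_pzb oU b (sh g d)).
  have [e _] := dz_pz a oU s1 Ux.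
  by rewrite (eq_pz oU a E Ux); exact: e.
have e2 mu : dz a (fun y => h y g mu) x = pz a (fun y => h y g mu) x :> C.
  by have [-> _] := dz_pz a oU (sh g mu) Ux.
have e3 nu : dzb b (fun y => h y nu d) x = pzb b (fun y => h y nu d) x :> C.
  by have [_ ->] := dz_pz b oU (sh nu d) Ux.
congr (- _ + _); first exact: e1.
apply: eq_bigr => mu _; apply: eq_bigr => nu _.
congr (_ * _ * _); [exact: e2|exact: e3].
Qed.

Lemma hscE n (h : 'rV[C]_n -> 'M[C]_n) (U : set 'rV[C]_n) x xi : open U ->
  (forall g d, smooth U (fun y => h y g d)) -> U x ->
  hsc h x xi = quart h x xi / hq (h x) xi ^+ 2 :> C.
Proof.
move=> oU sh Ux; rewrite /hsc /quart; congr (_ / _).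
apply: eq_bigr => g _; apply: eq_bigr => d _; apply: eq_bigr => a _.
apply: eq_bigr => b _; congr (_ * _ * _ * _ * _); exact: curvE oU sh Ux.
Qed.

End Bridge.

(** * Forms on complex manifolds *)

Section Representations.
Context {R : realType}.
Notation C := (complexN R).

(* The charts of Defs with R[i] replaced by complexN R *)
Definition ci (T : topologicalType) n (c : chart R T n) : set 'rV[C]_n := cimg c.

Definition repC (T T' : topologicalType) n m (F : T -> T')
  (c : chart R T n) (d : chart R T' m) : 'rV[C]_n -> 'rV[C]_m := rep F c d.

Definition domC (T T' : topologicalType) n m (F : T -> T')
  (c : chart R T n) (d : chart R T' m) : set 'rV[C]_n := rep_dom F c d.

Definition cinvC (T : topologicalType) n (c : chart R T n) : 'rV[C]_n -> T := cinv c.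

Lemma open_ci (T : topologicalType) n (c : chart R T n) : open (ci c).
Proof. exact: cimg_open. Qed.
Arguments open_ci {T n} c.

Lemma cont_cinv (T : topologicalType) n (c : chart R T n) t : ci c t ->
  cont_at (cinvC c) t.
Proof. exact: cinv_cont. Qed.

Lemma cont_cmap (T : topologicalType) n (c : chart R T n) x : cdom c x ->
  cont_at (cmap c : T -> 'rV[C]_n) x.
Proof. exact: cmap_cont. Qed.

Lemma near_domC (T T' : topologicalType) n m (F : T -> T') (c : chart R T n) (d : chart R T' m)
    (t : 'rV[C]_n) :
  continuous F -> domC F c d t -> \forall s \near t, domC F c d s.
Proof.
move=> cF [ct dt].
have n1 : \forall s \near t, cdom d (F (cinvC c s)).
  have n2 : \forall x \near cinvC c t, cdom d (F x).
    apply: (cF (cinvC c t)); apply: open_nbhs_nbhs; split => //; exact: cdom_open.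
  exact: (cont_cinv ct n2).
have h2 : \forall s \near t, ci c s := open_near (open_ci c) ct.
exact: (@filterI _ _ (nbhs_filter t) _ _ h2 n1).
Qed.

Lemma open_domC (T T' : topologicalType) n m (F : T -> T') (c : chart R T n) (d : chart R T' m) :
  continuous F -> open (domC F c d).
Proof. by move=> cF; rewrite openE => t; exact: near_domC. Qed.
Arguments open_domC {T T' n m F} c d cF.

Lemma repC_ci (T T' : topologicalType) n m (F : T -> T') (c : chart R T n) (d : chart R T' m) t :
  domC F c d t -> ci d (repC F c d t).
Proof. by move=> [_ dt]; exact: cmap_img. Qed.

Lemma repC_inv (T T' : topologicalType) n m (F : T -> T') (c : chart R T n) (d : chart R T' m) t :
  domC F c d t -> cinv d (repC F c d t) = F (cinv c t).
Proof. by move=> [_ dt]; exact: cmapK. Qed.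

Lemma repC_comp (T T' T'' : topologicalType) n m q (F : T -> T') (G : T' -> T'')
    (c : chart R T n) (d : chart R T' m) (e : chart R T'' q) t :
  domC F c d t -> repC G d e (repC F c d t) = repC (fun x => G (F x)) c e t.
Proof.
by move=> dt; rewrite {1}/repC /rep -/(repC F c d t) (repC_inv dt).
Qed.

Lemma domC_comp (T T' T'' : topologicalType) n m q (F : T -> T') (G : T' -> T'')
    (c : chart R T n) (d : chart R T' m) (e : chart R T'' q) t :
  domC F c d t -> domC (fun x => G (F x)) c e t -> domC G d e (repC F c d t).
Proof.
by move=> dt [_ et]; split; [exact: repC_ci|rewrite (repC_inv dt)].
Qed.

Lemma jacobian_repC (T T' T'' : topologicalType) n m q (F : T -> T') (G : T' -> T'')
    (c : chart R T n) (d : chart R T' m) (e : chart R T'' q) t :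
  continuous F -> continuous G ->
  hol_map (domC F c d) (repC F c d) -> hol_map (domC G d e) (repC G d e) ->
  domC F c d t -> domC (fun x => G (F x)) c e t ->
  jacobian (repC (fun x => G (F x)) c e) t =
  jacobian (repC F c d) t *m jacobian (repC G d e) (repC F c d t).
Proof.
move=> cF cG hF hG dt et.
rewrite -(jacobian_comp (open_domC _ _ cF) (open_domC _ _ cG) hF hG dt (domC_comp dt et)).
apply: near_jacobian.
by apply: (@filterS _ _ (nbhs_filter t) _ _ _ (near_domC cF dt)) => s /repC_comp ->.
Qed.

End Representations.
Arguments open_ci {R T n} c.
Arguments open_domC {R T T' n m F} c d cF.

Section Manifold.
Context {R : realType} {n : nat} (X : complexManifold R n).
Notation C := (complexN R).
Implicit Types c d : chart R X n.

Lemma transition_hol c d : atlas X c -> atlas X d ->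
  hol_map (domC (idfun : X -> X) c d) (repC (idfun : X -> X) c d).
Proof.
move=> Ac Ad; apply/(holomorphic_mapE _ (open_domC c d (fun x => cvg_id))).
exact: atlas_holomorphic.
Qed.

Lemma continuous_idfun (T : topologicalType) : continuous (idfun : T -> T).
Proof. by move=> x; exact: cvg_id. Qed.

Lemma jacobian_id (x : 'rV[C]_n) : jacobian (fun y => y) x = 1%:M.
Proof.
by apply/matrixP => a j; rewrite !mxE (wd_pz a (wd_coord j x)).
Qed.

Lemma domC_sym c d t : domC (idfun : X -> X) c d t -> domC (idfun : X -> X) d c (repC (idfun : X -> X) c d t).
Proof.
move=> dt; split; first exact: repC_ci.
by rewrite (repC_inv dt) /=; apply: cinv_dom; case: dt.
Qed.

Lemma transitionK c d t : domC (idfun : X -> X) c d t ->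
  repC (idfun : X -> X) d c (repC (idfun : X -> X) c d t) = t.
Proof. by move=> dt; rewrite /repC /rep (repC_inv dt) /=; apply: cinvK; case: dt. Qed.

Lemma transition_jacK c d t : atlas X c -> atlas X d -> domC (idfun : X -> X) c d t ->
  jacobian (repC (idfun : X -> X) c d) t *m jacobian (repC (idfun : X -> X) d c) (repC (idfun : X -> X) c d t) = 1%:M.
Proof.
move=> Ac Ad dt; rewrite -(jacobian_id t).
have ci1 := @continuous_idfun X.
rewrite -(jacobian_comp (open_domC _ _ ci1) (open_domC _ _ ci1) (transition_hol Ac Ad)
  (transition_hol Ad Ac) dt (domC_sym dt)).
apply: near_jacobian.
by apply: (@filterS _ _ (nbhs_filter t) _ _ _ (near_domC ci1 dt)) => s /transitionK.
Qed.

(** [closed_real_form] in terms of [pull] and [pz], with closedness reduced to its (2,1) half. *)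
Definition mform (w : coeffs R X n) : Prop :=
  [/\ forall c d, atlas X c -> atlas X d -> forall t, domC (idfun : X -> X) c d t ->
        (w c t : 'M[C]_n) = pull (jacobian (repC (idfun : X -> X) c d) t) (w d (repC (idfun : X -> X) c d t)),
      forall c, atlas X c -> forall a b, smooth (ci c) (fun t => w c t a b : C),
      forall c, atlas X c -> forall t, ci c t -> hermitian (w c t : 'M[C]_n)
    & forall c, atlas X c -> pz_closed (ci c) (w c : 'rV[C]_n -> 'M[C]_n)].

Lemma mformE (w : coeffs R X n) : closed_real_form (atlas X) w <-> mform w.
Proof.
have ci1 := @continuous_idfun X.
have jE c d t : atlas X c -> atlas X d -> domC (idfun : X -> X) c d t ->
    jac (rep idfun c d) t = jacobian (repC (idfun : X -> X) c d) t :> 'M[C]_n.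
  by move=> Ac Ad dt; exact: (jacE (open_domC c d ci1) (transition_hol Ac Ad) dt).
split.
  move=> [w1 w2 w3 w4]; split.
  - by move=> c d Ac Ad t dt; rewrite -jE//; exact: (w1 c d Ac Ad t dt).
  - by move=> c Ac a b; apply/(smooth_onE _ (open_ci c)); exact: w2.
  - by move=> c Ac t ct a b; exact: w3.
  move=> c Ac t g a b ct.
  have sw u v : smooth (ci c) (fun t => w c t u v : C).
    by apply/(smooth_onE _ (open_ci c)); exact: w2.
  have [e _] := w4 c Ac t ct g a b; apply/eqP; rewrite -subr_eq0; apply/eqP.
  have [<- _] := dz_pz g (open_ci c) (sw a b) ct.
  by have [<- _] := dz_pz a (open_ci c) (sw g b) ct.
move=> [w1 w2 w3 w4]; split.
- move=> c d Ac Ad t dt; rewrite /pull_mx; have := w1 c d Ac Ad t dt.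
  by rewrite -jE.
- by move=> c Ac a b; apply/(smooth_onE _ (open_ci c)); exact: w2.
- by move=> c Ac t ct a b; exact: w3.
move=> c Ac t ct g a b; split.
  apply/eqP; rewrite subr_eq0; apply/eqP.
  have [e1 _] := dz_pz g (open_ci c) (w2 c Ac a b) ct.
  have [e2 _] := dz_pz a (open_ci c) (w2 c Ac g b) ct.
  exact: etrans e1 (etrans (w4 c Ac t g a b ct) (esym e2)).
apply/eqP; rewrite subr_eq0; apply/eqP.
have [_ e1] := dz_pz g (open_ci c) (w2 c Ac a b) ct.
have [_ e2] := dz_pz b (open_ci c) (w2 c Ac a g) ct.
apply: etrans e1 (etrans _ (esym e2)).
exact: (pzb_closed _ _ _ (open_ci c) ct (w3 c Ac) (w2 c Ac) (w4 c Ac)).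
Qed.

End Manifold.

Section Pullback.
Context {R : realType} {n m : nat} {X : complexManifold R n} {B : complexManifold R m}.
Notation C := (complexN R).
Implicit Types (c : chart R X n) (d : chart R B m) (w : coeffs R X n).
Variable p : X -> B.
Hypothesis cp : continuous p.
Hypothesis hp : forall c d, atlas X c -> atlas B d -> hol_map (domC p c d) (repC p c d).
Variable wB : coeffs R B m.
Hypothesis wBP : mform wB.

Definition pull_form : coeffs R X n := fun c t =>
  let d := chart_at B (p (cinvC c t)) in
  pull (jacobian (repC p c d) t) (wB d (repC p c d t) : 'M[C]_m) : 'M[C]_n.

(** The chart of the base selected in [pull_form] varies with the point; compatibility of [wB]
    allows any fixed chart [d] instead, so that [pull_form] can be differentiated. *)
Lemma pull_formE c d t : atlas X c -> atlas B d -> domC p c d t ->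
  (pull_form c t : 'M[C]_n) =
    pull (jacobian (repC p c d) t) (wB d (repC p c d t) : 'M[C]_m).
Proof.
move=> Ac Ad dt; rewrite /pull_form; set d0 := chart_at B _.
have A0 : atlas B d0 := chart_at_atlas _.
have dt0 : domC p c d0 t by split; [case: dt|exact: chart_at_dom].
have d2 : domC (idfun : B -> B) d0 d (repC p c d0 t) := domC_comp dt0 dt.
have [compat _ _ _] := wBP.
rewrite (compat _ _ A0 Ad _ d2) -pull_comp.
rewrite -(jacobian_repC (G := (idfun : B -> B)) cp (@continuous_idfun B) (hp Ac A0)
  (transition_hol A0 Ad) dt0 dt).
by rewrite (repC_comp _ _ dt0).
Qed.

Let chart_nbhd c t : atlas X c -> ci c t ->
  let d := chart_at B (p (cinvC c t)) in atlas B d /\ domC p c d t.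
Proof.
by move=> Ac ct; split; [exact: chart_at_atlas|split => //; exact: chart_at_dom].
Qed.

Let ciB d a b : atlas B d -> smooth (ci d) (fun t => wB d t a b : C).
Proof. by move=> Ad; have [_ H _ _] := wBP; exact: H. Qed.

Let smooth_pull_rep c d a b : atlas X c -> atlas B d -> smooth (domC p c d)
  (fun t => pull (jacobian (repC p c d) t) (wB d (repC p c d t) : 'M[C]_m) a b).
Proof.
move=> Ac Ad.
exact: (smooth_pull (b := wB d : 'rV[C]_m -> 'M[C]_m) (open_domC c d cp)
  (fun y => @repC_ci _ _ _ _ _ p c d y) (hp Ac Ad) (fun g e => ciB g e Ad)).
Qed.

Lemma mform_pull : mform pull_form.
Proof.
have [compat _ herm clos] := wBP.
split.
- move=> c c' Ac Ac' t dt.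
  have [Ad dd] := chart_nbhd Ac dt.1; move: dd Ad; set d := chart_at B _ => dd Ad.
  have dd' := domC_comp dt dd.
  rewrite (pull_formE Ac Ad dd) (pull_formE Ac' Ad dd') -pull_comp.
  rewrite -(jacobian_repC (@continuous_idfun X) cp (transition_hol Ac Ac') (hp Ac' Ad) dt dd).
  by rewrite (repC_comp p d dt).
- move=> c Ac a b; apply: smooth_local => t ct.
  have [Ad dd] := chart_nbhd Ac ct; move: dd Ad; set d := chart_at B _ => dd Ad.
  exists (domC p c d); split; [exact: open_domC|exact: dd|].
  apply: (eq_smooth (open_domC c d cp) _ (smooth_pull_rep a b Ac Ad)) => s ds.
  by rewrite -pull_formE.
- move=> c Ac t ct.
  have [Ad dd] := chart_nbhd Ac ct; move: dd Ad; set d := chart_at B _ => dd Ad.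
  rewrite (pull_formE Ac Ad dd); apply: pull_hermitian.
  by apply: herm => //; exact: repC_ci.
move=> c Ac t g a b ct.
have [Ad dd] := chart_nbhd Ac ct; move: dd Ad; set d := chart_at B _ => dd Ad.
have oW := open_domC c d cp.
have E e f s : domC p c d s -> (pull_form c s e f : C) =
    pull (jacobian (repC p c d) s) (wB d (repC p c d s) : 'M[C]_m) e f.
  by move=> ds; rewrite -pull_formE.
rewrite (eq_pz oW g (E a b) dd) (eq_pz oW a (E g b) dd).
exact: (pull_closed (complex_schwarz (R := R)) oW (open_ci d)
  (fun y => @repC_ci _ _ _ _ _ p c d y) (hp Ac Ad) (fun g e => ciB g e Ad) (clos d Ad)).
Qed.

Lemma mform_comb w w' (k : C) : k \is Num.real -> mform w -> mform w' ->
  mform (fun c t => (w c t : 'M[C]_n) + k *: (w' c t : 'M[C]_n) : 'M[C]_n).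
Proof.
move=> /CrealP kr [w1 w2 w3 w4] [v1 v2 v3 v4]; split.
- move=> c d Ac Ad t dt; rewrite (w1 c d) // (v1 c d) //.
  by rewrite /pull mulmxDr mulmxDl -scalemxAr -scalemxAl.
- move=> c Ac a b N.
  rewrite (_ : (fun t => _) = (fun t => (w c t a b : C) + k * (w' c t a b : C))).
    by apply: WCD; [exact: w2|apply: WCZ; exact: v2].
  by apply/funext => t; rewrite !mxE.
- move=> c Ac t ct a b.
  by rewrite !mxE rmorphD rmorphM/= kr; congr (_ + _ * _); [exact: w3|exact: v3].
move=> c Ac t g a b ct.
have E e f : (fun t => ((w c t : 'M[C]_n) + k *: (w' c t : 'M[C]_n)) e f) =
   fun t => (w c t e f : C) + k * (w' c t e f : C).
  by apply/funext => s; rewrite !mxE.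
have W e f := smooth_wd (open_ci c) (w2 c Ac e f) ct.
have W' e f := smooth_wd (open_ci c) (v2 c Ac e f) ct.
rewrite !E (wd_pz g (wdD (W a b) (wdZ k (W' a b)))) (wd_pz a (wdD (W g b) (wdZ k (W' g b)))).
by rewrite (w4 c Ac t g a b ct) (v4 c Ac t g a b ct).
Qed.

End Pullback.

(** * Fibres *)

Section VerticalJets.
Context {K : numClosedFieldType}.
Hypothesis KS : schwarz (K := K).

Lemma wd_affine n p (t0 : 'rV[K]_n) (P : 'M[K]_(n, p)) x j :
  wd (fun v => ((v - t0) *m P) 0 j) x (fun a => P a j) (fun=> 0).
Proof.
have -> : (fun v : 'rV[K]_n => ((v - t0) *m P) 0 j) =
    fun v => \sum_i P i j * (v 0 i + (- t0 0 i)).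
  by apply/funext => v; rewrite mxE; apply: eq_bigr => i _; rewrite !mxE mulrC.
apply: eq_wd (wd_sum (index_enum _) (fun i => wdZ (P i j)
  (wdD (wd_coord i x) (wd_cst (- t0 0 i) x)))) => a.
  rewrite (bigD1 a)//= big1 => [|i ia]; first by rewrite eqxx !addr0 /= mulr1.
  by rewrite eq_sym (negbTE ia) addr0 mulr0.
by rewrite big1 // => i _; rewrite addr0 mulr0.
Qed.

Lemma hol_affine n p (t0 : 'rV[K]_n) (P : 'M[K]_(n, p)) :
  hol_map setT (fun v => (v - t0) *m P).
Proof.
move=> j; split; last by move=> x a _; exact: (wd_pzb a (wd_affine t0 P x j)).
move=> k; rewrite (_ : (fun v => _) =
    fun v : 'rV[K]_n => \sum_i P i j * (v 0 i + (- t0 0 i))); last first.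
  by apply/funext => v; rewrite mxE; apply: eq_bigr => i _; rewrite !mxE mulrC.
apply: WC_sum => i; apply: WCZ; apply: WCD; [exact: WC_coord|exact: WC_cst].
Qed.

Lemma jacobian_affine n p (t0 : 'rV[K]_n) (P : 'M[K]_(n, p)) x :
  jacobian (fun v => (v - t0) *m P) x = P.
Proof. by apply/matrixP => a j; rewrite mxE (wd_pz a (wd_affine t0 P x j)). Qed.

Lemma hess_affine n p (t0 : 'rV[K]_n) (P : 'M[K]_(n, p)) x xi :
  hess (fun v => (v - t0) *m P) x xi = 0.
Proof.
apply/rowP => j; rewrite !mxE; apply: big1 => a _; apply: big1 => b _.
rewrite (_ : pz a _ = fun=> P a j).
  by rewrite (wd_pz b (wd_cst (P a j) x)) !mul0r.
by apply/funext => y; rewrite (wd_pz a (wd_affine t0 P y j)).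
Qed.

Lemma eq_hess n m (U : set 'rV[K]_n) (F G : 'rV[K]_n -> 'rV[K]_m) x xi : open U ->
  (forall y, U y -> F y = G y) -> U x -> hess F x xi = hess G x xi.
Proof.
move=> oU FG Ux; apply/rowP => j; rewrite !mxE; apply: eq_bigr => a _.
apply: eq_bigr => b _.
have e y : U y -> pz a (fun y => F y 0 j) y = pz a (fun y => G y 0 j) y.
  by move=> Uy; exact: (eq_pz oU a (fun z Uz => congr1 (fun v : 'rV[K]_m => v 0 j) (FG z Uz)) Uy).
by rewrite (eq_pz oU b e Ux).
Qed.

Lemma eq_jacobian n m (U : set 'rV[K]_n) (F G : 'rV[K]_n -> 'rV[K]_m) x : open U ->
  (forall y, U y -> F y = G y) -> U x -> jacobian F x = jacobian G x.
Proof.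
move=> oU FG Ux; apply: near_jacobian.
exact: (@filterS _ _ (nbhs_filter x) _ _ FG (open_near oU Ux)).
Qed.

(** Second-order chain rule, that is, functoriality of the push-forward of 2-jets. *)
Lemma hess_comp n m q (U : set 'rV[K]_n) (V : set 'rV[K]_m)
    (s : 'rV[K]_n -> 'rV[K]_m) (F : 'rV[K]_m -> 'rV[K]_q) x xi :
  open U -> open V -> (forall y, U y -> V (s y)) -> hol_map U s -> hol_map V F -> U x ->
  hess (fun y => F (s y)) x xi =
  hess s x xi *m jacobian F (s x) + hess F (s x) (xi *m jacobian s x).
Proof.
move=> oU oV UV hs hF Ux; apply/rowP => j; rewrite !mxE.
have E a y : U y -> pz a (fun y => F (s y) 0 j) y =
    \sum_i pz a (fun y => s y 0 i) y * pz i (fun y => F y 0 j) (s y).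
  move=> Uy; rewrite (wd_pz a (wd_comp_hol (hol_wd oV (hF j) (UV _ Uy))
    (fun i => hol_wd oU (hs i) Uy))).
  by apply: eq_bigr => i _; rewrite mulrC.
have D a b : pz b (pz a (fun y => F (s y) 0 j)) x = \sum_i
   (pz b (pz a (fun y => s y 0 i)) x * pz i (fun y => F y 0 j) (s x)
    + pz a (fun y => s y 0 i) x *
      \sum_k pz k (pz i (fun y => F y 0 j)) (s x) * pz b (fun y => s y 0 k) x).
  rewrite (eq_pz oU b (E a) Ux).
  rewrite (wd_pz b (wd_sum (index_enum _) (fun i =>
    wdM (hol_wd oU (hol_pz KS a oU (hs i)) Ux)
     (wd_comp_hol (hol_wd oV (hol_pz KS i oV (hF j)) (UV _ Ux))
       (fun k => hol_wd oU (hs k) Ux))))).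
  by apply: eq_bigr => i _; rewrite addrC.
have -> : \sum_a \sum_b pz b (pz a (fun y => F (s y) 0 j)) x * xi 0 b * xi 0 a =
    \sum_i \sum_a \sum_b (pz b (pz a (fun y => s y 0 i)) x * xi 0 b * xi 0 a
       * pz i (fun y => F y 0 j) (s x)
     + (\sum_k pz k (pz i (fun y => F y 0 j)) (s x) * (xi 0 b * pz b (fun y => s y 0 k) x))
       * (xi 0 a * pz a (fun y => s y 0 i) x)).
  rewrite [RHS]exchange_big/=; apply: eq_bigr => a _.
  under eq_bigr => b _ do rewrite D !mulr_suml.
  rewrite exchange_big/=; apply: eq_bigr => i _; apply: eq_bigr => b _.
  set A := pz b _ x; set B := pz i _ _; set G := pz a _ x.
  have <- : (\sum_k pz k (pz i (fun y => F y 0 j)) (s x) *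
    pz b (fun y => s y 0 k) x) * xi 0 b = \sum_k pz k (pz i (fun y => F y 0 j)) (s x) *
    (xi 0 b * pz b (fun y => s y 0 k) x).
    by rewrite mulr_suml; apply: eq_bigr => k _; ring.
  by ring.
rewrite -big_split/=; apply: eq_bigr => i _.
under eq_bigr => a _ do rewrite big_split/=.
rewrite big_split/=; congr (_ + _).
  rewrite !mxE mulr_suml; apply: eq_bigr => a _; rewrite mulr_suml.
  exact: eq_bigr.
transitivity (\sum_a \sum_k pz k (pz i (fun y => F y 0 j)) (s x) *
    (xi *m jacobian s x) 0 k * (xi 0 a * pz a (fun y => s y 0 i) x)).
  apply: eq_bigr => a _; rewrite -!mulr_suml exchange_big/=; congr (_ * _).
  apply: eq_bigr => k _; rewrite mxE mulr_sumr; apply: eq_bigr => b _.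
  by rewrite mxE.
rewrite exchange_big/=; apply: eq_bigr => k _; rewrite -mulr_sumr; congr (_ * _).
by rewrite mxE; apply: eq_bigr => a _; rewrite mxE.
Qed.

(* A 2-jet whose push-forward by [F] vanishes is the push-forward of a 2-jet by
   any parametrisation [s] of the fibre of [F]. *)
Lemma vertical_jet n m p (U : set 'rV[K]_n) (O : set 'rV[K]_p)
    (F : 'rV[K]_n -> 'rV[K]_m) (s : 'rV[K]_p -> 'rV[K]_n) t0
    (K0 : 'M[K]_(p, n)) (S : 'M[K]_(m, n)) (P : 'M[K]_(n, p)) :
  open U -> open O -> O 0 -> (forall y, O y -> U (s y)) -> hol_map O s ->
  hol_map U F -> s 0 = t0 -> (forall y, O y -> F (s y) = F t0) ->
  (forall y, O y -> (s y - t0) *m P = y) ->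
  P *m K0 + jacobian F t0 *m S = 1%:M ->
  forall xi, xi *m jacobian F t0 = 0 ->
  [/\ (xi *m P) *m jacobian s 0 = xi,
      forall eta, (eta *m jacobian s 0 + hess s 0 (xi *m P)) *m jacobian F t0
         + hess F t0 xi = 0
    & forall eta, eta *m jacobian F t0 + hess F t0 xi = 0 ->
      (eta *m P) *m jacobian s 0 + hess s 0 (xi *m P) = eta].
Proof.
move=> oU oO O0 sU hs hF s0 Fs Ps PK xi xiJ.
have Pj : jacobian s 0 *m P = 1%:M.
  have := jacobian_comp oO (@openT _) hs (hol_affine t0 P) O0 I.
  rewrite jacobian_affine => <-; rewrite (eq_jacobian oO Ps O0).
  by apply/matrixP => a j; rewrite !mxE (wd_pz a (wd_coord j 0)).
have jJ : jacobian s 0 *m jacobian F t0 = 0.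
  rewrite -s0 -(jacobian_comp oO oU hs hF O0 (sU _ O0)) (eq_jacobian oO Fs O0).
  by apply/matrixP => a j; rewrite !mxE (wd_pz a (wd_cst (F t0 0 j) 0)).
(* By [PK] a vector is determined by its images under [jacobian F t0] and [P], so equalities are
   checked on these two. *)
have vert (v w : 'rV[K]_n) : v *m jacobian F t0 = w *m jacobian F t0 ->
    v *m P = w *m P -> v = w.
  by move=> e1 e2; rewrite -(mulmx1 v) -(mulmx1 w) -PK !mulmxDr !mulmxA e1 e2.
have e1 : (xi *m P) *m jacobian s 0 = xi.
  by apply: vert; rewrite -!mulmxA ?jJ ?Pj ?mulmx0 ?mulmx1// xiJ.
(* [F] is constant along [s], so every 2-jet pushed forward by [s] and then by [F] vanishes. *)
have e2 eta : (eta *m jacobian s 0 + hess s 0 (xi *m P)) *m jacobian F t0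
    + hess F t0 xi = 0.
  rewrite mulmxDl -mulmxA jJ mulmx0 add0r.
  have := hess_comp (xi *m P) oO oU sU hs hF O0.
  rewrite (eq_hess _ oO Fs O0) s0 e1 => <-.
  apply/rowP => j; rewrite !mxE; apply: big1 => a _; apply: big1 => b _.
  rewrite (_ : pz a _ = fun=> 0); first by rewrite (wd_pz b (wd_cst 0 0)) !mul0r.
  by apply/funext => y; rewrite (wd_pz a (wd_cst (F t0 0 j) y)).
split => // eta etaJ; apply: vert.
  by apply: (addIr (hess F t0 xi)); rewrite etaJ e2.
(* The affine map v -> (v - t0) P composed with [s] is the identity, hence the quadratic part of [s]
   is killed by [P]. *)
rewrite mulmxDl -mulmxA Pj mulmx1 -[RHS]addr0; congr (_ + _).
have := hess_comp (xi *m P) oO (@openT _) (fun _ _ => I) hs (hol_affine t0 P) O0.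
rewrite hess_affine jacobian_affine addr0 (eq_hess _ oO Ps O0) => <-.
apply/rowP => j; rewrite !mxE; apply: big1 => a _; apply: big1 => b _.
rewrite (_ : pz a _ = fun=> (a == j)%:R).
  by rewrite (wd_pz b (wd_cst (a == j)%:R 0)) !mul0r.
by apply/funext => y; rewrite (wd_pz a (wd_coord j y)).
Qed.

End VerticalJets.

Section MakeChart.
Context {R : realType} {T : topologicalType} {n : nat}.
Notation C := (complexN R).

Lemma mk_chart (D : set T) (O : set 'rV[C]_n) (f : T -> 'rV[C]_n) (g : 'rV[C]_n -> T) :
  open D -> open O -> (forall x, D x -> O (f x)) -> (forall t, O t -> D (g t)) ->
  (forall x, D x -> g (f x) = x) -> (forall t, O t -> f (g t) = t) ->
  (forall x, D x -> cont_at f x) -> (forall t, O t -> cont_at g t) ->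
  exists e : chart R T n, [/\ cdom e = D, ci e = O & cinvC e = g].
Proof.
move=> oD oO fO gD gf fg cf cg.
by exists (@Chart R T n D O f g oD oO fO gD gf fg cf cg).
Qed.

End MakeChart.

Section FiberChart.
Context {R : realType} {n m : nat} {X : complexManifold R n} {B : complexManifold R m}.
Notation C := (complexN R).
Implicit Types (c : chart R X n) (d : chart R B m).
Variable p : X -> B.
Hypothesis cp : continuous p.
Hypothesis hp : forall c d, atlas X c -> atlas B d -> hol_map (domC p c d) (repC p c d).
Hypothesis sp : forall c d, atlas X c -> atlas B d -> forall t, domC p c d t ->
  row_full (jacobian (repC p c d) t).

Lemma cont_fiber_incl z : continuous (fiber_incl p z).
Proof. exact: (@initial_continuous _ X set_val). Qed.

Lemma cont_into_fiber z (T : topologicalType) (f : T -> fiber p z) y :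
  cont_at (fun u => fiber_incl p z (f u)) y -> cont_at f y.
Proof.
move=> cf U [_ [[W oW <-] /= Wx sWU]].
have := cf W (open_nbhs_nbhs (conj oW Wx)).
by apply: (@filterS _ _ (nbhs_filter y)) => u; exact: sWU.
Qed.

Lemma fiber_rep z (e : chart R (fiber p z) (n - m)) (s : 'rV[C]_(n - m) -> 'rV[C]_n)
    (c d : chart R X n) y :
  (forall y, ci e y -> ci c (s y) /\ fiber_incl p z (cinvC e y) = cinvC c (s y)) ->
  domC (fiber_incl p z) e d y ->
  domC (idfun : X -> X) c d (s y) /\
  repC (fiber_incl p z) e d y = repC (idfun : X -> X) c d (s y).
Proof.
move=> He [ey dy]; have [cs E] := He y ey; split.
  by split => //=; rewrite -[cinv c _]/(cinvC c (s y)) -E.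
by rewrite /repC /rep /= -[cinv c _]/(cinvC c (s y)) -E.
Qed.

(** [s] is the inverse of the fibre chart read in the ambient chart [c]; in any other chart [d] the
    inclusion is [s] followed by a transition map. *)
Lemma fiber_jacobian z (e : chart R (fiber p z) (n - m)) (s : 'rV[C]_(n - m) -> 'rV[C]_n)
    (c d : chart R X n) :
  atlas X c -> atlas X d -> hol_map (ci e) s ->
  (forall y, ci e y -> ci c (s y) /\ fiber_incl p z (cinvC e y) = cinvC c (s y)) ->
  hol_map (domC (fiber_incl p z) e d) (repC (fiber_incl p z) e d) /\
  forall y, domC (fiber_incl p z) e d y -> jacobian (repC (fiber_incl p z) e d) y =
    jacobian s y *m jacobian (repC (idfun : X -> X) c d) (s y).
Proof.
move=> Ac Ad hs He.
have oe := open_domC e d (@cont_fiber_incl z).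
have oc := open_domC c d (@continuous_idfun X).
have ht := transition_hol Ac Ad.
have hs' : hol_map (domC (fiber_incl p z) e d) s.
  by move=> j; apply: (hol_sub (U := ci e)); [move=> y []|exact: hs].
have dU y dy := (fiber_rep (d := d) (y := y) He dy).1.
have E y dy := (fiber_rep (d := d) (y := y) He dy).2.
split.
  move=> j; refine (eq_hol oe _ (hol_comp oe oc dU (ht j) hs')) => y dy.
  by rewrite E.
move=> y dy; rewrite (eq_jacobian oe E dy).
exact: (jacobian_comp oe oc hs' ht dy (dU y dy)).
Qed.

(* The parametrisation of the fibre given by the implicit function theorem is
   inverse to the linear projection P of the ambient coordinates onto ker dF. *)
Lemma fiber_chart c0 d0 x : atlas X c0 -> atlas B d0 -> cdom c0 x -> cdom d0 (p x) ->
  let t0 := cmap c0 x : 'rV[C]_n in let F := repC p c0 d0 in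
  exists (e : chart R (fiber p (p x)) (n - m)) (s : 'rV[C]_(n - m) -> 'rV[C]_n)
    (K0 : 'M[C]_(n - m, n)) (S : 'M[C]_(m, n)) (P : 'M[C]_(n, n - m)),
  [/\ [/\ fiber_atlas p (p x) e, ci e 0, s 0 = t0 & hol_map (ci e) s],
     forall y, ci e y -> ci c0 (s y) /\ fiber_incl p (p x) (cinvC e y) = cinvC c0 (s y),
     forall y, ci e y -> [/\ domC p c0 d0 (s y), F (s y) = F t0 & (s y - t0) *m P = y]
   & P *m K0 + jacobian F t0 *m S = 1%:M].
Proof.
move=> A0 B0 cx dx t0 F; pose U := domC p c0 d0.
have oU : open U by exact: open_domC.
have hF : hol_map U F by exact: hp.
have Ut0 : U t0 by split; [exact: cmap_img|rewrite /= cmapK].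
have [K0 [S [P [K0J SJ K0P SP PK]]]] := split_kernel (sp A0 B0 Ut0).
have [V [N [s [[oV O0 oN Nt0 NU] HO HN hs]]]] := implicit_param (@complex_strict R)
  (@complex_compact_disc R) (@complex_attains_min R) oU hF Ut0 K0J SJ K0P SP PK.
have sU y : V y -> U (s y) by move=> /HO[/NU].
have pFt0 : cinv d0 (F t0) = p x by rewrite /F (repC_inv Ut0) cmapK.
have cs y : V y -> cont_at s y.
  by move=> Oy; apply: cont_mx => i j; rewrite ord1; exact: (smooth_cont (hs j).1 Oy).
have s0 : s 0 = t0.
  by have [_] := HN t0 Nt0 erefl; rewrite subrr mul0mx.
(* Lifts [s] to the fibre, a subtype of [X]; outside [V] the value is the base point [x]. *)
have /choice[g gE] y : exists x' : fiber p (p x), V y ->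
    fiber_incl p (p x) x' = cinvC c0 (s y).
  have [Oy|nO] := pselect (V y); last first.
    by exists (exist _ x (mem_set (erefl (p x)))).
  have pE : p (cinvC c0 (s y)) = p x.
    by have [_ Fs _] := HO _ Oy; rewrite -[LHS](repC_inv (sU y Oy)) -pFt0 -Fs.
  by exists (exist _ (cinvC c0 (s y)) (mem_set pE)).
pose inc := fiber_incl p (p x).
pose cm x' : 'rV[C]_n := cmap c0 (inc x').
pose D : set (fiber p (p x)) := [set x' | cdom c0 (inc x') /\ N (cm x')].
have pinc x' : p (inc x') = p x.
  by case: x' => v Hv /=; exact: (set_mem Hv).
have Fcm x' : D x' -> F (cm x') = F t0.
  move=> [cx' Nx']; rewrite /F /repC /rep /cm cmapK// pinc.
  by rewrite /t0 cmapK.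
have Dinv y : V y -> D (g y) /\ cm (g y) = s y.
  move=> Oy; have e : cm (g y) = s y.
    by rewrite /cm /inc (gE _ Oy) -[LHS]/(cmap c0 (cinv c0 (s y))) cinvK//; have [] := sU y Oy.
  split => //; split; last by rewrite e; have [] := HO _ Oy.
  by rewrite /inc (gE _ Oy); apply: cinv_dom; have [] := sU y Oy.
have incI : injective inc by exact: val_inj.
have gK x' : D x' -> g ((cm x' - t0) *m P) = x'.
  move=> Dx'; have [Oy sE] := HN _ Dx'.2 (Fcm _ Dx').
  apply: incI; rewrite /inc (gE _ Oy) sE.
  by rewrite -[LHS]/(cinv c0 (cmap c0 (inc x'))) cmapK//; exact: Dx'.1.
have cinc x' : cont_at inc x' by exact: cont_fiber_incl.
have ccm x' : D x' -> cont_at cm x'.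
  move=> Dx'; apply: (@continuous_comp _ _ _ inc (cmap c0 : X -> 'rV[C]_n)) (cinc x') _.
  exact: (cont_cmap Dx'.1).
have oD : open D.
  rewrite openE => x' Dx'.
  have n1 : \forall y \near x', cdom c0 (inc y).
    apply: (cinc x'); apply: open_nbhs_nbhs; split; [exact: cdom_open|exact: Dx'.1].
  have n2 : \forall y \near x', N (cm y) := ccm x' Dx' _ (open_near oN Dx'.2).
  exact: (@filterI _ _ (nbhs_filter x') _ _ n1 n2).
have cf x' : D x' -> cont_at (fun x' => (cm x' - t0) *m P) x'.
  move=> Dx'; refine (cont_mulmx (G := fun=> P) _ _); last exact: cst_continuous.
  refine (cont_addmx (ccm x' Dx') _); exact: cst_continuous.
have cg y : V y -> cont_at g y.
  move=> Oy; apply: cont_into_fiber.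
  apply: (cont_near_eq (f := fun y => cinvC c0 (s y))).
    by apply: (@filterS _ _ (nbhs_filter y) _ _ _ (open_near oV Oy)) => u /gE ->.
  apply: (@continuous_comp _ _ _ s (cinvC c0)); first exact: cs.
  by apply: cont_cinv; have [] := sU y Oy.
have fO x' : D x' -> V ((cm x' - t0) *m P).
  by move=> Dx'; have [] := HN _ Dx'.2 (Fcm _ Dx').
have fg y : V y -> (cm (g y) - t0) *m P = y.
  by move=> Oy; rewrite (Dinv y Oy).2; have [] := HO _ Oy.
have [e [eD eO eg]] := mk_chart oD oV fO (fun y Oy => (Dinv y Oy).1) gK fg cf cg.
have He y : ci e y -> ci c0 (s y) /\ inc (cinvC e y) = cinvC c0 (s y).
  by rewrite eO eg => Oy; split; [have [] := sU y Oy|exact: gE].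
have hse : hol_map (ci e) s by rewrite eO.
exists e, s, K0, S, P; split => //; last 1 first.
- by move=> y; rewrite eO => Oy; have [] := HO _ Oy; have := sU y Oy.
split => //; last by rewrite eO.
move=> d Ad; have [hi ji] := fiber_jacobian A0 Ad hse He.
have oe := open_domC e d (@cont_fiber_incl (p x)).
split; first exact/(holomorphic_mapE _ oe).
move=> y dy; have Oy : V y by rewrite -eO; case: dy.
rewrite (jacE oe hi dy) (ji y dy).
have [ty _] := fiber_rep (d := d) He dy.
(* The inclusion has a retraction in coordinates: return to [c0] by the inverse transition, then
   apply the projection, which inverts [s]. *)
apply/row_freeP; exists (jacobian (repC (idfun : X -> X) d c0) (repC (idfun : X -> X) c0 d (s y)) *m P).
rewrite mulmxA -(mulmxA (jacobian s y)) (transition_jacK A0 Ad ty) mulmx1.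
have Ps u : V u -> (s u - t0) *m P = u by move=> /HO[].
have := jacobian_comp oV (@openT _) hs (hol_affine t0 P) Oy I.
rewrite jacobian_affine => <-; rewrite (eq_jacobian oV Ps Oy).
exact: jacobian_id.
Qed.

End FiberChart.

Section FiberMetric.
Context {R : realType} {n m : nat} {X : complexManifold R n} {B : complexManifold R m}.
Notation C := (complexN R).
Variable p : X -> B.
Hypothesis cp : continuous p.
Hypothesis hp : forall c d, atlas X c -> atlas B d -> hol_map (domC p c d) (repC p c d).
Hypothesis sp : forall c d, atlas X c -> atlas B d -> forall t, domC p c d t ->
  row_full (jacobian (repC p c d) t).
Variable w : coeffs R X n.
Hypothesis wP : mform w.

(** Compatibility of [w] replaces the ambient charts chosen point by point in [fiber_restr] by the
    single chart [c]. *)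
Lemma fiber_restrE z (e : chart R (fiber p z) (n - m)) (s : 'rV[C]_(n - m) -> 'rV[C]_n)
    (c : chart R X n) : atlas X c -> hol_map (ci e) s ->
  (forall y, ci e y -> ci c (s y) /\ fiber_incl p z (cinvC e y) = cinvC c (s y)) ->
  forall y, ci e y -> (fiber_restr p w z e y : 'M[C]_(n - m)) =
    pull (jacobian s y) (w c (s y) : 'M[C]_n).
Proof.
move=> Ac hs He y ey; have [compat _ _ _] := wP.
set d := chart_at X (fiber_incl p z (cinvC e y)).
have Ad : atlas X d := chart_at_atlas _.
have dy : domC (fiber_incl p z) e d y by split => //; exact: chart_at_dom.
have [hi ji] := fiber_jacobian Ac Ad hs He.
have [dt E] := fiber_rep (d := d) He dy.
have oe := open_domC e d (@cont_fiber_incl _ _ _ X B p z).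
rewrite (compat _ _ Ac Ad _ dt) -pull_comp -(ji y dy) -E.
by rewrite -(jacE oe hi dy).
Qed.

(** Dictionary between the jets of the fibre at the origin of its chart and the jets at [t0] killed
    by [F]: [P] carries the latter to the former, preserving norms and Levi forms. The fourth clause
    lifts an arbitrary [eta] of the fibre, as the positive case demands; the last one treats all
    vertical jets, as the negative case demands. *)
Lemma vertical_metric c0 d0 x : atlas X c0 -> atlas B d0 -> cdom c0 x -> cdom d0 (p x) ->
  let t0 := cmap c0 x : 'rV[C]_n in let F := repC p c0 d0 in
  exists (e : chart R (fiber p (p x)) (n - m)) (s : 'rV[C]_(n - m) -> 'rV[C]_n)
    (P : 'M[C]_(n, n - m)),
  let h : 'rV[C]_(n - m) -> 'M[C]_(n - m) := fiber_restr p w (p x) e in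
  [/\ [/\ fiber_atlas p (p x) e, ci e 0, forall y, ci e y -> hermitian (h y)
        & forall a b, smooth (ci e) (fun y => h y a b)],
      forall xi : 'rV[C]_n, xi *m jacobian F t0 = 0 -> hq (h 0) (xi *m P) = hq (w c0 t0 : 'M[C]_n) xi,
      forall xi : 'rV[C]_n, xi *m jacobian F t0 = 0 -> xi *m P = 0 -> xi = 0,
      forall xi : 'rV[C]_n, xi *m jacobian F t0 = 0 -> forall eta, exists eta' : 'rV[C]_n,
        eta' *m jacobian F t0 + hess F t0 xi = 0 /\
        levi (w c0 : 'rV[C]_n -> 'M[C]_n) t0 xi eta' = levi h 0 (xi *m P) eta
    & forall xi eta : 'rV[C]_n, xi *m jacobian F t0 = 0 -> eta *m jacobian F t0 + hess F t0 xi = 0 ->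
        levi (w c0 : 'rV[C]_n -> 'M[C]_n) t0 xi eta = levi h 0 (xi *m P) (eta *m P)
        /\ (eta *m P = 0 -> xi = 0 -> eta = 0)].
Proof.
move=> A0 B0 cx dx t0 F; have [compat sm herm _] := wP.
have [e [s [K0 [S [P [[Ae e0 s0 hs] He Hs PK]]]]]] := fiber_chart cp hp sp A0 B0 cx dx.
exists e, s, P => h.
have hE : forall y, ci e y -> h y = pull (jacobian s y) (w c0 (s y) : 'M[C]_n).
  exact: fiber_restrE.
have sc y : ci e y -> ci c0 (s y) by move=> /He[].
have sh : forall a b, smooth (ci e) (fun y => h y a b).
  move=> a b; refine (eq_smooth (open_ci e) (fun y ey => esym (congr1
    (fun M : 'M[C]_(n - m) => M a b) (hE y ey))) _).
  exact: (smooth_pull (b := w c0 : 'rV[C]_n -> 'M[C]_n) (open_ci e) sc hs (sm c0 A0)).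
have jets := vertical_jet (complex_schwarz (R := R)) (open_domC c0 d0 cp) (open_ci e) e0
  (fun y ey => let: And3 H _ _ := Hs y ey in H) hs (hp A0 B0) s0
  (fun y ey => let: And3 _ H _ := Hs y ey in H)
  (fun y ey => let: And3 _ _ H := Hs y ey in H) PK.
have lev xi eta : levi h 0 xi eta = levi (w c0 : 'rV[C]_n -> 'M[C]_n) t0
    (xi *m jacobian s 0) (eta *m jacobian s 0 + hess s 0 xi).
  rewrite (esym s0 : t0 = s 0).
  exact: (levi_pull (complex_schwarz (R := R)) (open_ci e) (open_ci c0) sc hs xi eta
    (sm c0 A0) hE sh e0).
split.
- split => //; move=> y ey; rewrite (hE y ey); apply: pull_hermitian.
  by apply: herm => //; exact: sc.
- by move=> xi xiJ; have [e1 _ _] := jets xi xiJ; rewrite (hE 0 e0) hq_pull e1 s0.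
- by move=> xi xiJ xiP; have [<- _ _] := jets xi xiJ; rewrite xiP mul0mx.
- move=> xi xiJ eta; have [e1 e2 _] := jets xi xiJ.
  by exists (eta *m jacobian s 0 + hess s 0 (xi *m P)); rewrite e2 lev e1.
move=> xi eta xiJ etaJ; have [e1 _ e3] := jets xi xiJ.
split; first by rewrite lev e1 e3.
move=> eP xi0; rewrite -(e3 eta etaJ) eP mul0mx add0r xi0 mul0mx.
by apply/rowP => j; rewrite !mxE; apply: big1 => a _; apply: big1 => b _; rewrite !mxE !mulr0.
Qed.

End FiberMetric.

(** * The total space *)

Section LeviForm.
Context {R : realType} {n : nat} {X : complexManifold R n}.
Notation C := (complexN R).
Implicit Types (c : chart R X n) (w : coeffs R X n).

Definition levi_positive_at w x := forall c, atlas X c -> cdom c x ->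
  forall xi eta : 'rV[C]_n, (xi != 0) || (eta != 0) ->
  0 < levi (w c : 'rV[C]_n -> 'M[C]_n) (cmap c x) xi eta.

Definition levi_indefinite_at w x := forall c, atlas X c -> cdom c x ->
  pos_def (w c (cmap c x) : 'M[C]_n) /\
  forall xi : 'rV[C]_n, xi != 0 -> exists eta : 'rV[C]_n,
  levi (w c : 'rV[C]_n -> 'M[C]_n) (cmap c x) xi eta < 0.

Lemma levi_transition w c c0 t (xi eta : 'rV[C]_n) : mform w -> atlas X c -> atlas X c0 ->
  domC (idfun : X -> X) c c0 t ->
  let T := repC (idfun : X -> X) c c0 in
  levi (w c : 'rV[C]_n -> 'M[C]_n) t xi eta =
  levi (w c0 : 'rV[C]_n -> 'M[C]_n) (T t) (xi *m jacobian T t)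
    (eta *m jacobian T t + hess T t xi).
Proof.
move=> [compat sm _ _] Ac A0 dt T.
have sw a b : smooth (domC (idfun : X -> X) c c0) (fun y => w c y a b : C).
  by apply: (smooth_sub (U := ci c)); [move=> y []|exact: sm].
exact: (levi_pull (complex_schwarz (R := R)) (open_domC c c0 (@continuous_idfun X))
  (open_ci c0) (fun y => @repC_ci _ _ _ _ _ (idfun : X -> X) c c0 y) (transition_hol Ac A0)
  xi eta (sm c0 A0) (compat c c0 Ac A0) sw dt).
Qed.

Lemma hess0 p (F : 'rV[C]_n -> 'rV[C]_p) t : hess F t 0 = 0.
Proof.
by apply/rowP => j; rewrite !mxE; apply: big1 => a _; apply: big1 => b _; rewrite !mxE !mulr0.
Qed.

Section Transfer.
Variables (w : coeffs R X n) (c c0 : chart R X n) (x : X).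
Hypotheses (wP : mform w) (Ac : atlas X c) (A0 : atlas X c0) (cx : cdom c x) (c0x : cdom c0 x).
Let T := repC (idfun : X -> X) c c0.
Let t : 'rV[C]_n := cmap c x.

Lemma transition_point : domC (idfun : X -> X) c c0 t /\ T t = cmap c0 x.
Proof.
by split; [split; [exact: cmap_img|rewrite /= cmapK]|rewrite /T /repC /rep cmapK].
Qed.

Lemma transition_unit : jacobian T t \in unitmx.
Proof. by have [H _] := mulmx1_unit (transition_jacK Ac A0 transition_point.1). Qed.

Lemma transition_inj (v : 'rV[C]_n) : v *m jacobian T t = 0 -> v = 0.
Proof. by move=> e; rewrite -(mulmxK transition_unit v) e mul0mx. Qed.

End Transfer.

(** A transition map acts bijectively on 2-jets, so positivity in one chart around the point gives
    it in all of them. *)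
Lemma levi_positive_transfer w c0 x : mform w -> atlas X c0 -> cdom c0 x ->
  (forall xi eta : 'rV[C]_n, (xi != 0) || (eta != 0) ->
    0 < levi (w c0 : 'rV[C]_n -> 'M[C]_n) (cmap c0 x) xi eta) ->
  levi_positive_at w x.
Proof.
move=> wP A0 c0x H c Ac cx xi eta nz.
have [dt Tt] := transition_point cx c0x.
rewrite (levi_transition xi eta wP Ac A0 dt) Tt; apply: H.
apply: contraT; rewrite negb_or !negbK => /andP[/eqP xi0 /eqP eta0].
have e1 := transition_inj Ac A0 cx c0x xi0; move: eta0; rewrite e1 hess0 addr0 => eta0.
by move: nz; rewrite e1 (transition_inj Ac A0 cx c0x eta0) eqxx.
Qed.

Lemma levi_indefinite_transfer w c0 x : mform w -> atlas X c0 -> cdom c0 x ->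
  pos_def (w c0 (cmap c0 x) : 'M[C]_n) ->
  (forall xi : 'rV[C]_n, xi != 0 -> exists eta : 'rV[C]_n,
    levi (w c0 : 'rV[C]_n -> 'M[C]_n) (cmap c0 x) xi eta < 0) ->
  levi_indefinite_at w x.
Proof.
move=> wP A0 c0x pw H c Ac cx.
have [dt Tt] := transition_point cx c0x.
have nzT (xi : 'rV[C]_n) : xi != 0 -> xi *m jacobian (repC (idfun : X -> X) c c0) (cmap c x) != 0.
  by apply: contra => /eqP /(transition_inj Ac A0 cx c0x) ->.
split.
  move=> xi xi0; have [compat _ _ _] := wP.
  by rewrite (compat c c0 Ac A0 _ dt) hq_pull Tt; apply: pw; exact: nzT.
move=> xi xi0; have [eta Heta] := H _ (nzT xi xi0).
(* Chosen so that the push-forward by the transition map has second component [eta]. *)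
exists ((eta - hess (repC (idfun : X -> X) c c0) (cmap c x) xi) *m
  invmx (jacobian (repC (idfun : X -> X) c c0) (cmap c x))).
rewrite (levi_transition xi _ wP Ac A0 dt) mulmxKV; last exact: transition_unit.
by rewrite subrK Tt.
Qed.

Lemma negative_metric w : mform w -> (forall x, levi_positive_at w x) ->
  kahler_metric w /\ negative_hsc (atlas X) w.
Proof.
move=> wP H; have [_ sm herm _] := wP.
have key c t : atlas X c -> ci c t -> pos_def (w c t : 'M[C]_n) /\
    forall xi : 'rV[C]_n, xi != 0 ->
    quart (w c : 'rV[C]_n -> 'M[C]_n) t xi / hq (w c t : 'M[C]_n) xi ^+ 2 < 0.
  move=> Ac ct; apply: (levi_neg (open_ci c) ct (herm c Ac) (sm c Ac)) => xi eta nz.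
  by have := H (cinv c t) c Ac (cinv_dom ct) xi eta nz; rewrite cinvK.
split; first split; first exact/mformE.
  by move=> c Ac t ct xi nz; exact: (key c t Ac ct).1.
move=> c Ac t ct xi nz.
by rewrite (hscE xi (open_ci c) (sm c Ac) ct); exact: (key c t Ac ct).2.
Qed.

Lemma positive_metric w : mform w -> (forall x, levi_indefinite_at w x) ->
  kahler_metric w /\ positive_hsc (atlas X) w.
Proof.
move=> wP H; have [_ sm herm _] := wP.
have key c t : atlas X c -> ci c t -> pos_def (w c t : 'M[C]_n) /\
    forall xi : 'rV[C]_n, xi != 0 -> exists eta : 'rV[C]_n,
    levi (w c : 'rV[C]_n -> 'M[C]_n) t xi eta < 0.
  by move=> Ac ct; have := H (cinv c t) c Ac (cinv_dom ct); rewrite cinvK.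
split; first split; first exact/mformE.
  by move=> c Ac t ct xi nz; exact: (key c t Ac ct).1.
move=> c Ac t ct xi nz; have [pw lw] := key c t Ac ct.
rewrite (hscE xi (open_ci c) (sm c Ac) ct).
exact: (levi_pos (open_ci c) ct (herm c Ac) (sm c Ac) pw lw).
Qed.

End LeviForm.

Section TotalSpace.
Context {R : realType} {n m : nat} {X : complexManifold R n} {B : complexManifold R m}.
Notation C := (complexN R).
Variable p : X -> B.
Hypothesis cp : continuous p.
Hypothesis hp : forall (c : chart R X n) (d : chart R B m),
  atlas X c -> atlas B d -> hol_map (domC p c d) (repC p c d).
Hypothesis sp : forall (c : chart R X n) (d : chart R B m), atlas X c -> atlas B d ->
  forall t, domC p c d t -> row_full (jacobian (repC p c d) t).
Variables (w : coeffs R X n) (wB : coeffs R B m).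
Hypotheses (wP : mform w) (wBP : mform wB).
Hypothesis fiber_pos : forall z, form_positive (fiber_atlas p z) (fiber_restr p w z).
Hypothesis base_pos : form_positive (atlas B) wB.

Definition total (k : C) : coeffs R X n := fun c t =>
  (w c t : 'M[C]_n) + k *: (pull_form p wB c t : 'M[C]_n) : 'M[C]_n.

Lemma near_pull (c0 : chart R X n) x (Q : 'rV[C]_n -> C -> Prop) : cdom c0 x ->
  (\forall t \near (cmap c0 x : 'rV[C]_n) & k \near (pinfty_nbhs C), Q t k) ->
  \forall x' \near x & k \near (pinfty_nbhs C), Q (cmap c0 x') k.
Proof.
move=> cx [[A D] [nA nD] AD]; exists ([set x' | A (cmap c0 x')], D).
  by split => //; exact: (cont_cmap cx nA).
by move=> [x' k] [/= Ax' Dk]; exact: (AD (cmap c0 x' : 'rV[C]_n, k)).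
Qed.

Lemma near_chart (c0 : chart R X n) (d0 : chart R B m) x : cdom c0 x -> cdom d0 (p x) ->
  \forall x' \near x & k \near (pinfty_nbhs C),
  [/\ cdom c0 x', domC p c0 d0 (cmap c0 x') & k \is Num.real].
Proof.
move=> cx dx; exists ([set x' | cdom c0 x' /\ cdom d0 (p x')], [set k : C | k \is Num.real]).
  split.
    have n1 : \forall x' \near x, cdom c0 x'.
      by apply: open_nbhs_nbhs; split; [exact: cdom_open|].
    have n2 : \forall x' \near x, cdom d0 (p x').
      exact: (cp (open_nbhs_nbhs (conj (cdom_open d0) dx))).
    exact: (@filterI _ _ (nbhs_filter x) _ _ n1 n2).
  exists 0; split; first exact: real0.
  by move=> k k0; exact: gtr0_real.
move=> [x' k] [/= [cx' dx'] kr]; split => //; split; first exact: cmap_img.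
by rewrite /= cmapK.
Qed.

Lemma total_mform k : k \is Num.real -> mform (total k).
Proof. by move=> kr; exact: (mform_comb kr wP (mform_pull cp hp wBP)). Qed.

(** Around [t] the form [total k] has its expression in the fixed base chart [d0], and [levi]
    depends only on the germ of the metric. *)
Lemma total_near (c0 : chart R X n) (d0 : chart R B m) k t (xi eta : 'rV[C]_n) :
  atlas X c0 -> atlas B d0 -> domC p c0 d0 t ->
  let h y := (w c0 y : 'M[C]_n) + k *: pull (jacobian (repC p c0 d0) y)
    (wB d0 (repC p c0 d0 y) : 'M[C]_m) in
  (total k c0 t : 'M[C]_n) = h t /\
  levi (total k c0 : 'rV[C]_n -> 'M[C]_n) t xi eta = levi h t xi eta.
Proof.
move=> A0 B0 dt h; have E y : domC p c0 d0 y -> (total k c0 y : 'M[C]_n) = h y.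
  by move=> dy; rewrite /total (pull_formE cp hp wBP A0 B0 dy).
split; first exact: E.
exact: (eq_levi (open_domC c0 d0 cp) dt xi eta E).
Qed.

Lemma base_pos_def (d : chart R B m) : atlas B d -> forall y, ci d y ->
  pos_def (wB d y : 'M[C]_m).
Proof. by move=> Ad y dy v v0; exact: base_pos. Qed.

Let ciB (d : chart R B m) (Ad : atlas B d) : forall a b,
  smooth (ci d) (fun t => wB d t a b : C).
Proof. by have [_ H _ _] := wBP; exact: H. Qed.

Let heB (d : chart R B m) (Ad : atlas B d) : forall y, ci d y ->
  hermitian (wB d y : 'M[C]_m).
Proof. by have [_ _ H _] := wBP; exact: H. Qed.

Let hU (c : chart R X n) (d : chart R B m) (Ac : atlas X c) :
  forall y, domC p c d y -> hermitian (w c y : 'M[C]_n).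
Proof. by move=> y [cy _]; have [_ _ H _] := wP; exact: H. Qed.

Let sU (c : chart R X n) (d : chart R B m) (Ac : atlas X c) a b :
  smooth (domC p c d) (fun t => w c t a b : C).
Proof.
have [_ H _ _] := wP; apply: (smooth_sub (U := ci c)); last exact: H.
by move=> y [].
Qed.

(** The curvature hypothesis is used only for the fibre through [x] and at the point [x] itself; the
    local estimate then reaches all nearby points, including those on other fibres. *)
Lemma negative_near (x : X) :
  (forall z, negative_hsc (fiber_atlas p z) (fiber_restr p w z)) ->
  negative_hsc (atlas B) wB ->
  \forall x' \near x & k \near (pinfty_nbhs C), levi_positive_at (total k) x'.
Proof.
move=> fneg bneg; pose c0 := chart_at X x; pose d0 := chart_at B (p x).
have A0 : atlas X c0 := chart_at_atlas x.
have B0 : atlas B d0 := chart_at_atlas (p x).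
have cx : cdom c0 x := chart_at_dom x.
have dx : cdom d0 (p x) := chart_at_dom (p x).
pose t0 : 'rV[C]_n := cmap c0 x.
have Ut0 : domC p c0 d0 t0 by split; [exact: cmap_img|rewrite /= cmapK].
have [e [s [P [[Ae e0 hh sh] _ injP _ lev]]]] :=
  vertical_metric cp hp sp wP A0 B0 cx dx.
have ph := fiber_pos Ae e0.
have qh (xi : 'rV[C]_(n - m)) : xi != 0 ->
    quart (fiber_restr p w (p x) e : 'rV[C]_(n - m) -> 'M[C]_(n - m)) 0 xi /
    hq (fiber_restr p w (p x) e 0 : 'M[C]_(n - m)) xi ^+ 2 < 0.
  by move=> nz; have := fneg _ e Ae 0 e0 xi nz; rewrite (hscE xi (open_ci e) sh e0).
have qb y (xi : 'rV[C]_m) : ci d0 y -> xi != 0 ->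
    quart (wB d0 : 'rV[C]_m -> 'M[C]_m) y xi / hq (wB d0 y : 'M[C]_m) xi ^+ 2 < 0.
  by move=> dy nz; have := bneg d0 B0 y dy xi nz; rewrite (hscE xi (open_ci d0) (ciB B0) dy).
have bl (y u v : 'rV[C]_m) : ci d0 y -> (u != 0) || (v != 0) ->
    0 < levi (wB d0 : 'rV[C]_m -> 'M[C]_m) y u v.
  move=> dy; apply: (neg_levi (open_ci d0) dy (heB B0) (ciB B0) (base_pos_def B0 dy)).
  by move=> xi; exact: qb.
have vl (xi eta : 'rV[C]_n) : (xi != 0) || (eta != 0) ->
    xi *m jacobian (repC p c0 d0) t0 = 0 ->
    eta *m jacobian (repC p c0 d0) t0 + hess (repC p c0 d0) t0 xi = 0 ->
    0 < levi (w c0 : 'rV[C]_n -> 'M[C]_n) t0 xi eta.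
  move=> nz xiJ etaJ; have [-> inj] := lev xi eta xiJ etaJ.
  apply: (neg_levi (open_ci e) e0 hh sh ph qh).
  apply: contraT; rewrite negb_or !negbK => /andP[/eqP xi0 /eqP eta0].
  by move: nz; rewrite (injP xi xiJ xi0) (inj eta0 (injP xi xiJ xi0)) eqxx.
have near1 := near_pull cx (local_levi_gt0 (complex_schwarz (R := R))
  (@complex_compact_disc R) (open_domC c0 d0 cp) (open_ci d0)
  (fun y => @repC_ci _ _ _ _ _ p c0 d0 y) (hp A0 B0) (@hU c0 d0 A0) (@sU c0 d0 A0) (ciB B0) Ut0 bl vl).
apply: filterS2 near1 (near_chart cx dx) => -[x' k] /= H1 [cx' dt kr].
apply: (levi_positive_transfer (total_mform kr) A0 cx') => xi eta nz.
by rewrite (total_near k xi eta A0 B0 dt).2; exact: H1.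
Qed.

Lemma positive_near (x : X) :
  (forall z, positive_hsc (fiber_atlas p z) (fiber_restr p w z)) ->
  positive_hsc (atlas B) wB ->
  \forall x' \near x & k \near (pinfty_nbhs C), levi_indefinite_at (total k) x'.
Proof.
move=> fpos bpos; pose c0 := chart_at X x; pose d0 := chart_at B (p x).
have A0 : atlas X c0 := chart_at_atlas x.
have B0 : atlas B d0 := chart_at_atlas (p x).
have cx : cdom c0 x := chart_at_dom x.
have dx : cdom d0 (p x) := chart_at_dom (p x).
pose t0 : 'rV[C]_n := cmap c0 x.
have Ut0 : domC p c0 d0 t0 by split; [exact: cmap_img|rewrite /= cmapK].
have [e [s [P [[Ae e0 hh sh] hv injP ex _]]]] :=
  vertical_metric cp hp sp wP A0 B0 cx dx.
have ph := fiber_pos Ae e0.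
have nzP (xi : 'rV[C]_n) : xi != 0 -> xi *m jacobian (repC p c0 d0) t0 = 0 -> xi *m P != 0.
  by move=> nz xiJ; apply: contra nz => /eqP /(injP xi xiJ) ->.
have qh (xi : 'rV[C]_(n - m)) : xi != 0 -> 0 <
    quart (fiber_restr p w (p x) e : 'rV[C]_(n - m) -> 'M[C]_(n - m)) 0 xi /
    hq (fiber_restr p w (p x) e 0 : 'M[C]_(n - m)) xi ^+ 2.
  by move=> nz; have := fpos _ e Ae 0 e0 xi nz; rewrite (hscE xi (open_ci e) sh e0).
have qb (y xi : 'rV[C]_m) : ci d0 y -> xi != 0 ->
    0 < quart (wB d0 : 'rV[C]_m -> 'M[C]_m) y xi.
  move=> dy; apply: (pos_quart (base_pos_def B0 dy)) => u nz.
  by have := bpos d0 B0 y dy u nz; rewrite (hscE u (open_ci d0) (ciB B0) dy).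
have vp (xi : 'rV[C]_n) : xi != 0 -> xi *m jacobian (repC p c0 d0) t0 = 0 ->
    0 < hq (w c0 t0 : 'M[C]_n) xi.
  by move=> nz xiJ; rewrite -(hv xi xiJ); apply: ph; exact: nzP.
have vl (xi : 'rV[C]_n) : xi != 0 -> xi *m jacobian (repC p c0 d0) t0 = 0 ->
    exists eta : 'rV[C]_n,
    eta *m jacobian (repC p c0 d0) t0 + hess (repC p c0 d0) t0 xi = 0 /\
    levi (w c0 : 'rV[C]_n -> 'M[C]_n) t0 xi eta < 0.
  move=> nz xiJ; have [eta lt0] := pos_levi (open_ci e) e0 hh sh ph qh (nzP xi nz xiJ).
  by have [eta' [e1 e2]] := ex xi xiJ eta; exists eta'; rewrite e2.
have /row_fullP[M MJ] := sp A0 B0 Ut0.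
have near1 := near_pull cx (local_levi_lt0 (complex_schwarz (R := R))
  (@complex_compact_disc R) (open_domC c0 d0 cp) (open_ci d0)
  (fun y => @repC_ci _ _ _ _ _ p c0 d0 y) (hp A0 B0) (@hU c0 d0 A0) (@sU c0 d0 A0) (heB B0) (ciB B0)
  Ut0 MJ (base_pos_def B0) qb vl).
have near2 := near_pull cx (local_pos_def (complex_schwarz (R := R))
  (@complex_compact_disc R) (open_domC c0 d0 cp)
  (fun y => @repC_ci _ _ _ _ _ p c0 d0 y) (hp A0 B0) (@hU c0 d0 A0) (@sU c0 d0 A0) (ciB B0)
  Ut0 (base_pos_def B0) vp).
apply: filterS3 near1 near2 (near_chart cx dx) => -[x' k] /= H1 H2 [cx' dt kr].
apply: (levi_indefinite_transfer (total_mform kr) A0 cx') => [|xi nz].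
  by rewrite (total_near k 0 0 A0 B0 dt).1; exact: H2.
have [eta lt0] := H1 dt xi nz.
by exists eta; rewrite (total_near k xi eta A0 B0 dt).2.
Qed.

(** Near-covering compactness of [X] for the filter of large k makes the bound on k uniform over
    [X]; positive elements are real, so k can also be taken real. *)
Lemma compact_total (Q : coeffs R X n -> X -> Prop) : compact [set: X] ->
  (forall x : X, \forall x' \near x & k \near (pinfty_nbhs C), Q (total k) x') ->
  exists2 k : C, k \is Num.real & forall x, Q (total k) x.
Proof.
move=> /compact_near_coveringP cX H.
have PF : ProperFilter (pinfty_nbhs C) := @proper_pinfty_nbhs C.
have H1 : \forall k \near pinfty_nbhs C, forall x : X, Q (total k) x.
  have H1 := cX C (pinfty_nbhs C) (fun k x => Q (total k) x)
    (@filter_filter _ _ PF) (fun x _ => H x).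
  apply: filterS H1 => k Hk x; exact: Hk.
have H2 : \forall k \near pinfty_nbhs C, k \is Num.real.
  exists 0; split; first exact: real0.
  by move=> k k0; exact: gtr0_real.
have [k [Hk kr]] := filter_ex (filterI H1 H2).
by exists k.
Qed.

End TotalSpace.

Theorem theorem1p6 (R : realType) (n m : nat)
    (X : complexManifold R n) (B : complexManifold R m)
    (X_compact : compact [set: X]) (B_compact : compact [set: B])
    (p : X -> B) (p_proper : proper_map p)
    (p_holomorphic : holomorphic p) (p_submersion : submersion p)
    (omega : coeffs R X n) (omega_relative : relative_kahler p omega) :
  ((forall z : B, negative_hsc (fiber_atlas p z) (fiber_restr p omega z)) ->
   (exists wB : coeffs R B m, kahler_metric wB /\ negative_hsc (atlas B) wB) ->
   exists wX : coeffs R X n, kahler_metric wX /\ negative_hsc (atlas X) wX)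
  /\
  ((forall z : B, positive_hsc (fiber_atlas p z) (fiber_restr p omega z)) ->
   (exists wB : coeffs R B m, kahler_metric wB /\ positive_hsc (atlas B) wB) ->
   exists wX : coeffs R X n, kahler_metric wX /\ positive_hsc (atlas X) wX).
Proof.
have [cp hp0] := p_holomorphic; have [/mformE wP wpos] := omega_relative.
have hp (c : chart R X n) (d : chart R B m) (Ac : atlas X c) (Ad : atlas B d) :
    hol_map (domC p c d) (repC p c d).
  by apply/(holomorphic_mapE _ (open_domC c d cp)); exact: hp0.
have sp (c : chart R X n) (d : chart R B m) (Ac : atlas X c) (Ad : atlas B d) t
    (dt : domC p c d t) : row_full (jacobian (repC p c d) t).
  have /row_fullP[M MJ] := p_submersion _ _ Ac Ad _ dt.
  by apply/row_fullP; exists M; rewrite -(jacE (open_domC c d cp) (hp c d Ac Ad) dt).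
split=> Hf [wB [[/mformE wBP posB] hB]].
  have [k kr Hk] := compact_total (p := p) (w := omega) (wB := wB) X_compact
    (fun x => negative_near cp hp sp wP wBP wpos posB x Hf hB).
  exists (total p omega wB k).
  exact: negative_metric (total_mform cp hp wP wBP kr) Hk.
have [k kr Hk] := compact_total (p := p) (w := omega) (wB := wB) X_compact
  (fun x => positive_near cp hp sp wP wBP wpos posB x Hf hB).
exists (total p omega wB k).
exact: positive_metric (total_mform cp hp wP wBP kr) Hk.
Qed.
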